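(* Let $\Lambda\subset\mathbb{R}^n$ be an integral lattice of rank $n$ with level $N(\Lambda)$, let $m\ge0$ be an integer and let $\mathcal{B}^{\mathrm{harm}}_{2m}$ be an orthonormal basis of $\mathrm{Harm}_{2m}$. Then \[ \Theta_{m,m,\Lambda}=\sum_{h\in\mathcal{B}^{\mathrm{harm}}_{2m}}\Theta_{h,\Lambda}^2 \] is a modular form of weight $4m+n$ and level $N(\Lambda)$, and it is independent of the chosen isometric embedding $\Lambda\to\mathbb{R}^n$. Its $q$-expansion is \[ \Theta_{m,m,\Lambda}(\tau)=\sum_{k\ge0}\Bigg(\sum_{(v,w)\in\Lambda^2,\ \|v\|^2+\|w\|^2=k}p_m(\cos(\measuredangle(v,w)))\,\|v\|^{2m}\|w\|^{2m}\Bigg)q^k,\qquad q=e^{2\pi i\tau}. \] Moreover, for $m>0$, letting $\mu$ denote the minimum of $\|v\|^2$ over nonzero $v\in\Lambda$, \[ \frac{(2m)!\,2^{2m}\prod_{l=0}^{m-1}(n+4m-4-2l)}{q^{2\mu}}\,\Theta_{m,m,\Lambda}\in\mathbb{Z}[[q]]. \]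
   Context: A lattice $\Lambda\subset\mathbb{R}^n$ of rank $n$ is integral if $\|\gamma\|^2\in\mathbb{Z}$ for all $\gamma\in\Lambda$; if $\frac12A$ is a Gram matrix of a basis, the level $N(\Lambda)$ is the smallest positive integer $N$ such that $NA^{-1}$ has integer entries and even diagonal. $A_{2m}$ denotes homogeneous polynomials of degree $2m$ in $\mathbb{R}[x_1,\dots,x_n]$ with the positive definite pairing $\langle g,f\rangle=g(\partial/\partial x_1,\dots,\partial/\partial x_n)f|_{x=0}$ (orthonormality refers to it); $\mathrm{Harm}_{2m}\subset A_{2m}$ is the space of harmonic polynomials. $\Theta_{h,\Lambda}(\tau)=\sum_{\lambda\in\Lambda}h(\lambda)e^{2\pi i\|\lambda\|^2\tau}$. The polynomial $p_m$ is $p_m(c)=\sum_{k=0}^m\frac{(-1)^k c^{2m-2k}}{(2m-2k)!\,k!\,2^k\prod_{l=0}^{k-1}(n+4m-4-2l)}$, and $\cos(\measuredangle(v,w))=\langle v,w\rangle/(\|v\|\|w\|)$. When $v=0$ or $w=0$ the summand $p_m(\cos(\measuredangle(v,w)))\|v\|^{2m}\|w\|^{2m}$ is interpreted as $0$ if $m\ge1$ and as $1$ if $m=0$ (equivalently, as $\sum_{k=0}^m\frac{(-1)^k\langle v,w\rangle^{2m-2k}\|v\|^{2k}\|w\|^{2k}}{(2m-2k)!k!2^k\prod_{l=0}^{k-1}(n+4m-4-2l)}$). *)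

(* Defs.v *)
From HB Require Import structures.
From mathcomp Require Import all_boot all_order all_algebra.
From mathcomp Require Import finmap.
From mathcomp Require Import all_classical all_reals all_analysis.
From mathcomp Require Export complex.
(* The notations of [mpoly] clash with those of MathComp-Analysis. *)
From mathcomp.multinomials Require Export -(notations) mpoly.
From mathcomp.analysis.showcase Require summability.

Set Implicit Arguments.
Unset Strict Implicit.
Unset Printing Implicit Defensive.

Import Order.TTheory GRing.Theory Num.Theory.
Import numFieldNormedType.Exports.

Local Open Scope classical_set_scope.
Local Open Scope ring_scope.

Section Euclidean.
Context {R : realType} {n : nat}.
Implicit Types (v w : 'rV[R]_n) (L : set 'rV[R]_n).

Definition dot v w : R := \sum_i v 0 i * w 0 i.

(* [`|v|] on ['rV[R]_n] is the sup norm. *)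
Definition enorm v : R := Num.sqrt (dot v v).

Definition cos_angle v w : R := dot v w / (enorm v * enorm w).

Definition lattice_basis L (B : 'M[R]_n) : Prop :=
  B \in unitmx /\ L = [set v | exists z : 'rV[int]_n, v = map_mx intr z *m B].

Definition full_rank_lattice L : Prop := exists B, lattice_basis L B.

Definition integral_lattice L : Prop :=
  forall v, L v -> enorm v ^+ 2 \is a Num.int.

Definition even_mx (M : 'M[R]_n) : Prop :=
  (forall i j, M i j \is a Num.int) /\
  (forall i, exists k : int, M i i = (2 * k)%:~R).

(* A basis [B] (as rows) has Gram matrix [B *m B^T], which is [1/2 *: A]. *)
Definition basis_level (B : 'M[R]_n) (N : nat) : Prop :=
  let A := 2 *: (B *m B^T) in
  [/\ (0 < N)%N, even_mx (N%:R *: invmx A) &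
      forall N' : nat, (0 < N')%N -> even_mx (N'%:R *: invmx A) -> (N <= N')%N].

(* The level does not depend on the basis. *)
Definition lattice_level L (N : nat) : Prop :=
  exists B, lattice_basis L B /\ basis_level B N.

Definition isometric_embedding L (phi : 'rV[R]_n -> 'rV[R]_n) : Prop :=
  (forall v w, L v -> L w -> phi (v + w) = phi v + phi w) /\
  (forall v, L v -> enorm (phi v) = enorm v).

Definition minimal_norm L (mu : nat) : Prop :=
  (exists v, [/\ L v, v != 0 & enorm v ^+ 2 = mu%:R]) /\
  (forall v, L v -> v != 0 -> mu%:R <= enorm v ^+ 2).

End Euclidean.

Section Harmonic.
Context {R : realType} {n : nat}.
Implicit Types (f g : mpoly n R).

(* g(d/dx_1, ..., d/dx_n) f *)
Definition diff_op g f : mpoly n R :=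
  \sum_(a <- msupp g) mcoeff a g *: mderivm a f.

Definition pairing g f : R := meval (fun=> 0) (diff_op g f).

Definition laplacian f : mpoly n R :=
  \sum_(i < n) mderiv i (mderiv i f).

Definition Harm (e : nat) : set (mpoly n R) :=
  [set f | f \is ishomog1 e mdeg /\ laplacian f = 0].

Definition Harm_orthonormal_basis (e d : nat) (h : 'I_d -> mpoly n R) :=
  [/\ forall i, Harm e (h i),
      forall i j, pairing (h i) (h j) = (i == j)%:R &
      forall f, Harm e f -> exists c : 'I_d -> R, f = \sum_i c i *: h i].

End Harmonic.

(* The linear factors are formed in [R], so no truncated subtraction occurs
   there. *)
Definition pfactor_prod {R : realType} (n m k : nat) : R :=
  \prod_(l < k) (n%:R + 4 * m%:R - 4 - 2 * l%:R).

Definition zonal_poly {R : realType} (n m : nat) (c : R) : R :=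
  \sum_(k < m.+1) (-1) ^+ k * c ^+ (2 * m - 2 * k) /
    ((2 * m - 2 * k)`!%:R * k`!%:R * 2 ^+ k * pfactor_prod n m k).

(* When [v = 0] or [w = 0], [cos_angle v w] is [0] since [x / 0 = 0], and the
   summand is [0] if [0 < m] and [1] if [m = 0]. *)
Definition zonal_term {R : realType} {n : nat} (m : nat) (v w : 'rV[R]_n) : R :=
  zonal_poly n m (cos_angle v w) * enorm v ^+ (2 * m) * enorm w ^+ (2 * m).

Section ComplexAnalysis.
Context {R : realType}.
Local Notation C := (R[i]).

Definition upper_half_plane : set C := [set z | 0 < complex.Im z].

Definition cexp (z : C) : C :=
  Complex (expR (complex.Re z) * cos (complex.Im z))
          (expR (complex.Re z) * sin (complex.Im z)).

(* e ^ (2 pi i x z) *)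
Definition expi2pi (x : R) (z : C) : C := cexp ((2 * pi * x)%:C%C * 'i%C * z).

Definition nome (tau : C) : C := expi2pi 1 tau.

Definition qexpansion (f : C -> C) (a : nat -> C) : Prop :=
  forall tau, upper_half_plane tau ->
    ([series a k * nome tau ^+ k]_k : nat -> C^o) @ \oo --> (f tau : C^o).

(* The unordered sum of [f] over [D]; [^o] gives [R[i]] its norm topology. *)
Definition sum_over {T : choiceType} (D : set T) (f : T -> C) : C :=
  @summability.sum T C (C^o : normedModType C) (patch (fun=> 0) D f).

Definition moebius (g : 'M[int]_2) (tau : C) : C :=
  ((g 0 0)%:~R * tau + (g 0 1)%:~R) / ((g 1 0)%:~R * tau + (g 1 1)%:~R).

Definition automorphy (g : 'M[int]_2) (tau : C) : C :=
  (g 1 0)%:~R * tau + (g 1 1)%:~R.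

Definition slash (k : nat) (f : C -> C) (g : 'M[int]_2) (tau : C) : C :=
  (automorphy g tau) ^- k * f (moebius g tau).

Definition dirichlet_character (N : nat) (chi : int -> C) : Prop :=
  [/\ chi 1 = 1,
      forall a b, chi (a * b) = chi a * chi b,
      forall a, chi (a + N%:Z) = chi a &
      forall a, (chi a != 0) = coprimez a N%:Z].

Definition principal_character (N : nat) (chi : int -> C) : Prop :=
  forall a, coprimez a N%:Z -> chi a = 1.

(* The space M_k(Gamma_0(N), chi). The last clause is holomorphy at all the
   cusps. *)
Definition modular_form (k N : nat) (chi : int -> C) (f : C -> C) : Prop :=
  [/\ forall tau, upper_half_plane tau -> derivable (f : C^o -> C^o) tau 1,
      forall g : 'M[int]_2, \det g = 1 -> (N%:Z %| g 1%R 0%R)%Z ->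
        forall tau, upper_half_plane tau ->
          f (moebius g tau) = chi (g 1%R 1%R) * automorphy g tau ^+ k * f tau &
      forall g : 'M[int]_2, \det g = 1 ->
        exists A M : R, forall tau, upper_half_plane tau -> A <= complex.Im tau ->
          `|slash k f g tau| <= M%:C%C].

End ComplexAnalysis.

Section Theta.
Context {R : realType} {n : nat}.
Implicit Types (L : set 'rV[R]_n).

Definition theta (f : mpoly n R) L (tau : R[i]) : R[i] :=
  sum_over L (fun v => (meval (fun i => v 0 i) f)%:C%C *
                       expi2pi (enorm v ^+ 2) tau).

Definition Theta (d : nat) (h : 'I_d -> mpoly n R) L (tau : R[i]) : R[i] :=
  \sum_(j < d) theta (h j) L tau ^+ 2.

(* A finitely supported sum: a lattice has finitely many vectors of given
   norm. *)
Definition Theta_coef (m : nat) L (k : nat) : R :=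
  \sum_(p \in [set p : 'rV[R]_n * 'rV[R]_n |
                [/\ L p.1, L p.2 & enorm p.1 ^+ 2 + enorm p.2 ^+ 2 = k%:R]])
    zonal_term m p.1 p.2.

End Theta.

(* Main.v *)
(* A rational diagonalization of the Gram matrix puts the lattice L inside an
   orthogonal lattice, with periodic indicator, so that Poisson summation on L
   reduces to the one-variable inversion of Gaussian sums, itself obtained by
   comparing Riemann sums of a Gaussian along rotated lines.  Expanding in s the
   identity for sum psi(x) e(W |x|^2) exp(s <xi, x>) brings in harmonic
   coefficients: writing h as a sum of powers <xi, x>^e, harmonicity kills all
   terms but the leading one.  At g = (a b; c d), c > 0, this yields theta_h(g tau)
   as a sum over the dual lattice weighted by finite sums Phi(w); if the level
   divides c, shifting the summation variable shows that Phi is supported on L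
   and constant there.  Hence theta_h^2 transforms under Gamma_0(N) by a
   multiplier depending only on (a, c), which a comparison of the behaviour at
   i oo under g and g S expresses as a product of squared quadratic Gauss sums;
   these are read off from the case L = Z, where Gamma_0(4) is reached by
   descent.  The q-expansion follows from the reproducing kernel
   sum_h h(v) h(w) = p_m(cos(v, w)) |v|^2m |w|^2m of harmonic polynomials, which
   only involves inner products; this gives the independence of the embedding. *)
Require Import Defs.
From mathcomp Require Import all_boot all_order all_algebra.
From mathcomp Require Import finmap.
From mathcomp Require Import all_classical all_reals all_analysis.
From mathcomp Require Import ring lra zify.
From mathcomp.analysis.showcase Require summability.
Import Order.TTheory GRing.Theory Num.Theory.
Import numFieldNormedType.Exports.

Set Implicit Arguments.
Unset Strict Implicit.
Unset Printing Implicit Defensive.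

Local Open Scope classical_set_scope.
Local Open Scope ring_scope.

(** * The complex exponential *)

(** The prefactor of Poisson summation is a product of square roots whose branches would be painful
    to follow. Since only squares of theta series enter the statement, this prefactor [r] is known
    throughout only through [r ^+ 2]; it is fixed before the periodic weight and the harmonic
    polynomial vary. The Gaussian integral is not computed either: it stays an unknown normalisation
    of the Riemann sums, determined at the end by the self-dual case. The diagonalisation has to be
    rational, so that a multiple of the orthogonal lattice falls back into [L] and the indicator of
    [L] is periodic. That the multiplier is a function of [(a, c)] alone gives the freedom to move
    [d] inside its class modulo [c] until it is prime to all data, so that only Gauss sums of odd
    modulus with invertible coefficient have to be known. In odd rank the answer is the character
    modulo 4, which has modulus [N] only if 4 divides [N]; this divisibility is forced by comparing
    two matrices with the same [(a, c)]. *)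

Section ComplexModulus.
Context {R : realType}.
Local Notation C := (R[i]).
Implicit Types z w : C.

(** The norm of [z] is an element of [R[i]], whose order is only partial. Its real part is used
    instead, so that all estimates take place in the ordered field [R]. *)
Definition cabs z : R := complex.Re `|z|.

Lemma cabsE z : `|z| = (cabs z)%:C%C.
Proof. by rewrite /cabs normc_def. Qed.

Lemma cabs_ge0 z : 0 <= cabs z.
Proof. by rewrite -ler0c -cabsE. Qed.

Lemma cabs0 : cabs 0 = 0.
Proof. by apply: (@complexI R); rewrite -cabsE normr0. Qed.

Lemma cabs1 : cabs 1 = 1.
Proof. by apply: (@complexI R); rewrite -cabsE normr1. Qed.

Lemma cabsN z : cabs (- z) = cabs z.
Proof. by rewrite /cabs normrN. Qed.

Lemma cabsM z w : cabs (z * w) = cabs z * cabs w.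
Proof. by apply: (@complexI R); rewrite rmorphM /= -!cabsE normrM. Qed.

Lemma cabsX z k : cabs (z ^+ k) = cabs z ^+ k.
Proof. by apply: (@complexI R); rewrite rmorphXn /= -!cabsE normrX. Qed.

Lemma cabsV z : cabs z^-1 = (cabs z)^-1.
Proof. by apply: (@complexI R); rewrite fmorphV /= -!cabsE normfV. Qed.

Lemma cabsD z w : cabs (z + w) <= cabs z + cabs w.
Proof. by rewrite -lecR rmorphD /= -!cabsE ler_normD. Qed.

Lemma cabsB z w : cabs (z - w) <= cabs z + cabs w.
Proof. by rewrite (le_trans (cabsD _ _)) ?cabsN. Qed.

Lemma cabsBC z w : cabs (z - w) = cabs (w - z).
Proof. by rewrite -cabsN opprB. Qed.

Lemma cabs_triangle w z z' : cabs (z - z') <= cabs (z - w) + cabs (w - z').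
Proof. by rewrite (le_trans _ (cabsD _ _))// addrA subrK. Qed.

Lemma cabs_real (x : R) : cabs x%:C%C = `|x|.
Proof. by apply: (@complexI R); rewrite -cabsE normc_def /= expr0n addr0 sqrtr_sqr. Qed.

Lemma cabs_eq0 z : (cabs z == 0) = (z == 0).
Proof.
apply/eqP/eqP => [h|->]; last exact: cabs0.
by apply/eqP; rewrite -normr_eq0 cabsE h.
Qed.

Lemma cabs_sum (I : Type) (r : seq I) (P : pred I) (F : I -> C) :
  cabs (\sum_(i <- r | P i) F i) <= \sum_(i <- r | P i) cabs (F i).
Proof.
elim/big_rec2: _ => [|i x y _ h]; first by rewrite cabs0.
by rewrite (le_trans (cabsD _ _))// lerD2l.
Qed.

Lemma sqr_cabs z : cabs z ^+ 2 = complex.Re z ^+ 2 + complex.Im z ^+ 2.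
Proof.
by rewrite /cabs normc_def /= sqr_sqrtr// addr_ge0// sqr_ge0.
Qed.

Lemma Re_le_cabs z : `|complex.Re z| <= cabs z.
Proof.
rewrite -(@ler_pXn2r _ 2)// ?nnegrE ?cabs_ge0// sqr_cabs real_normK ?num_real//.
by rewrite lerDl sqr_ge0.
Qed.

Lemma Im_le_cabs z : `|complex.Im z| <= cabs z.
Proof.
rewrite -(@ler_pXn2r _ 2)// ?nnegrE ?cabs_ge0// sqr_cabs real_normK ?num_real//.
by rewrite lerDr sqr_ge0.
Qed.

Lemma Re_add z w : complex.Re (z + w) = complex.Re z + complex.Re w.
Proof. by case: z w => [a b] [c d]. Qed.

Lemma Im_add z w : complex.Im (z + w) = complex.Im z + complex.Im w.
Proof. by case: z w => [a b] [c d]. Qed.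

Lemma Re_opp z : complex.Re (- z) = - complex.Re z.
Proof. by case: z. Qed.

Lemma Im_opp z : complex.Im (- z) = - complex.Im z.
Proof. by case: z. Qed.

Lemma Re_mul z w :
  complex.Re (z * w) = complex.Re z * complex.Re w - complex.Im z * complex.Im w.
Proof. by case: z w => [a b] [c d]. Qed.

Lemma Im_mul z w :
  complex.Im (z * w) = complex.Re z * complex.Im w + complex.Im z * complex.Re w.
Proof. by case: z w => [a b] [c d]. Qed.

Definition ReIm := (Re_add, Im_add, Re_opp, Im_opp, Re_mul, Im_mul).

Lemma complex_ext z w :
  complex.Re z = complex.Re w -> complex.Im z = complex.Im w -> z = w.
Proof. by case: z w => [a b] [c d] /= -> ->. Qed.

Lemma ReImE z : z = (complex.Re z)%:C%C + 'i%C * (complex.Im z)%:C%C.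
Proof. by apply: complex_ext; rewrite !ReIm /=; ring. Qed.

Lemma cabs_i : cabs 'i%C = 1.
Proof.
apply: (@complexI R); rewrite -cabsE normc_def /=.
by rewrite expr0n expr1n add0r sqrtr1.
Qed.

Lemma cabs_le_ReIm z : cabs z <= `|complex.Re z| + `|complex.Im z|.
Proof.
rewrite {1}(ReImE z) (le_trans (cabsD _ _))// cabsM cabs_i mul1r.
by rewrite !cabs_real.
Qed.

Lemma sqrc_i : 'i%C * 'i%C = -1 :> C.
Proof. by rewrite -expr2 sqr_i. Qed.

Lemma invc_i : 'i%C^-1 = - 'i%C :> C.
Proof.
by apply: (mulfI (neq0Ci _)); rewrite mulfV ?neq0Ci// mulrN sqrc_i opprK.
Qed.

Lemma ci_neq0 : ('i%C : C) != 0.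
Proof. exact: neq0Ci. Qed.

Lemma cpi_neq0 : ((pi : R)%:C%C : C) != 0.
Proof. by rewrite -(rmorph0 (real_complex R)) (inj_eq (@complexI R)) gt_eqF// pi_gt0. Qed.

End ComplexModulus.

(** * Addition law, kernel and second-order estimates of the exponential *)

Section ComplexExp.
Context {R : realType}.
Local Notation C := (R[i]).
Implicit Types z w : C.

Lemma cexpD z w : cexp (z + w) = cexp z * cexp w.
Proof.
apply: complex_ext; rewrite /cexp !ReIm /= expRD ?cosD ?sinD; ring.
Qed.

Lemma cexp0 : cexp (0 : C) = 1.
Proof. by rewrite /cexp /= expR0 cos0 sin0 mulr1 mulr0. Qed.

Lemma cabs_cexp z : cabs (cexp z) = expR (complex.Re z).
Proof.
apply/eqP; rewrite -(@eqrXn2 _ 2)// ?cabs_ge0 ?expR_ge0//.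
by rewrite sqr_cabs /= !exprMn -mulrDr cos2Dsin2 mulr1.
Qed.

Lemma cexp_neq0 z : cexp z != 0.
Proof. by rewrite -cabs_eq0 cabs_cexp expR_eq0. Qed.

Lemma cexpN z : cexp (- z) = (cexp z)^-1.
Proof.
apply: (mulfI (cexp_neq0 z)); rewrite mulfV ?cexp_neq0//.
by rewrite -cexpD subrr cexp0.
Qed.

Lemma cexpB z w : cexp (z - w) = cexp z / cexp w.
Proof. by rewrite cexpD cexpN. Qed.

Lemma cexpMn z k : cexp (z *+ k) = cexp z ^+ k.
Proof.
elim: k => [|k IH]; first by rewrite mulr0n expr0 cexp0.
by rewrite mulrS exprS cexpD IH.
Qed.

Lemma cexp_sum (I : Type) (r : seq I) (P : pred I) (F : I -> C) :
  cexp (\sum_(i <- r | P i) F i) = \prod_(i <- r | P i) cexp (F i).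
Proof. exact: (big_morph _ cexpD cexp0). Qed.

Lemma cexp_real (x : R) : cexp x%:C%C = (expR x)%:C%C.
Proof. by rewrite /cexp /= cos0 sin0 mulr1 mulr0. Qed.

Definition tpi : C := 2 * (pi : R)%:C%C * 'i%C.

Lemma tpiE : tpi = Complex 0 (2 * pi).
Proof.
rewrite /tpi; apply: complex_ext; rewrite !ReIm /=; last by ring.
by ring.
Qed.

Lemma cexp_tpi : cexp tpi = 1.
Proof.
rewrite tpiE /cexp /= expR0 !mul1r.
by rewrite !mulr_natl cos2pi sin2pi.
Qed.

Lemma cexp_tpi_int (k : int) : cexp (tpi * k%:~R) = 1.
Proof.
case: k => k; first by rewrite mulr_natr cexpMn cexp_tpi expr1n.
by rewrite NegzE rmorphN /= mulrN cexpN mulr_natr cexpMn cexp_tpi expr1n invr1.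
Qed.

(** Turns a trivial character value into integrality: once the floor is removed, [sin (pi y) = 0]
    with [0 <= y < 1] leaves only [y = 0]. This is the arithmetic input of [root_sum] and of
    [cuspsum_support]. *)
Lemma cexp_tpi_eq1 (x : R) : cexp (tpi * x%:C%C) = 1 -> exists k : int, x = k%:~R.
Proof.
move=> h; exists (Num.floor x).
set k := Num.floor x.
have hb : 0 <= x - k%:~R < 1.
  by rewrite subr_ge0 floor_le ltrBlDl (lt_le_trans (floorD1_gt x))// rmorphD.
set y := x - k%:~R in hb.
suff : y = 0 by move/eqP; rewrite subr_eq0 => /eqP.
have {h} : cexp (tpi * y%:C%C) = 1.
  rewrite /y rmorphB /= mulrBr cexpB h.
  by rewrite rmorph_int cexp_tpi_int divr1.
have -> : tpi * y%:C%C = Complex 0 (2 * pi * y).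
  by rewrite tpiE; apply: complex_ext; rewrite !ReIm /=; ring.
move/(congr1 (@complex.Re R)); rewrite /= expR0 mul1r => hc.
have : cos (pi * y) ^+ 2 = 1.
  move: hc; rewrite -mulrA (_ : 2 * _ = (pi * y) *+ 2) ?mulr_natl//.
  by rewrite cos_mulr2n => h2; lra.
move=> h1.
have : sin (pi * y) = 0.
  by apply/eqP; rewrite -sqrf_eq0 sin2cos2 h1 subrr.
have [->//|y0] := eqVneq y 0.
have : 0 < sin (pi * y).
  apply: sin_gt0_pi; rewrite mulr_gt0 ?pi_gt0//=; last first.
    by rewrite lt_neqAle eq_sym y0; case/andP: hb.
  by rewrite -[ltRHS]mulr1 ltr_pM2l ?pi_gt0//; case/andP: hb.
by move=> h2 h3; rewrite h3 ltxx in h2.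
Qed.

Lemma expR_sub1_le (a : R) : `|expR a - 1| <= `|a| * (1 + expR a).
Proof.
have h1 := expR_ge1Dx a; have h2 := expR_ge1Dx (- a).
have e0 := expR_gt0 a.
have h3 : expR a - 1 <= a * expR a.
  have : (1 - a) * expR a <= 1 by rewrite -[leRHS](expRxMexpNx_1 a) mulrC ler_pM2l.
  by lra.
have [a0|a0] := ger0P a.
  rewrite ger0_norm; last lra.
  by nra.
by rewrite ler_norml; apply/andP; split; nra.
Qed.

Lemma expR_taylor2 (a : R) : `|expR a - 1 - a| <= a ^+ 2 * (1 + expR a).
Proof.
have h1 := expR_ge1Dx a; have h2 := expR_ge1Dx (- a).
have e0 := expR_gt0 a.
have h3 : expR a - 1 <= a * expR a.
  have : (1 - a) * expR a <= 1 by rewrite -[leRHS](expRxMexpNx_1 a) mulrC ler_pM2l.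
  by lra.
rewrite ger0_norm; last lra.
apply: (@le_trans _ _ (a * (expR a - 1))); first lra.
apply: (le_trans (ler_norm _)); rewrite normrM -(real_normK (num_real a)) expr2 -mulrA.
by rewrite ler_wpM2l// expR_sub1_le.
Qed.

Lemma sin_le_norm (x : R) : `|sin x| <= `|x|.
Proof.
wlog x0 : x / 0 <= x => [hw|].
  have [x0|/ltW x0] := leP 0 x; first exact: hw.
  by rewrite -normrN -sinN -(normrN x) hw// oppr_ge0.
move: x0; rewrite le_eqVlt => /predU1P[<-|x0]; first by rewrite sin0.
have hc : {within `[0, x], continuous (@sin R)}.
  by apply: continuous_subspaceT; exact: continuous_sin.
have [c _] := MVT x0 (fun y _ => is_derive_sin y) hc.
rewrite sin0 !subr0 => ->; rewrite normrM ler_piMl//; exact: cos_max.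
Qed.

Lemma cos_taylor2 (x : R) : `|cos x - 1| <= x ^+ 2 / 2.
Proof.
have -> : cos x - 1 = - (2 * sin (x / 2) ^+ 2).
  have {1}-> : x = (x / 2) *+ 2 by rewrite -mulr_natr divfK.
  by rewrite cos_mulr2n sin2cos2; ring.
rewrite normrN ger0_norm; last by rewrite mulr_ge0 ?sqr_ge0.
have h := sin_le_norm (x / 2).
have : sin (x / 2) ^+ 2 <= (x / 2) ^+ 2.
  by rewrite -(real_normK (num_real (sin _))) -(real_normK (num_real (x/2))) lerXn2r// nnegrE.
by move=> h2; lra.
Qed.

Lemma sin_taylor2 (x : R) : `|sin x - x| <= x ^+ 2.
Proof.
wlog x0 : x / 0 <= x => [hw|].
  have [x0|/ltW x0] := leP 0 x; first exact: hw.
  rewrite -normrN opprB -(sqrrN x).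
  by rewrite (_ : x - sin x = sin (- x) - (- x)) ?hw ?oppr_ge0// sinN; ring.
move: x0; rewrite le_eqVlt => /predU1P[<-|x0].
  by rewrite sin0 subrr normr0 expr0n.
have hc : {within `[0, x], continuous (fun y : R => sin y - y)}.
  by apply: continuous_subspaceT => y; apply: cvgB; [exact: continuous_sin | exact: cvg_id].
have hd (y : R) : y \in `]0, x[ -> is_derive y 1 (fun y : R => sin y - y) (cos y - 1).
  by move=> _; apply: is_deriveB.
have [c cx] := MVT x0 hd hc.
rewrite sin0 !subr0 => ->; rewrite normrM (gtr0_norm x0) expr2 ler_pM2r//.
have : 0 < c < x by rewrite in_itv in cx.
case/andP=> c0 cx'; have [x2|x2] := leP x 2.
  apply: (le_trans (cos_taylor2 c)).
  have : c ^+ 2 <= x * 2 by nra.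
  by lra.
rewrite ler_norml; have := cos_le1 c; have := cos_geN1 c; lra.
Qed.

(** The factor [1 + expR (Re z)] makes the estimate valid for all [z]. Multiplied by a Gaussian
    value it becomes the sum of the Gaussian at the base point and at the shifted point, both of
    which decay. *)
Lemma cexp_taylor2 z : cabs (cexp z - 1 - z) <= 4 * cabs z ^+ 2 * (1 + expR (complex.Re z)).
Proof.
case: z => a b /=; rewrite sqr_cabs /=.
have -> : cexp (Complex a b) - 1 - Complex a b =
  Complex (cos b) (sin b) * (expR a - 1 - a)%:C%C
  + (Complex (cos b - 1) (sin b - b)) + a%:C%C * Complex (cos b - 1) (sin b).
  by apply: complex_ext; rewrite !ReIm /=; ring.
have e0 := expR_gt0 a.
apply: (le_trans (cabsD _ _)); apply: (@le_trans _ _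
  (a ^+ 2 * (1 + expR a) + 2 * b ^+ 2 + `|a| * (2 * `|b|))).
  apply: lerD; first apply: (le_trans (cabsD _ _)); first apply: lerD.
  - rewrite cabsM cabs_real; have -> : cabs (Complex (cos b) (sin b)) = 1.
      apply/eqP; rewrite -(@eqrXn2 _ 2)// ?cabs_ge0// sqr_cabs /= cos2Dsin2.
      by rewrite expr1n.
    by rewrite mul1r expR_taylor2.
  - apply: (le_trans (cabs_le_ReIm _)) => /=.
    have := cos_taylor2 b; have := sin_taylor2 b; have := sqr_ge0 b; lra.
  - rewrite cabsM cabs_real ler_wpM2l//.
    rewrite -(@ler_pXn2r _ 2)// ?nnegrE ?cabs_ge0 ?mulr_ge0//.
    rewrite sqr_cabs /= exprMn real_normK ?num_real//.
    have h1 : (cos b - 1) ^+ 2 + sin b ^+ 2 = 2 * (1 - cos b).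
      by rewrite sin2cos2; ring.
    have := cos_taylor2 b; rewrite h1 ler_norml => /andP[h2 _].
    have := sqr_ge0 b; lra.
have h1 : `|a| * (2 * `|b|) <= a ^+ 2 + b ^+ 2.
  have := sqr_ge0 (`|a| - `|b|).
  rewrite sqrrB !real_normK ?num_real// => h; lra.
have := sqr_ge0 a; have := sqr_ge0 b; nra.
Qed.

End ComplexExp.

(** * Absolutely convergent sums over a choiceType *)

Section Summation.
Context {R : realType}.
Local Notation C := (R[i]).

Definition bsums (T : choiceType) (g : T -> R) : Prop :=
  exists M, forall A : {fset T}, \sum_(x <- A) g x <= M.

(** Absolute convergence is part of the definition, so that regrouping by fibres and products of
    sums need no separate summability hypothesis. *)
Definition hassum (T : choiceType) (f : T -> C) (s : C) : Prop :=
  bsums (fun x => cabs (f x)) /\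
  forall e : R, 0 < e -> exists A : {fset T}, forall B : {fset T}, (A `<=` B)%fset ->
    cabs (\sum_(x <- B) f x - s) <= e.

(** A choice of the sum, meaningful only when some [hassum] is known; the value is [0] otherwise. *)
Definition tsum (T : choiceType) (f : T -> C) : C := xget 0 [set s | hassum f s].

Lemma bsums_le (T : choiceType) (f g : T -> R) :
  (forall x, f x <= g x) -> bsums g -> bsums f.
Proof.
move=> fg [M hM]; exists M => A; rewrite (le_trans _ (hM A))//.
by apply: ler_sum => x _; exact: fg.
Qed.

Lemma bsumsD (T : choiceType) (f g : T -> R) :
  bsums f -> bsums g -> bsums (fun x => f x + g x).
Proof.
move=> [M hM] [M' hM']; exists (M + M') => A.
by rewrite big_split lerD.
Qed.

Lemma bsumsZ (T : choiceType) (c : R) (f : T -> R) :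
  0 <= c -> bsums f -> bsums (fun x => c * f x).
Proof.
by move=> c0 [M hM]; exists (c * M) => A; rewrite -mulr_sumr ler_wpM2l.
Qed.

Lemma sum_fset_le (T : choiceType) (g : T -> R) (A B : {fset T}) :
  (forall x, 0 <= g x) -> (A `<=` B)%fset -> \sum_(x <- A) g x <= \sum_(x <- B) g x.
Proof.
move=> g0 AB; rewrite [leRHS](big_fsetID _ (mem A))/=.
have -> : [fset x in B | x \in A]%fset = A.
  apply/fsetP => x; rewrite !inE andbC; case xA: (x \in A) => //=.
  by rewrite (fsubsetP AB).
by rewrite lerDl sumr_ge0.
Qed.

Lemma sum_const_fset (T : choiceType) (c : R) (A : {fset T}) :
  \sum_(x <- A) c = #|` A|%:R * c.
Proof. by rewrite big_const_seq count_predT iter_addr_0 mulr_natl. Qed.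

Lemma sum_const_le (T : choiceType) (c : R) (A : {fset T}) :
  0 < c -> \sum_(x <- A) (c / (#|` A|%:R + 1)) <= c.
Proof.
move=> c0; rewrite sum_const_fset mulrA ler_pdivrMr ?ltr_wpDl//.
by rewrite mulrC ler_pM2l// lerDl.
Qed.

Lemma hassum_unique (T : choiceType) (f : T -> C) (s t : C) :
  hassum f s -> hassum f t -> s = t.
Proof.
move=> [_ hs] [_ ht]; apply/eqP; rewrite -subr_eq0 -cabs_eq0.
rewrite eq_le cabs_ge0 andbT; apply/ler_addgt0Pr => e e0; rewrite add0r.
have e2 : 0 < e / 2 by rewrite divr_gt0.
have [A hA] := hs _ e2; have [B hB] := ht _ e2.
have := hA ((A `|` B)%fset) (fsubsetUl _ _); have := hB ((A `|` B)%fset) (fsubsetUr _ _).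
set S := \sum_(x <- _) _ => h1 h2.
by rewrite (le_trans (cabs_triangle S _ _))// (splitr e) lerD// cabsBC.
Qed.

Lemma hassum_tsum (T : choiceType) (f : T -> C) (s : C) : hassum f s -> hassum f (tsum f).
Proof. by move=> h; apply: (@xgetPex _ 0 [set s | hassum f s]); exists s. Qed.

Lemma tsumE (T : choiceType) (f : T -> C) (s : C) : hassum f s -> tsum f = s.
Proof. by move=> h; apply: (hassum_unique (hassum_tsum h) h). Qed.

Lemma eq_hassum (T : choiceType) (f g : T -> C) (s : C) :
  f =1 g -> hassum f s -> hassum g s.
Proof. by move=> /funext ->. Qed.

Lemma hassum_lin (T : choiceType) (c : C) (f g : T -> C) (s t : C) :
  hassum f s -> hassum g t -> hassum (fun x => c * f x + g x) (c * s + t).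
Proof.
move=> [bf hf] [bg hg]; split.
  apply: (@bsums_le _ _ (fun x => cabs c * cabs (f x) + cabs (g x))).
    by move=> x; rewrite -cabsM cabsD.
  by apply: bsumsD => //; apply: bsumsZ => //; exact: cabs_ge0.
move=> e e0; have c1 : 0 < cabs c + 1 by rewrite ltr_wpDl ?cabs_ge0.
have e1 : 0 < e / 2 / (cabs c + 1) by rewrite !divr_gt0.
have e2 : 0 < e / 2 by rewrite divr_gt0.
have [A hA] := hf _ e1; have [B hB] := hg _ e2.
exists ((A `|` B)%fset) => D; rewrite fsubUset => /andP[AD BD].
rewrite big_split /= -mulr_sumr opprD addrACA -mulrBr.
rewrite (le_trans (cabsD _ _))// (splitr e) lerD ?hB// cabsM.
apply: (@le_trans _ _ ((cabs c + 1) * (e / 2 / (cabs c + 1)))); last first.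
  by rewrite mulrC divfK// gt_eqF.
by rewrite ler_pM ?cabs_ge0 ?hA// lerDl.
Qed.

Lemma hassum0 (T : choiceType) : hassum (fun _ : T => 0) 0.
Proof.
split; first by exists 0 => A; rewrite big1// => x _; rewrite cabs0.
by move=> e e0; exists fset0%fset => B _; rewrite big1// subrr cabs0 ltW.
Qed.

Lemma hassumZ (T : choiceType) (c : C) (f : T -> C) (s : C) :
  hassum f s -> hassum (fun x => c * f x) (c * s).
Proof.
move=> h; have := hassum_lin c h (hassum0 T); rewrite addr0.
by apply: eq_hassum => x; rewrite addr0.
Qed.

Lemma hassumZr (T : choiceType) (c : C) (f : T -> C) (s : C) :
  hassum f s -> hassum (fun x => f x * c) (s * c).
Proof.
by move=> /(hassumZ c); rewrite mulrC; apply: eq_hassum => x; rewrite mulrC.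
Qed.

Lemma hassumD (T : choiceType) (f g : T -> C) (s t : C) :
  hassum f s -> hassum g t -> hassum (fun x => f x + g x) (s + t).
Proof.
move=> hf hg; have := hassum_lin 1 hf hg; rewrite mul1r.
by apply: eq_hassum => x; rewrite mul1r.
Qed.

Lemma hassumN (T : choiceType) (f : T -> C) (s : C) :
  hassum f s -> hassum (fun x => - f x) (- s).
Proof.
by move=> /(hassumZ (-1)); rewrite mulN1r; apply: eq_hassum => x; rewrite mulN1r.
Qed.

Lemma hassumB (T : choiceType) (f g : T -> C) (s t : C) :
  hassum f s -> hassum g t -> hassum (fun x => f x - g x) (s - t).
Proof. by move=> hf hg; apply: hassumD => //; exact: hassumN. Qed.

Lemma hassum_bigsum (T : choiceType) (I : Type) (r : seq I) (P : pred I)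
    (f : I -> T -> C) (s : I -> C) :
  (forall i, P i -> hassum (f i) (s i)) ->
  hassum (fun x => \sum_(i <- r | P i) f i x) (\sum_(i <- r | P i) s i).
Proof.
move=> h; elim: r => [|i r IH].
  by rewrite big_nil; apply: eq_hassum (hassum0 T) => x; rewrite big_nil.
rewrite big_cons; case: ifPn => Pi.
  by apply: eq_hassum (hassumD (h _ Pi) IH) => x; rewrite big_cons Pi.
by apply: eq_hassum IH => x; rewrite big_cons (negbTE Pi).
Qed.

Lemma hassum_real_ge0 (T : choiceType) (g : T -> R) : (forall x, 0 <= g x) -> bsums g ->
  exists s : R, hassum (fun x => (g x)%:C%C) s%:C%C.
Proof.
move=> g0 [M hM].
pose E := [set y | exists A : {fset T}, y = \sum_(x <- A) g x].
have hE : has_sup E.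
  split; first by exists (\sum_(x <- fset0%fset) g x); exists fset0%fset.
  by exists M => _ [A ->].
exists (sup E); split.
  by exists M => A; rewrite (le_trans _ (hM A))// ler_sum// => x _; rewrite cabs_real ger0_norm.
move=> e e0; have [_ [A ->] hA] := sup_adherent e0 hE; exists A => B AB.
have -> : \sum_(x <- B) (g x)%:C%C = (\sum_(x <- B) g x)%:C%C :> C by rewrite rmorph_sum.
rewrite -rmorphB cabs_real distrC ger0_norm.
  rewrite lerBlDr -lerBlDl ltW// (lt_le_trans hA)//.
  exact: sum_fset_le.
by rewrite subr_ge0; apply: ub_le_sup; [exact: hE.2 | exists B].
Qed.

(** Reduction to nonnegative real families: [|f| + Re f] and [|f| + Im f] are nonnegative and
    bounded by [2 |f|], and [f] is recovered from them by subtracting [|f|]. *)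
Lemma summable_hassum (T : choiceType) (f : T -> C) :
  bsums (fun x => cabs (f x)) -> hassum f (tsum f).
Proof.
move=> bf; suff [s hs] : exists s, hassum f s by exact: hassum_tsum hs.
have h2 : bsums (fun x => 2 * cabs (f x)) by apply: bsumsZ.
have [a ha] : exists s : R, hassum (fun x => (cabs (f x))%:C%C) s%:C%C.
  by apply: hassum_real_ge0 => // x; exact: cabs_ge0.
have [b hb] : exists s : R, hassum (fun x => (cabs (f x) + complex.Re (f x))%:C%C) s%:C%C.
  apply: hassum_real_ge0 => [x|].
    by have := Re_le_cabs (f x); rewrite ler_norml => /andP[h _]; rewrite addrC -lerBlDr sub0r.
  apply: bsums_le h2 => x; have := Re_le_cabs (f x); rewrite ler_norml; lra.
have [c hc] : exists s : R, hassum (fun x => (cabs (f x) + complex.Im (f x))%:C%C) s%:C%C.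
  apply: hassum_real_ge0 => [x|].
    by have := Im_le_cabs (f x); rewrite ler_norml => /andP[h _]; rewrite addrC -lerBlDr sub0r.
  apply: bsums_le h2 => x; have := Im_le_cabs (f x); rewrite ler_norml; lra.
have := hassumD (hassumB hb ha) (hassumZ 'i%C (hassumB hc ha)).
set s := (X in hassum _ X) => h; exists s; apply: eq_hassum h => x.
by rewrite [RHS]ReImE !rmorphD /=; ring.
Qed.

Lemma hassum_cabs_le (T : choiceType) (f : T -> C) (s : C) (M : R) :
  hassum f s -> (forall A : {fset T}, \sum_(x <- A) cabs (f x) <= M) -> cabs s <= M.
Proof.
move=> [_ h] hM; apply/ler_addgt0Pr => e e0; have [A /(_ A (fsubset_refl _))] := h _ e0.
rewrite cabsBC => h1; rewrite -(subrK (\sum_(x <- A) f x) s) addrC.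
rewrite (le_trans (cabsD _ _))// lerD// (le_trans _ (hM A))//.
exact: cabs_sum.
Qed.

Lemma hassum_ge0_le (T : choiceType) (g : T -> R) (s : R) (A : {fset T}) :
  (forall x, 0 <= g x) -> hassum (fun x => (g x)%:C%C) s%:C%C ->
  \sum_(x <- A) g x <= s.
Proof.
move=> g0 [_ h]; apply/ler_addgt0Pr => e e0; have [B hB] := h _ e0.
have := hB ((B `|` A)%fset) (fsubsetUl _ _); rewrite -rmorph_sum -rmorphB cabs_real ler_norml.
move=> /andP[_]; rewrite lerBlDr addrC => h1; apply: le_trans h1.
by apply: sum_fset_le => //; exact: fsubsetUr.
Qed.

Lemma hassum_reindex (S T : choiceType) (phi : S -> T) (f : T -> C) (s : C) :
  injective phi -> (forall y, f y != 0 -> exists x, y = phi x) ->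
  hassum (f \o phi) s -> hassum f s.
Proof.
move=> inj im [[M hM] h].
(* A finite set [B] pulls back along [phi] to a finite set [D] carrying the same sums; points of [B]
   where [f] vanishes may have no preimage and are discarded. *)
have key (B : {fset T}) : exists2 D : {fset S},
    (forall F : T -> R, (forall y, f y = 0 -> F y = 0) -> \sum_(y <- B) F y = \sum_(x <- D) F (phi x)) /\
    \sum_(y <- B) f y = \sum_(x <- D) f (phi x) &
    (forall x, phi x \in B -> f (phi x) != 0 -> x \in D).
  pose B' := [fset y in B | f y != 0]%fset.
  have /choice[psi hpsi] : forall y, exists o : option S, f y != 0 -> exists2 x, o = Some x & y = phi x.
    move=> y.
    have [fy|fy] := boolP (f y != 0); last by exists None.
    by have [x ->] := im _ fy; exists (Some x) => _; exists x.
  pose D := [fset x | x in pmap psi (enum_fset B')]%fset.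
  have hD x : (x \in D) = (phi x \in B').
    rewrite /D inE /= mem_pmap; apply/mapP/idP.
      case=> y; rewrite !inE => /andP[yB fy] e.
      by have [x' e1 e2] := hpsi _ fy; move: e; rewrite e1 => -[->]; rewrite -e2 yB.
    move=> xB; exists (phi x) => //; move: xB; rewrite !inE => /andP[_ fy].
    by have [x' -> /inj ->] := hpsi _ fy.
  have himg : (phi @` D)%fset = B'.
    apply/fsetP => y; apply/imfsetP/idP => [[x /=]|yB]; first by rewrite hD => h1 ->.
    have := yB; rewrite !inE => /andP[_ fy]; have [x ex] := im _ fy.
    by exists x => //=; rewrite hD -ex.
  have gen (V : nmodType) (F : T -> V) : (forall y, f y = 0 -> F y = 0) ->
      \sum_(y <- B) F y = \sum_(x <- D) F (phi x).
    move=> hF; rewrite -(big_imfset _ imfset_key F (h := phi) (A := mem D))/=; last by move=> ? ? _ _; exact: inj.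
    rewrite himg; apply/esym/big_fset_incl.
      by apply/fsubsetP => y; rewrite !inE => /andP[].
    by move=> y yB; rewrite !inE yB /= negbK => /eqP /hF.
  exists D; first by split; [move=> F; exact: gen | exact: gen].
  by move=> x xB fx; rewrite hD !inE xB.
split.
  exists M => B; have [D [hD _] _] := key B.
  by rewrite hD; [exact: hM | move=> y ->; rewrite cabs0].
move=> e e0; have [A hA] := h _ e0.
exists ((phi @` A)%fset) => B AB; have [D [_ ->] hD] := key B.
have := hA ((A `|` D)%fset) (fsubsetUl _ _).
suff -> : \sum_(x <- (A `|` D)%fset) (f \o phi) x = \sum_(x <- D) f (phi x) by [].
apply/esym/big_fset_incl; first exact: fsubsetUr.
move=> x; rewrite in_fsetU => /orP[xA|->//] xD; apply/eqP; apply: contraNT xD => fx.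
by apply: hD => //; apply: (fsubsetP AB); apply/imfsetP; exists x.
Qed.

Lemma hassum_bij (S T : choiceType) (phi : S -> T) (psi : T -> S) (f : T -> C) (s : C) :
  cancel phi psi -> cancel psi phi -> hassum f s -> hassum (f \o phi) s.
Proof.
move=> k1 k2 h; apply: (hassum_reindex (can_inj k2)).
  by move=> x _; exists (phi x); rewrite k1.
by apply: eq_hassum h => y /=; rewrite k2.
Qed.

(** Fubini in the form used everywhere. Over finitely many fibres a single finite set [D]
    approximates all the fibre sums at once, and a sum over [D] can be taken in either order. *)
Lemma hassum_fiber (S T : choiceType) (p : T -> S) (f : T -> C) (g : S -> C) (s : C) :
  hassum f s ->
  (forall y, hassum (fun x => if p x == y then f x else 0) (g y)) ->
  hassum g s.
Proof.
move=> [[M hM] h] hg.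
have key (B : {fset S}) (A0 : {fset T}) (e : R) : 0 < e -> exists2 D : {fset T}, (A0 `<=` D)%fset &
    forall y, y \in B -> cabs (\sum_(x <- D) (if p x == y then f x else 0) - g y) <= e.
  move=> e0; have /choice[A hA] : forall y, exists A : {fset T}, forall D : {fset T}, (A `<=` D)%fset ->
      cabs (\sum_(x <- D) (if p x == y then f x else 0) - g y) <= e.
    by move=> y; have [_ /(_ _ e0)] := hg y.
  exists (A0 `|` \bigcup_(y <- B) A y)%fset; first exact: fsubsetUl.
  move=> y yB; apply: hA; apply: fsubsetU; apply/orP; right.
  exact: bigfcup_sup.
have sw (B : {fset S}) (D : {fset T}) (V : nmodType) (F : T -> V) :
    \sum_(y <- B) \sum_(x <- D) (if p x == y then F x else 0) =
    \sum_(x <- D) (if p x \in B then F x else 0).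
  rewrite exchange_big /=; apply: eq_bigr => x _.
  case: ifPn => pB; last first.
    by rewrite big_seq big1// => y yB; case: eqP => // e; rewrite e yB in pB.
  rewrite (big_fsetD1 (p x))//= eqxx big_seq big1 ?addr0// => y.
  by rewrite !inE eq_sym => /andP[/negbTE ->].
split.
  exists (M + 1) => B.
  (* The admissible error is shared out equally among the fibres over [B], so that the total stays
     below 1 whatever the size of [B]. *)
  have e0 : 0 < 1 / (#|` B|%:R + 1) :> R by rewrite divr_gt0// ltr_wpDl.
  have [D _ hD] := key B fset0%fset _ e0.
  apply: (@le_trans _ _ (\sum_(y <- B) (\sum_(x <- D) (if p x == y then cabs (f x) else 0) + 1 / (#|` B|%:R + 1)))).
    rewrite big_seq [leRHS]big_seq; apply: ler_sum => y yB.
    rewrite -[g y](subrK (\sum_(x <- D) (if p x == y then f x else 0))) addrC.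
    rewrite (le_trans (cabsD _ _))// lerD//; last by rewrite cabsBC hD.
    rewrite (le_trans (cabs_sum _ _ _))// ler_sum// => x _.
    by case: ifP => // _; rewrite cabs0.
  rewrite big_split /= sw lerD//.
    apply: le_trans (hM D); apply: ler_sum => x _; case: ifP => // _; exact: cabs_ge0.
  exact: sum_const_le.
move=> e e0; have e2 : 0 < e / 2 by rewrite divr_gt0.
have [A0 hA0] := h _ e2; exists ((p @` A0)%fset) => B AB.
have e3 : 0 < e / 2 / (#|` B|%:R + 1) :> R by rewrite divr_gt0// ltr_wpDl.
have [D A0D hD] := key B A0 _ e3.
apply: (le_trans (cabs_triangle (\sum_(y <- B) \sum_(x <- D) (if p x == y then f x else 0)) _ _)).
rewrite (splitr e) lerD//.
  rewrite -sumrB (le_trans (cabs_sum _ _ _))//.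
  apply: (@le_trans _ _ (\sum_(y <- B) (e / 2 / (#|` B|%:R + 1)))).
    by rewrite big_seq [leRHS]big_seq; apply: ler_sum => y yB; rewrite cabsBC hD.
  exact: sum_const_le.
rewrite sw.
have -> : \sum_(x <- D) (if p x \in B then f x else 0) =
    \sum_(x <- [fset x in D | p x \in B]%fset) f x.
  rewrite (big_fsetID _ (fun x => p x \in B))/= [X in _ + X]big_seq [X in _ + X]big1 ?addr0; last first.
    by move=> x; rewrite !inE => /andP[_ /negbTE ->].
  by rewrite big_seq [RHS]big_seq; apply: eq_bigr => x; rewrite !inE => /andP[_ ->].
apply: hA0; apply/fsubsetP => x xA; rewrite !inE (fsubsetP A0D)//=.
by apply: (fsubsetP AB); apply/imfsetP; exists x.
Qed.

Lemma hassum_pair (S T : choiceType) (f : S * T -> C) (g : S -> C) (s : C) :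
  hassum f s -> (forall x, hassum (fun y => f (x, y)) (g x)) -> hassum g s.
Proof.
move=> h hg; apply: (hassum_fiber (p := fst) h) => x.
apply: (@hassum_reindex _ _ (fun y => (x, y))); first by move=> ? ? [].
  by case=> x' y /=; case: (x' =P x) => [-> _|_]; [exists y | rewrite eqxx].
by apply: eq_hassum (hg x) => y /=; rewrite eqxx.
Qed.

Lemma hassum_swap (S T : choiceType) (f : S * T -> C) (s : C) :
  hassum f s -> hassum (fun p : T * S => f (p.2, p.1)) s.
Proof.
by move=> h; apply: (hassum_bij (phi := fun p : T * S => (p.2, p.1))
  (psi := fun p => (p.2, p.1)) _ _ h); case.
Qed.

Lemma fset_sub_prod (S T : choiceType) (A : {fset S * T}) :
  exists (D : {fset S}) (E : {fset T}), forall p, p \in A -> (p.1 \in D) && (p.2 \in E).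
Proof.
exists ((fst @` A)%fset), ((snd @` A)%fset) => p pA.
by apply/andP; split; apply/imfsetP; exists p.
Qed.

Lemma bsums_pair (S T : choiceType) (f : S * T -> R) (G : S -> R) :
  (forall p, 0 <= f p) -> bsums G ->
  (forall x (E : {fset T}), \sum_(y <- E) f (x, y) <= G x) -> bsums f.
Proof.
move=> f0 [M hM] hG; exists M => A; have [D [E hDE]] := fset_sub_prod A.
apply: (@le_trans _ _ (\sum_(x <- D) \sum_(y <- E) f (x, y))); last first.
  by apply: le_trans (hM D); apply: ler_sum => x _; exact: hG.
rewrite pair_big_dep_cond /=.
set DE := Imfset.imfset2 _ _ _ _.
rewrite [leRHS](eq_bigr f); last by case.
apply: sum_fset_le => //; apply/fsubsetP => p /hDE /andP[pD pE].
apply/imfset2P; exists p.1; first by rewrite !inE pD.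
by exists p.2; [rewrite !inE pE | case: p {pD pE}].
Qed.

Lemma hassum_mul (S T : choiceType) (f : S -> C) (g : T -> C) (s t : C) :
  hassum f s -> hassum g t -> hassum (fun p : S * T => f p.1 * g p.2) (s * t).
Proof.
move=> hf hg; have [M hM] := hg.1.
have h := @summable_hassum _ (fun p : S * T => f p.1 * g p.2).
have {}h : hassum (fun p : S * T => f p.1 * g p.2) (tsum (fun p : S * T => f p.1 * g p.2)).
  apply: h; apply: (@bsums_pair _ _ _ (fun x => `|M| * cabs (f x))).
  - by move=> p; exact: cabs_ge0.
  - by apply: bsumsZ => //; exact: hf.1.
  - move=> x E; under eq_bigr do rewrite /= cabsM.
    rewrite -mulr_sumr mulrC ler_wpM2r ?cabs_ge0//.
    by rewrite (le_trans (hM E))// ler_norm.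
have hs : hassum (fun x => f x * t) (s * t) by exact: hassumZr.
have := hassum_pair h (fun x => hassumZ (f x) hg) => h1.
by rewrite -(hassum_unique h1 hs).
Qed.

Lemma bsums_fin (T : choiceType) (f : T -> R) (M e : R) : 0 < e ->
  bsums f -> (forall x, 0 <= f x) ->
  exists A : {fset T}, forall B : {fset T}, (forall x, x \in A -> x \notin B) ->
    \sum_(x <- B) f x <= e.
Proof.
move=> e0 bf f0; have [s hs] := hassum_real_ge0 f0 bf.
have [A hA] := hs.2 _ e0; exists A => B AB.
have := hA A (fsubset_refl _); rewrite -rmorph_sum -rmorphB cabs_real ler_norml => /andP[h _].
have := hassum_ge0_le (A `|` B)%fset f0 hs.
rewrite (big_fsetID _ (mem A))/=.
have -> : [fset x in (A `|` B)%fset | x \in A]%fset = A.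
  by apply/fsetP => x; rewrite !inE; case: (x \in A); rewrite ?orbT ?andbF.
have -> : [fset x in (A `|` B)%fset | x \notin A]%fset = B.
  apply/fsetP => x; rewrite !inE; case xA: (x \in A) => //=; last by rewrite andbT.
  by rewrite (negbTE (AB _ xA)).
lra.
Qed.

(** Tannery's theorem: outside a finite set the tail of [g] is small uniformly in [l], and on that
    finite set pointwise convergence is enough. *)
Lemma hassum_dominated (T : choiceType) (f : nat -> T -> C) (s : nat -> C) (g : T -> R) :
  bsums g -> (forall l x, cabs (f l x) <= g x) -> (forall l, hassum (f l) (s l)) ->
  (forall x (e : R), 0 < e -> exists N : nat, forall l, (N <= l)%N -> cabs (f l x) <= e) ->
  forall e : R, 0 < e -> exists N : nat, forall l, (N <= l)%N -> cabs (s l) <= e.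
Proof.
move=> bg fg hf h e e0; have e2 : 0 < e / 2 by rewrite divr_gt0.
have g0 x : 0 <= g x by apply: le_trans (fg 0%N x); exact: cabs_ge0.
have [A hA] := bsums_fin 0 e2 bg g0.
have e3 : 0 < e / 2 / (#|` A|%:R + 1) :> R by rewrite divr_gt0// ltr_wpDl.
have /choice[N hN] := fun x => h x _ e3.
exists (\max_(x <- A) N x)%N => l hl; apply: (hassum_cabs_le (hf l)) => B.
rewrite (big_fsetID _ (mem A))/= (splitr e) lerD//; last first.
  apply: (@le_trans _ _ (\sum_(x <- [fset x in B | x \notin A]%fset) g x)).
    by apply: ler_sum => x _; exact: fg.
  by apply: hA => x xA; rewrite !inE xA andbF.
apply: (@le_trans _ _ (\sum_(x <- A) cabs (f l x))).
  apply: sum_fset_le => [x|]; first exact: cabs_ge0.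
  by apply/fsubsetP => x; rewrite !inE => /andP[].
apply: (@le_trans _ _ (\sum_(x <- A) (e / 2 / (#|` A|%:R + 1)))).
  rewrite big_seq [leRHS]big_seq; apply: ler_sum => x xA; apply: hN.
  by rewrite (leq_trans _ hl)//; exact: (@leq_bigmax_seq _ (enum_fset A) xpredT N x xA).
exact: sum_const_le.
Qed.

Lemma hassum_fin (T : finType) (f : T -> C) : hassum f (\sum_x f x).
Proof.
have hT (A : {fset T}) : (forall x, x \in A) -> \sum_(x <- A) f x = \sum_x f x.
  move=> hA; rewrite big_uniq ?fset_uniq//=; apply: eq_bigl => x; exact: hA.
split.
  exists (\sum_x cabs (f x)) => A; rewrite big_uniq ?fset_uniq//=.
  by rewrite big_mkcond; apply: ler_sum => x _; case: ifP => // _; exact: cabs_ge0.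
move=> e e0; exists [fset x | x in T]%fset => B hB.
rewrite hT ?subrr ?cabs0 ?ltW// => x; apply: (fsubsetP hB).
by rewrite !inE.
Qed.

Lemma hassum_nat_cvg (f : nat -> C) (s : C) (e : R) : hassum f s -> 0 < e ->
  exists N : nat, forall l, (N <= l)%N -> cabs (\sum_(i < l) f i - s) <= e.
Proof.
move=> [_ h] e0; have [A hA] := h _ e0.
exists (\max_(x <- A) x).+1 => l hl.
have -> : \sum_(i < l) f i = \sum_(i <- [fset i | i in iota 0 l]%fset) f i.
  rewrite -(big_mkord xpredT f) /index_iota subn0.
  apply/perm_big/uniq_perm; rewrite ?iota_uniq ?fset_uniq// => i.
  by rewrite !inE.
apply: hA; apply/fsubsetP => x xA; rewrite !inE mem_iota leq0n add0n /=.
by apply: leq_ltn_trans hl; exact: (@leq_bigmax_seq _ (enum_fset A) xpredT id x xA).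
Qed.

Lemma bsums_nat (f : nat -> R) (M : R) : (forall i, 0 <= f i) ->
  (forall l, \sum_(i < l) f i <= M) -> bsums f.
Proof.
move=> f0 h; exists M => A.
apply: (@le_trans _ _ (\sum_(i < (\max_(x <- A) x).+1) f i)); last exact: h.
rewrite -(big_mkord xpredT f) /index_iota subn0.
have -> : \sum_(i <- iota 0 (\max_(x <- A) x).+1) f i =
   \sum_(i <- [fset i | i in iota 0 (\max_(x <- A) x).+1]%fset) f i.
  apply/perm_big/uniq_perm; rewrite ?iota_uniq ?fset_uniq// => i.
  by rewrite !inE.
apply: sum_fset_le => //; apply/fsubsetP => x xA; apply/imfsetP; exists x => //.
suff hx : x \in iota 0 (\max_(x <- A) x).+1 by exact: hx.
by rewrite mem_iota /= add0n ltnS; exact: (@leq_bigmax_seq _ (enum_fset A) xpredT id x xA).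
Qed.

(** The bridge from [hassum] to the unordered sums by which [theta] is defined. *)
Lemma sum_over_hassum (T : choiceType) (D : set T) (f : T -> C) (s : C) :
  hassum (patch (fun=> 0) D f) s -> sum_over D f = s.
Proof.
move=> [_ h]; rewrite /sum_over /summability.sum.
pose F : {fset T} -> (C^o : normedModType C) := summability.partial_sum (patch (fun=> 0) D f).
have PF : ProperFilter (F @ @summability.totally T) by apply: fmap_proper_filter; apply: summability.totally_filter.
suff hc : F @ summability.totally --> (s : C^o).
  apply: (@cvg_unique (C^o : topologicalType) (@norm_hausdorff C (C^o : normedModType C)) (F @ @summability.totally T) PF); last exact: hc.
  have : cvg (F @ @summability.totally T) by apply/cvg_ex; exists s.
  by [].
have := @summability.totally_filter T => FF.
apply/cvgrPdist_lt => e e0.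
have e1 : 0 < complex.Re e by move: e0; rewrite ltcE => /andP[].
have ee : e = (complex.Re e)%:C%C by move: e0; case: (e) => a b; rewrite ltcE /= => /andP[/eqP->].
have [A hA] := h _ (divr_gt0 e1 (ltr0Sn R 1)).
exists A => // B AB; rewrite ee distrC cabsE ltcR.
apply: (@le_lt_trans _ _ (complex.Re e / 2)); last by rewrite gtr_pMr// invf_lt1// ltr1n.
have := hA B AB; rewrite big_seq_fsetE; exact.
Qed.

End Summation.

(** * Inversion of the one-variable Gaussian sum *)

Section Inversion.
Context {R : realType}.
Local Notation C := (R[i]).
Local Notation "x %:K" := (x%:C%C : C) (at level 2, format "x %:K").

Definition gauss (z : C) : C := cexp (- (pi : R)%:K * z ^+ 2).

(* The parameters allowed in the contour [x |-> rho x + a]. *)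
Definition admissible (c M : R) (rho a : C) : Prop :=
  [/\ c <= complex.Re rho - `|complex.Im rho|, cabs rho <= M & cabs a <= M].

Lemma gauss_shift (y w : C) :
  gauss (y + w) = gauss y * cexp (- (pi : R)%:K * (2 * y * w + w ^+ 2)).
Proof. by rewrite /gauss -cexpD; congr cexp; ring. Qed.

Lemma expR_quad_le (al be : R) : 0 < al ->
  forall x : R, - al * x ^+ 2 + be * x <= be ^+ 2 / (4 * al).
Proof.
move=> al0 x; rewrite ler_pdivlMr ?mulr_gt0//.
by have := sqr_ge0 (2 * al * x - be); rewrite sqrrB !exprMn; nra.
Qed.

Lemma poly_le_expR (x : R) : 0 <= x -> (1 + x) ^+ 6 <= 6 ^+ 6 * expR (1 + x).
Proof.
move=> x0; have x1 : 0 <= 1 + x by rewrite addr_ge0.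
have h : (1 + x) / 6 <= expR ((1 + x) / 6).
  by apply: le_trans (expR_ge1Dx _); rewrite lerDr.
have -> : expR (1 + x) = expR ((1 + x) / 6) ^+ 6.
  by rewrite -expRM_natl; congr expR; field.
rewrite -exprMn lerXn2r ?nnegrE ?mulr_ge0 ?expR_ge0//.
by move: h; rewrite ler_pdivrMr// mulrC.
Qed.

(** In the sector [|Im rho| < Re rho] the real part of [rho^2] is at least [c^2], so the decay is
    uniform over admissible parameters. The sixth power leaves room for the polynomial factors of
    degree at most 5 in [gauss_step]. *)
Lemma gauss_bound (c M : R) : 0 < c ->
  exists2 A : R, 0 <= A & forall rho a, admissible c M rho a -> forall x : R,
    (1 + `|x|) ^+ 6 * cabs (gauss (rho * x%:K + a)) <= A * expR (- `|x|).
Proof.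
(* In the linear coefficient, [4 pi M^2] bounds the cross term of the square, and [2] pays for
   [expR (1 + t)] and for the required decay [expR (- t)]. *)
move=> c0; set be := pi * 4 * M ^+ 2 + 2.
have al0 : 0 < pi * c ^+ 2 :> R by rewrite mulr_gt0 ?pi_gt0 ?exprn_gt0.
pose A : R := 6 ^+ 6 * expR (1 + (be ^+ 2 / (4 * (pi * c ^+ 2)) + pi * M ^+ 2)).
exists A; first by rewrite mulr_ge0 ?expR_ge0// exprn_ge0.
move=> rho a [hc hM ha] x; set t := `|x|.
have t0 : 0 <= t by rewrite normr_ge0.
apply: (@le_trans _ _ (6 ^+ 6 * expR (1 + t) * cabs (gauss (rho * x%:K + a)))).
  by rewrite ler_wpM2r ?cabs_ge0// poly_le_expR.
rewrite /A -[leLHS]mulrA -[leRHS]mulrA; apply: ler_wpM2l; first exact: exprn_ge0.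
rewrite /gauss cabs_cexp -!expRD ler_expR.
set p := complex.Re rho in hc; set q := complex.Im rho in hc.
set a1 := complex.Re a; set a2 := complex.Im a.
have -> : complex.Re (- (pi : R)%:K * (rho * x%:K + a) ^+ 2) =
  - pi * ((p ^+ 2 - q ^+ 2) * x ^+ 2 + 2 * x * (p * a1 - q * a2) + (a1 ^+ 2 - a2 ^+ 2)).
  by rewrite expr2 !ReIm /= -/p -/q -/a1 -/a2; ring.
have hq : `|q| ^+ 2 = q ^+ 2 by rewrite real_normK ?num_real.
have h1 : c ^+ 2 <= p ^+ 2 - q ^+ 2.
  by have := normr_ge0 q; rewrite -hq; nra.
have hp : `|p| <= M by apply: le_trans hM; exact: Re_le_cabs.
have hq' : `|q| <= M by apply: le_trans hM; exact: Im_le_cabs.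
have ha1 : `|a1| <= M by apply: le_trans ha; exact: Re_le_cabs.
have ha2 : `|a2| <= M by apply: le_trans ha; exact: Im_le_cabs.
have M0 : 0 <= M by apply: le_trans ha; exact: cabs_ge0.
have h2 : - (2 * x * (p * a1 - q * a2)) <= 4 * M ^+ 2 * t.
  apply: (le_trans (ler_norm _)); rewrite normrN !normrM -/t (ger0_norm (_ : 0 <= 2 :> R))//.
  have h : `|p * a1 - q * a2| <= M * M + M * M.
    by rewrite (le_trans (ler_normB _ _))// !normrM lerD// ler_pM.
  have : t * `|p * a1 - q * a2| <= t * (M * M + M * M) by rewrite ler_wpM2l.
  by lra.
have h3 : - (a1 ^+ 2 - a2 ^+ 2) <= M ^+ 2.
  have : `|a2| ^+ 2 <= M ^+ 2 by rewrite lerXn2r ?nnegrE.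
  rewrite real_normK ?num_real//; have := sqr_ge0 a1; lra.
have h4 := expR_quad_le be al0 t.
have ht : t ^+ 2 = x ^+ 2 by rewrite /t real_normK ?num_real.
have h5 : - pi * ((p ^+ 2 - q ^+ 2) * x ^+ 2) <= - (pi * c ^+ 2) * t ^+ 2.
  have hx : c ^+ 2 * x ^+ 2 <= (p ^+ 2 - q ^+ 2) * x ^+ 2 by rewrite ler_wpM2r ?sqr_ge0.
  have := ler_wpM2l (pi_ge0 R) hx; rewrite ht; lra.
have h6 : - pi * (2 * x * (p * a1 - q * a2)) <= pi * (4 * M ^+ 2 * t).
  by rewrite mulNr -mulrN ler_pM2l ?pi_gt0.
have h7 : - pi * (a1 ^+ 2 - a2 ^+ 2) <= pi * M ^+ 2.
  by rewrite mulNr -mulrN ler_pM2l ?pi_gt0.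
move: h4; rewrite {1}/be; lra.
Qed.

Lemma sum_int_le (g : int -> R) (M1 M2 : R) : (forall k, 0 <= g k) ->
  (forall L, \sum_(i < L) g (Posz i) <= M1) -> (forall L, \sum_(i < L) g (Negz i) <= M2) ->
  forall A : {fset int}, \sum_(k <- A) g k <= M1 + M2.
Proof.
move=> g0 h1 h2 A; pose L := (\max_(k <- A) `|k|%N).+1.
pose t := map Posz (iota 0 L) ++ map Negz (iota 0 L).
have tu : uniq t.
  rewrite cat_uniq !map_inj_uniq ?iota_uniq; [|by move=> ? ? []|by move=> ? ? []].
  by rewrite andbT andTb; apply/hasPn => k /mapP[i _ ->]; apply/negP => /mapP[].
apply: (@le_trans _ _ (\sum_(k <- [fset k | k in t]%fset) g k)).
  apply: sum_fset_le => //; apply/fsubsetP => k kA; apply/imfsetP; exists k => //.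
  suff h : k \in t by exact: h.
  have hk : (`|k| < L)%N by rewrite ltnS; exact: (@leq_bigmax_seq _ (enum_fset A) xpredT absz k kA).
  rewrite mem_cat; case: k hk {kA} => i hi; apply/orP; [left|right];
    apply: map_f; rewrite mem_iota leq0n add0n; [exact: hi | exact: ltnW hi].
have -> : \sum_(k <- [fset k | k in t]%fset) g k = \sum_(k <- t) g k.
  by apply/perm_big/uniq_perm; rewrite ?fset_uniq// => i; apply/imfsetP/idP => [[x /= hx ->//]|]; exists i.
rewrite big_cat !big_map /= lerD//.
  by apply: le_trans (h1 L); rewrite -(big_mkord xpredT (fun i => g (Posz i))) /index_iota subn0.
by apply: le_trans (h2 L); rewrite -(big_mkord xpredT (fun i => g (Negz i))) /index_iota subn0.
Qed.

(** The point is that the bound does not depend on the mesh [l]. The ratio [l / (l + 1)] dominates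
    [expR (- 1 / l)] and its geometric series has sum [l + 1]; each of the two half-lines
    contributes at most 5. *)
Lemma bsums_int_exp (l : nat) : (0 < l)%N ->
  forall A : {fset int}, \sum_(k <- A) (l%:R^-1 * expR (- `|k%:~R / l%:R : R|)) <= 10.
Proof.
move=> l0 A; have l1 : 0 < l%:R :> R by rewrite ltr0n.
set r : R := l%:R / (l%:R + 1).
have r1 : 0 <= r < 1.
  by rewrite divr_ge0 ?addr_ge0//= ltr_pdivrMr ?mul1r ?ltrDl// ltr_wpDl.
have hr : expR (- l%:R^-1) <= r.
  rewrite expRN /r -[leRHS]invrK invf_div lef_pV2 ?posrE ?expR_gt0 ?divr_gt0 ?addr_gt0//.
  rewrite mulrDl divff ?gt_eqF// mul1r; exact: expR_ge1Dx.
have hgeo L : \sum_(i < L) r ^+ i <= l%:R + 1.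
  have e1 : l%:R + 1 != 0 :> R by rewrite gt_eqF// addr_gt0.
  have er : 1 - r = (l%:R + 1)^-1 by rewrite /r; field.
  have -> : l%:R + 1 = 1 / (1 - r) by rewrite er div1r invrK.
  rewrite ler_pdivlMr; last by rewrite er invr_gt0 addr_gt0.
  by rewrite mulrC -opprB mulNr -subrX1 opprB gerBl exprn_ge0//; case/andP: r1.
have key (g : nat -> int) L : (forall i, `|(g i)%:~R : R| = i%:R \/ `|(g i)%:~R : R| = i.+1%:R) ->
   \sum_(i < L) (l%:R^-1 * expR (- `|(g i)%:~R / l%:R : R|)) <= 5.
  move=> hg; rewrite -mulr_sumr mulrC ler_pdivrMr//.
  apply: (@le_trans _ _ (\sum_(i < L) r ^+ i)).
    apply: ler_sum => i _; apply: (@le_trans _ _ (expR (- l%:R^-1) ^+ i)); last first.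
      by rewrite lerXn2r ?nnegrE ?expR_ge0//; case/andP: r1.
    rewrite -expRM_natl ler_expR mulrN lerN2 normrM (ger0_norm (_ : 0 <= l%:R^-1)) ?invr_ge0//.
    by rewrite ler_pM2r ?invr_gt0//; case: (hg i) => ->; rewrite ?ler_nat.
  have : 1 <= l%:R :> R by rewrite ler1n.
  by have := hgeo L; lra.
have -> : 10 = 5 + 5 :> R by ring.
apply: (@sum_int_le (fun k => l%:R^-1 * expR (- `|k%:~R / l%:R : R|))).
- by move=> k; rewrite mulr_ge0 ?invr_ge0 ?expR_ge0.
- by move=> L; apply: (key Posz) => i; left; rewrite normr_nat.
- by move=> L; apply: (key Negz) => i; right; rewrite NegzE rmorphN normrN normr_nat.
Qed.

Lemma mesh_hassum (l : nat) (f : int -> C) (A : R) : (0 < l)%N -> 0 <= A ->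
  (forall k, cabs (f k) <= A * expR (- `|k%:~R / l%:R : R|)) ->
  hassum f (tsum f) /\ cabs (tsum f) <= 10 * A * l%:R.
Proof.
move=> l0 A0 h; have l1 : 0 < l%:R :> R by rewrite ltr0n.
have hB (B : {fset int}) : \sum_(k <- B) cabs (f k) <= 10 * A * l%:R.
  apply: (@le_trans _ _ (\sum_(k <- B) (A * l%:R * (l%:R^-1 * expR (- `|k%:~R / l%:R : R|))))).
    by apply: ler_sum => k _; rewrite mulrA mulfK ?gt_eqF.
  rewrite -mulr_sumr [leRHS](_ : _ = A * l%:R * 10); last by ring.
  by rewrite ler_wpM2l ?mulr_ge0// bsums_int_exp.
have hs : hassum f (tsum f) by apply: summable_hassum; exists (10 * A * l%:R).
by split=> //; apply: (hassum_cabs_le hs).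
Qed.

Lemma mesh_le (l : nat) (f : int -> C) (s : C) (A : R) : (0 < l)%N -> 0 <= A ->
  hassum f s -> (forall k, cabs (f k) <= A * expR (- `|k%:~R / l%:R : R|)) ->
  cabs s <= 10 * A * l%:R.
Proof. by move=> l0 A0 hs h; have [_] := mesh_hassum l0 A0 h; rewrite (tsumE hs). Qed.

(** * Riemann sums of the Gaussian along a line *)

Section RiemannSums.
Variable l : nat.
Hypothesis l0 : (0 < l)%N.

Let x_ (k : int) : R := k%:~R / l%:R.

(** Approximates, with step [1 / l], the integral of the Gaussian along the line [x |-> rho x + a].
    Cauchy's theorem makes the integral independent of [rho] and [a]; [riemann_close] is the
    discrete substitute for it. *)
Definition riemann (rho a : C) : C :=
  l%:R^-1 * tsum (fun k : int => rho * gauss (rho * (k%:~R / l%:R : R)%:K + a)).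

Lemma le_poly (x : R) (k : nat) : (k <= 6)%N -> (1 + `|x|) ^+ k <= (1 + `|x|) ^+ 6.
Proof. by move=> k6; rewrite ler_weXn2l// lerDl. Qed.

Lemma gauss_mesh_hassum (c M : R) (rho a : C) : 0 < c -> admissible c M rho a ->
  hassum (fun k : int => gauss (rho * (x_ k)%:K + a)) (tsum (fun k : int => gauss (rho * (x_ k)%:K + a))).
Proof.
move=> c0 ad; have [A A0 hA] := gauss_bound M c0.
have [|//] := @mesh_hassum l (fun k : int => gauss (rho * (x_ k)%:K + a)) A l0 A0.
move=> k; apply: le_trans (hA _ _ ad (x_ k)).
by rewrite ler_peMl ?cabs_ge0// exprn_ege1// lerDl.
Qed.

Lemma riemann_hassum (c M : R) (rho a : C) : 0 < c -> admissible c M rho a ->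
  hassum (fun k : int => l%:R^-1 * (rho * gauss (rho * (x_ k)%:K + a))) (riemann rho a).
Proof.
move=> c0 ad; apply: hassumZ; apply: (@hassum_tsum _ _ _ (rho * _)).
exact/hassumZ/(gauss_mesh_hassum c0 ad).
Qed.

Lemma shiftz_hassum (f : int -> C) (s : C) (j : int) :
  hassum f s -> hassum (fun k => f (k + j)) s.
Proof.
move=> h; apply: (hassum_bij (phi := fun k => k + j) (psi := fun k => k - j) _ _ h).
  by move=> k; rewrite addrK.
by move=> k; rewrite subrK.
Qed.

End RiemannSums.

(** The remainder is measured by the Gaussian at both ends of the step, so [gauss_bound] applies to
    it directly. *)
Lemma gauss_taylor : exists2 K : R, 0 <= K & forall (y v : C) (d B : R),
  0 <= d <= 1 -> cabs y <= B -> cabs v <= B ->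
  cabs (gauss (y + v * d%:K) - gauss y * (1 - (pi : R)%:K * (2 * y * (v * d%:K) + (v * d%:K) ^+ 2)))
  <= K * B ^+ 4 * d ^+ 2 * (cabs (gauss y) + cabs (gauss (y + v * d%:K))).
Proof.
exists (4 * (3 * pi) ^+ 2); first by rewrite mulr_ge0 ?sqr_ge0.
move=> y v d B /andP[d0 d1] hy hv; rewrite gauss_shift; set w := - (pi : R)%:K * _.
have B0 : 0 <= B by apply: le_trans hy; exact: cabs_ge0.
have -> : gauss y * cexp w - gauss y * (1 - (pi : R)%:K * (2 * y * (v * d%:K) + (v * d%:K) ^+ 2)) =
  gauss y * (cexp w - 1 - w) by rewrite /w; ring.
have hw : cabs w <= 3 * pi * B ^+ 2 * d.
  rewrite /w cabsM cabsN cabs_real ger0_norm ?pi_ge0//.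
  rewrite [leRHS](_ : _ = pi * (2 * B * (B * d) + B * d * (B * 1))); last by ring.
  rewrite ler_pM2l ?pi_gt0// (le_trans (cabsD _ _))// lerD//.
    rewrite !cabsM cabs_real (ger0_norm d0).
    have -> : cabs (2 : C) = 2 by rewrite -(rmorph_nat (real_complex R)) cabs_real normr_nat.
    by rewrite -!mulrA ler_pM2l// ler_pM ?mulr_ge0 ?cabs_ge0// ler_wpM2r.
  rewrite cabsX cabsM cabs_real (ger0_norm d0) expr2.
  apply: ler_pM; rewrite ?mulr_ge0 ?cabs_ge0//; first by rewrite ler_wpM2r.
  by rewrite ler_pM ?cabs_ge0.
rewrite cabsM (le_trans (ler_wpM2l (cabs_ge0 _) (cexp_taylor2 w)))//.
rewrite [in leRHS]cabsM cabs_cexp.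
have e0 := expR_gt0 (complex.Re w); have g0 := cabs_ge0 (gauss y).
have hw2 : cabs w ^+ 2 <= (3 * pi * B ^+ 2 * d) ^+ 2.
  by rewrite lerXn2r ?nnegrE ?cabs_ge0// !mulr_ge0 ?pi_ge0 ?exprn_ge0.
have -> : 4 * (3 * pi) ^+ 2 * B ^+ 4 * d ^+ 2 * (cabs (gauss y) + cabs (gauss y) * expR (complex.Re w)) =
   cabs (gauss y) * (4 * (3 * pi * B ^+ 2 * d) ^+ 2 * (1 + expR (complex.Re w))) by ring.
rewrite ler_wpM2l//; apply: ler_wpM2r; first by rewrite addr_ge0// ltW.
by rewrite ler_pM2l.
Qed.

Lemma cabs_affine (c M : R) (rho a : C) (x : R) : admissible c M rho a ->
  cabs (rho * x%:K + a) <= M * (1 + `|x|).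
Proof.
case=> _ hr ha; rewrite (le_trans (cabsD _ _))// cabsM cabs_real mulrDr mulr1 addrC.
by rewrite lerD// ler_wpM2r.
Qed.

Lemma poly_absorb (X G P : R) (k : nat) : 1 <= X -> 0 <= G -> (k <= 6)%N ->
  X ^+ 6 * G <= P -> X ^+ k * G <= P.
Proof. by move=> X1 G0 k6; apply: le_trans; rewrite ler_wpM2r// ler_weXn2l. Qed.

(* The derivative of [t |-> (rho + t e) g((rho + t e) x + a + t f)] at [0] is the
   derivative of [x |-> (e x + f) g(rho x + a)], whose mesh sums telescope. *)
Lemma gauss_step (c M : R) : 0 < c -> exists2 A : R, 0 <= A &
  forall (rho a e f : C) (d x : R), 0 <= d <= 1 ->
    admissible c M rho a -> admissible c M (rho + e * d%:K) (a + f * d%:K) ->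
    admissible c M rho (a + rho * d%:K) ->
    cabs e <= M -> cabs f <= M ->
  cabs ((rho + e * d%:K) * gauss ((rho + e * d%:K) * x%:K + (a + f * d%:K)) -
        rho * gauss (rho * x%:K + a) -
        ((e * (x + d)%:K + f) * gauss (rho * (x + d)%:K + a) -
         (e * x%:K + f) * gauss (rho * x%:K + a)))
    <= d ^+ 2 * A * expR (- `|x|).
Proof.
move=> c0; have [A A0 hA] := gauss_bound M c0.
have [K K0 hK] := gauss_taylor.
exists (8 * pi * `|M| ^+ 3 * A + 8 * K * `|M| ^+ 5 * A).
  by rewrite addr_ge0// !mulr_ge0 ?exprn_ge0 ?pi_ge0.
move=> rho a e f d x hd ad ad1 ad2 he hf; have /andP[d0 d1] := hd.
have M0 : 0 <= M by apply: le_trans he; exact: cabs_ge0.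
rewrite (ger0_norm M0).
set y := rho * x%:K + a; set v := e * x%:K + f; set X := 1 + `|x|.
have X1 : 1 <= X by rewrite lerDl.
have X0 : 0 <= X by apply: le_trans X1.
have hy : cabs y <= M * X := cabs_affine x ad.
have hv : cabs v <= M * X.
  by rewrite (le_trans (cabsD _ _))// cabsM cabs_real mulrDr mulr1 addrC lerD// ler_wpM2r.
have hr0 : cabs rho <= M by case: ad.
have hr : cabs rho <= M * X by rewrite (le_trans hr0)// ler_peMr.
have -> : (rho + e * d%:K) * x%:K + (a + f * d%:K) = y + v * d%:K by rewrite /y /v; ring.
have -> : rho * (x + d)%:K + a = y + rho * d%:K by rewrite /y rmorphD /=; ring.
have -> : e * (x + d)%:K + f = v + e * d%:K by rewrite /v rmorphD /=; ring.
set G := gauss y; set G1 := gauss (y + v * d%:K); set G2 := gauss (y + rho * d%:K).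
set P := A * expR (- `|x|).
have P0 : 0 <= P by rewrite mulr_ge0 ?expR_ge0.
have bG : X ^+ 6 * cabs G <= P := hA _ _ ad x.
have bG1 : X ^+ 6 * cabs G1 <= P.
  have := hA _ _ ad1 x; rewrite (_ : _ * x%:K + _ = y + v * d%:K)//.
  by rewrite /y /v; ring.
have bG2 : X ^+ 6 * cabs G2 <= P.
  have := hA _ _ ad2 x; rewrite (_ : _ * x%:K + _ = y + rho * d%:K)//.
  by rewrite /y; ring.
have T1 := hK _ _ _ _ hd hy hv; have T2 := hK _ _ _ _ hd hy hr.
rewrite -/G -/G1 in T1; rewrite -/G -/G2 in T2.
set r1 := (X in cabs X <= _) in T1; set r2 := (X in cabs X <= _) in T2.
(* The first-order terms cancel. What remains is two Taylor remainders and an explicit term carrying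
   [d ^+ 2]. *)
have -> : (rho + e * d%:K) * G1 - rho * G - ((v + e * d%:K) * G2 - v * G) =
  (rho + e * d%:K) * r1 - (v + e * d%:K) * r2 +
  (- (pi : R)%:K) * (d%:K) ^+ 2 * G * (rho * v * (v - rho) + e * (2 * y * (v - rho) + d%:K * (v ^+ 2 - rho ^+ 2))).
  by rewrite /r1 /r2; ring.
have c2 : cabs (2 : C) = 2 by rewrite -(rmorph_nat (real_complex R)) cabs_real normr_nat.
have bm : cabs (v - rho) <= 2 * (M * X) by rewrite (le_trans (cabsB _ _))//; lra.
have bq : cabs (v ^+ 2 - rho ^+ 2) <= 2 * (M * X) ^+ 2.
  rewrite (le_trans (cabsB _ _))// !cabsX.
  have h1 : cabs v ^+ 2 <= (M * X) ^+ 2 by rewrite lerXn2r ?nnegrE ?mulr_ge0 ?cabs_ge0.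
  have h2 : cabs rho ^+ 2 <= (M * X) ^+ 2 by rewrite lerXn2r ?nnegrE ?mulr_ge0 ?cabs_ge0.
  by lra.
have MX : M <= M * X by rewrite ler_peMr.
have MX0 : 0 <= M * X by rewrite mulr_ge0.
have be : cabs (e * d%:K) <= M * X.
  rewrite cabsM cabs_real (ger0_norm d0) (le_trans _ MX)// -[leRHS]mulr1.
  by rewrite ler_pM ?cabs_ge0.
have b3 : cabs (rho * v * (v - rho) + e * (2 * y * (v - rho) + d%:K * (v ^+ 2 - rho ^+ 2)))
    <= 8 * (M * X) ^+ 3.
  have h1 : cabs (rho * v * (v - rho)) <= (M * X) * (M * X) * (2 * (M * X)).
    by rewrite !cabsM !ler_pM ?mulr_ge0 ?cabs_ge0.
  have h2 : cabs (2 * y * (v - rho)) <= 2 * (M * X) * (2 * (M * X)).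
    by rewrite !cabsM c2 !ler_pM ?mulr_ge0 ?cabs_ge0.
  have h3 : cabs (d%:K * (v ^+ 2 - rho ^+ 2)) <= 1 * (2 * (M * X) ^+ 2).
    by rewrite cabsM cabs_real (ger0_norm d0) ler_pM ?cabs_ge0.
  have h4 : cabs (e * (2 * y * (v - rho) + d%:K * (v ^+ 2 - rho ^+ 2))) <= (M * X) * (6 * (M * X) ^+ 2).
    rewrite cabsM ler_pM ?cabs_ge0//; first exact: le_trans MX.
    by rewrite (le_trans (cabsD _ _))//; move: h2 h3; rewrite expr2; lra.
  by rewrite (le_trans (cabsD _ _))//; move: h1 h4; rewrite !expr2 !exprS expr0; lra.
have hG (g : C) (k : nat) : X ^+ 6 * cabs g <= P -> (k <= 6)%N -> X ^+ k * cabs g <= P.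
  by move=> hg k6; apply: poly_absorb hg; rewrite ?cabs_ge0.
have D0 : 0 <= d ^+ 2 by exact: sqr_ge0.
have brem (w r g : C) : cabs w <= M * X -> cabs r <= K * (M * X) ^+ 4 * d ^+ 2 * (cabs G + cabs g) ->
   X ^+ 6 * cabs g <= P -> cabs ((w + e * d%:K) * r) <= 4 * K * M ^+ 5 * d ^+ 2 * P.
  move=> hw hrr hg; rewrite cabsM.
  apply: (@le_trans _ _ (2 * (M * X) * (K * (M * X) ^+ 4 * d ^+ 2 * (cabs G + cabs g)))).
    rewrite ler_pM ?cabs_ge0// (le_trans (cabsD _ _))//; lra.
  rewrite [leLHS](_ : _ = 2 * K * M ^+ 5 * d ^+ 2 * (X ^+ 5 * cabs G + X ^+ 5 * cabs g)); last by ring.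
  rewrite [leRHS](_ : _ = 2 * K * M ^+ 5 * d ^+ 2 * (P + P)); last by ring.
  apply: ler_wpM2l; first by rewrite !mulr_ge0 ?exprn_ge0.
  by apply: lerD; apply: hG.
have q1 := brem _ _ _ hr T1 bG1; have q2 := brem _ _ _ hv T2 bG2.
have q3 : cabs (- (pi : R)%:K * (d%:K) ^+ 2 * G * (rho * v * (v - rho) + e * (2 * y * (v - rho) + d%:K * (v ^+ 2 - rho ^+ 2))))
   <= 8 * pi * M ^+ 3 * d ^+ 2 * P.
  rewrite cabsM [cabs (_ * G)]cabsM [cabs (- _ * _)]cabsM cabsN cabsX !cabs_real (ger0_norm d0) (ger0_norm (pi_ge0 _)).
  apply: (@le_trans _ _ (pi * d ^+ 2 * cabs G * (8 * (M * X) ^+ 3))).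
    by rewrite ler_wpM2l// !mulr_ge0 ?pi_ge0 ?cabs_ge0.
  rewrite [leLHS](_ : _ = 8 * pi * M ^+ 3 * d ^+ 2 * (X ^+ 3 * cabs G)); last by ring.
  by apply: ler_wpM2l; [rewrite !mulr_ge0 ?exprn_ge0 ?pi_ge0 | apply: hG].
apply: (le_trans (cabsD _ _)); apply: (le_trans (lerD (cabsB _ _) (lexx _))).
by move: q1 q2 q3; rewrite /P; lra.
Qed.

(** The second difference is needed for the decay of the mesh Fourier coefficients in [j], where it
    plays the role of two integrations by parts. *)
Lemma gauss_diff2 (c M : R) : 0 < c -> exists2 A : R, 0 <= A &
  forall (rho a : C) (d x : R), 0 <= d <= 1 -> admissible c M rho a ->
    admissible c M rho (a + rho * d%:K) -> admissible c M rho (a - rho * d%:K) ->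
  cabs (gauss (rho * (x + d)%:K + a) + gauss (rho * (x - d)%:K + a)
        - 2 * gauss (rho * x%:K + a))
    <= d ^+ 2 * A * expR (- `|x|).
Proof.
move=> c0; have [A A0 hA] := gauss_bound M c0.
have [K K0 hK] := gauss_taylor.
exists (2 * pi * `|M| ^+ 2 * A + 4 * K * `|M| ^+ 4 * A).
  by rewrite addr_ge0// !mulr_ge0 ?exprn_ge0 ?pi_ge0.
move=> rho a d x hd ad ad1 ad2; have /andP[d0 d1] := hd.
have hr0 : cabs rho <= M by case: ad.
have M0 : 0 <= M by apply: le_trans hr0; exact: cabs_ge0.
rewrite (ger0_norm M0).
set y := rho * x%:K + a; set X := 1 + `|x|.
have X1 : 1 <= X by rewrite lerDl.
have X0 : 0 <= X by apply: le_trans X1.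
have hy : cabs y <= M * X := cabs_affine x ad.
have hr : cabs rho <= M * X by rewrite (le_trans hr0)// ler_peMr.
have hr' : cabs (- rho) <= M * X by rewrite cabsN.
have -> : rho * (x + d)%:K + a = y + rho * d%:K by rewrite /y rmorphD /=; ring.
have -> : rho * (x - d)%:K + a = y + (- rho) * d%:K by rewrite /y rmorphB /=; ring.
set G := gauss y; set G1 := gauss (y + rho * d%:K); set G2 := gauss (y + (- rho) * d%:K).
set P := A * expR (- `|x|).
have P0 : 0 <= P by rewrite mulr_ge0 ?expR_ge0.
have bG : X ^+ 6 * cabs G <= P := hA _ _ ad x.
have bG1 : X ^+ 6 * cabs G1 <= P.
  have := hA _ _ ad1 x; rewrite (_ : _ * x%:K + _ = y + rho * d%:K)//.
  by rewrite /y; ring.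
have bG2 : X ^+ 6 * cabs G2 <= P.
  have := hA _ _ ad2 x; rewrite (_ : _ * x%:K + _ = y + (- rho) * d%:K)//.
  by rewrite /y; ring.
have T1 := hK _ _ _ _ hd hy hr; have T2 := hK _ _ _ _ hd hy hr'.
rewrite -/G -/G1 in T1; rewrite -/G -/G2 in T2.
set r1 := (X in cabs X <= _) in T1; set r2 := (X in cabs X <= _) in T2.
have -> : G1 + G2 - 2 * G = r1 + r2 - 2 * (pi : R)%:K * (rho * d%:K) ^+ 2 * G.
  by rewrite /r1 /r2; ring.
have hG (g : C) (k : nat) : X ^+ 6 * cabs g <= P -> (k <= 6)%N -> X ^+ k * cabs g <= P.
  by move=> hg k6; apply: poly_absorb hg; rewrite ?cabs_ge0.
have D0 : 0 <= d ^+ 2 by exact: sqr_ge0.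
have c2 : cabs (2 : C) = 2 by rewrite -(rmorph_nat (real_complex R)) cabs_real normr_nat.
have brem (r g : C) : cabs r <= K * (M * X) ^+ 4 * d ^+ 2 * (cabs G + cabs g) ->
   X ^+ 6 * cabs g <= P -> cabs r <= 2 * K * M ^+ 4 * d ^+ 2 * P.
  move=> hrr hg; apply: (le_trans hrr).
  rewrite [leLHS](_ : _ = K * M ^+ 4 * d ^+ 2 * (X ^+ 4 * cabs G + X ^+ 4 * cabs g)); last by ring.
  rewrite [leRHS](_ : _ = K * M ^+ 4 * d ^+ 2 * (P + P)); last by ring.
  apply: ler_wpM2l; first by rewrite !mulr_ge0 ?exprn_ge0.
  by apply: lerD; apply: hG.
have q1 := brem _ _ T1 bG1; have q2 := brem _ _ T2 bG2.
have q3 : cabs (2 * (pi : R)%:K * (rho * d%:K) ^+ 2 * G) <= 2 * pi * M ^+ 2 * d ^+ 2 * P.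
  rewrite cabsM [cabs (_ * _ ^+ 2)]cabsM [cabs (2 * _)]cabsM c2 cabsX [cabs (rho * _)]cabsM !cabs_real (ger0_norm d0) (ger0_norm (pi_ge0 _)) exprMn.
  have hM2 : cabs rho ^+ 2 <= M ^+ 2 by rewrite lerXn2r ?nnegrE ?cabs_ge0.
  have hG0 : cabs G <= P by have := hG G 0%N bG isT; rewrite expr0 mul1r.
  rewrite [leLHS](_ : _ = 2 * pi * d ^+ 2 * (cabs rho ^+ 2 * cabs G)); last by ring.
  rewrite [leRHS](_ : _ = 2 * pi * d ^+ 2 * (M ^+ 2 * P)); last by ring.
  apply: ler_wpM2l; first by rewrite !mulr_ge0 ?pi_ge0.
  by apply: ler_pM; rewrite ?exprn_ge0 ?cabs_ge0.
apply: (le_trans (cabsB _ _)); apply: (le_trans (lerD (cabsD _ _) (lexx _))).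
by move: q1 q2 q3; rewrite /P; lra.
Qed.

Lemma admissible_le (c M M' : R) (rho a : C) : M <= M' ->
  admissible c M rho a -> admissible c M' rho a.
Proof. by move=> h [h1 h2 h3]; split=> //; apply: le_trans h. Qed.

Lemma admissible_shift (c M : R) (rho a : C) (b : C) : cabs b <= M ->
  admissible c M rho a -> admissible c (2 * M) rho (a + b).
Proof.
move=> hb [h1 h2 h3]; have M0 : 0 <= M by apply: le_trans hb; exact: cabs_ge0.
split=> //; first lra.
by rewrite (le_trans (cabsD _ _))//; lra.
Qed.

Lemma admissible_convex (c M : R) (rho a rho' a' : C) (t : R) : 0 <= t <= 1 ->
  admissible c M rho a -> admissible c M rho' a' ->
  admissible c M (rho + (rho' - rho) * t%:K) (a + (a' - a) * t%:K).
Proof.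
move=> /andP[t0 t1] [h1 h2 h3] [h1' h2' h3'].
have t1' : 0 <= 1 - t by rewrite subr_ge0.
have e (z z' : C) : z + (z' - z) * t%:K = (1 - t)%:K * z + t%:K * z'.
  by rewrite rmorphB /=; ring.
have conv (z z' : C) (B : R) : cabs z <= B -> cabs z' <= B -> cabs (z + (z' - z) * t%:K) <= B.
  move=> hz hz'; rewrite e (le_trans (cabsD _ _))// !cabsM !cabs_real !ger0_norm//.
  have : (1 - t) * cabs z <= (1 - t) * B by rewrite ler_wpM2l.
  have : t * cabs z' <= t * B by rewrite ler_wpM2l.
  lra.
split; [|exact: conv|exact: conv].
rewrite e !ReIm /= !mul0r !subr0 !addr0.
have := ler_normD ((1 - t) * complex.Im rho) (t * complex.Im rho').
rewrite !normrM (ger0_norm t0) (ger0_norm t1').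
have : (1 - t) * c <= (1 - t) * (complex.Re rho - `|complex.Im rho|) by rewrite ler_wpM2l.
have : t * c <= t * (complex.Re rho' - `|complex.Im rho'|) by rewrite ler_wpM2l.
lra.
Qed.

Lemma riemann_step (c M : R) : 0 < c -> exists2 A : R, 0 <= A &
  forall (l : nat) (rho a e f : C), (0 < l)%N ->
    admissible c M rho a -> admissible c M (rho + e * (l%:R^-1 : R)%:K) (a + f * (l%:R^-1 : R)%:K) ->
    admissible c M rho (a + rho * (l%:R^-1 : R)%:K) -> cabs e <= M -> cabs f <= M ->
  cabs (riemann l (rho + e * (l%:R^-1 : R)%:K) (a + f * (l%:R^-1 : R)%:K) - riemann l rho a)
    <= A / l%:R ^+ 2.
Proof.
move=> c0; have [A A0 hA] := gauss_step M c0; exists (10 * A); first by rewrite mulr_ge0.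
move=> l rho a e f l0 ad ad1 ad2 he hf; set d : R := l%:R^-1.
have l1 : 0 < l%:R :> R by rewrite ltr0n.
have hd : 0 <= d <= 1 by rewrite invr_ge0 ler0n/= invf_le1// ler1n.
have M0 : 0 <= M by apply: le_trans he; exact: cabs_ge0.
pose x_ (k : int) : R := k%:~R / l%:R.
have xS (k : int) : x_ (k + 1) = x_ k + d by rewrite /x_ rmorphD /= mulrDl div1r.
pose V (k : int) : C := (e * (x_ k)%:K + f) * gauss (rho * (x_ k)%:K + a).
have hV : hassum V (tsum V).
  have [B B0 hB] := gauss_bound M c0.
  have [||//] := @mesh_hassum l V (M * B) l0; first by rewrite mulr_ge0.
  move=> k; rewrite /V cabsM -mulrA.
  apply: (@le_trans _ _ (M * (1 + `|x_ k|) * cabs (gauss (rho * (x_ k)%:K + a)))).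
    rewrite ler_wpM2r ?cabs_ge0// (le_trans (cabsD _ _))// cabsM cabs_real mulrDr mulr1 addrC.
    by rewrite lerD// ler_wpM2r.
  rewrite -mulrA ler_wpM2l//; apply: le_trans (hB _ _ ad _).
  by rewrite ler_wpM2r ?cabs_ge0// -{1}(expr1 (1 + _)) le_poly.
(* The mesh sums of [V] and of its translate by one step agree, so the first-order part isolated by
   [gauss_step] contributes nothing; only errors of size [d ^+ 2] remain. *)
have h0 := hassumB (shiftz_hassum 1 hV) hV; rewrite subrr in h0.
have h1 := riemann_hassum l0 c0 ad; have h2 := riemann_hassum l0 c0 ad1.
have h3 := hassumB (hassumB h2 h1) (hassumZ (d%:K) h0); rewrite mulr0 subr0 in h3.
have dM (z : C) : (l%:R^-1 : C) * z = d%:K * z by rewrite /d fmorphV rmorph_nat.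
have hdA : 0 <= d * (d ^+ 2 * A) by rewrite !mulr_ge0 ?exprn_ge0//; case/andP: hd.
apply: (le_trans (mesh_le l0 hdA h3 _)).
  move=> k; rewrite !dM -!mulrBr cabsM cabs_real ger0_norm; last by case/andP: hd.
  rewrite -mulrA ler_wpM2l//; first by case/andP: hd.
  by rewrite /V xS; apply: hA.
rewrite le_eqVlt; apply/orP; left; apply/eqP.
by rewrite /d; field; rewrite gt_eqF.
Qed.

(** A discrete contour shift: the segment between the two parameters is cut into [l] steps, each
    costing at most [A / l^2]. The segment stays admissible because the sector is convex; the bound
    [2 M] accommodates the differences of parameters and the shifted offsets. *)
Lemma riemann_close (c M : R) : 0 < c -> 0 <= M -> exists2 A : R, 0 <= A &
  forall (l : nat) (rho a rho' a' : C), (0 < l)%N ->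
    admissible c M rho a -> admissible c M rho' a' ->
  cabs (riemann l rho' a' - riemann l rho a) <= A / l%:R.
Proof.
move=> c0 M0; have [A A0 hA] := riemann_step (2 * M) c0; exists A => //.
move=> l rho a rho' a' l0 ad ad'; have l1 : 0 < l%:R :> R by rewrite ltr0n.
pose r t := rho + (rho' - rho) * (t%:R / l%:R : R)%:K.
pose b t := a + (a' - a) * (t%:R / l%:R : R)%:K.
have MM : M <= 2 * M by lra.
have hd : cabs ((l%:R^-1 : R)%:K) <= 1.
  by rewrite cabs_real ger0_norm ?invr_ge0// invf_le1// ler1n.
have adt t : (t <= l)%N -> admissible c M (r t) (b t).
  by move=> tl; apply: admissible_convex => //; rewrite divr_ge0//= ler_pdivrMr// mul1r ler_nat.
have st t : (t <= l)%N -> cabs (riemann l (r t) (b t) - riemann l rho a) <= t%:R * (A / l%:R ^+ 2).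
  elim: t => [|t IH] tl.
    by rewrite /r /b !mul0r !mulr0 !addr0 subrr cabs0.
  rewrite (le_trans (cabs_triangle (riemann l (r t) (b t)) _ _))//.
  rewrite -natr1 mulrDl mul1r addrC lerD ?IH 1?ltnW//.
  have eS (z z' : C) : z + z' * (t.+1%:R / l%:R : R)%:K = z + z' * (t%:R / l%:R : R)%:K + z' * (l%:R^-1 : R)%:K.
    by rewrite -natr1 mulrDl mul1r rmorphD /=; ring.
  have a1 := adt t (ltnW tl); have a2 := adt _ tl; move: a2; rewrite /r /b !eS => a2.
  apply: hA => //.
  - exact: admissible_le a1.
  - exact: admissible_le a2.
  - apply: admissible_shift => //; case: a1 => _ h _.
    by rewrite cabsM -[leRHS]mulr1 ler_pM ?cabs_ge0.
  - by case: ad ad' => _ h1 _ [_ h2 _]; rewrite (le_trans (cabsB _ _))//; lra.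
  - by case: ad ad' => _ _ h1 [_ _ h2]; rewrite (le_trans (cabsB _ _))//; lra.
have := st l (leqnn l).
have -> : r l = rho' by rewrite /r divff ?gt_eqF// mulr1 addrC subrK.
have -> : b l = a' by rewrite /b divff ?gt_eqF// mulr1 addrC subrK.
move=> h; apply: (le_trans h).
rewrite le_eqVlt; apply/orP; left; apply/eqP; field; by rewrite gt_eqF.
Qed.

(** * Fourier coefficients on a mesh and their limit *)

Section Fourier.
Variables (rho u : C).
Hypothesis rho_sector : `|complex.Im rho| < complex.Re rho.

Let c : R := complex.Re rho - `|complex.Im rho|.
Let c0 : 0 < c. Proof. by rewrite subr_gt0. Qed.

Lemma sector_neq0 : rho != 0.
Proof.
apply/negP => /eqP h; move: rho_sector; rewrite h /= normr0 ltxx//.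
Qed.

Let M (b : C) : R := 2 * (cabs rho + cabs b).

Let admM (b : C) : admissible c (M b) rho b.
Proof.
have := cabs_ge0 rho; have := cabs_ge0 b; rewrite /M => h1 h2.
by split=> //; lra.
Qed.

Definition dual_term (j : int) : C :=
  cexp (- (pi : R)%:K * j%:~R ^+ 2 / rho ^+ 2 + tpi * (j%:~R * u)).

(** Up to a constant factor the dual terms are again Gaussian values, along the line of slope
    [1 / rho], which lies in the same sector. *)
Lemma dual_term_hassum : hassum dual_term (tsum dual_term).
Proof.
have hn : complex.Re rho^-1 - `|complex.Im rho^-1| > 0.
  have -> : rho^-1 = ((complex.Re rho ^+ 2 + complex.Im rho ^+ 2)^-1)%:K * Complex (complex.Re rho) (- complex.Im rho).
    rewrite invc_norm -add_Re2_Im2 -fmorphV; by case: (rho).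
  rewrite !ReIm /= !mul0r subr0 addr0 normrM normrN ger0_norm; last first.
    by rewrite invr_ge0 addr_ge0 ?sqr_ge0.
  rewrite -mulrBr mulr_gt0 ?c0// invr_gt0 ltr_wpDr ?sqr_ge0// exprn_even_gt0//=.
  by rewrite gt_eqF// (le_lt_trans _ rho_sector).
set c' := (X in X > 0) in hn; set b := - 'i%C * rho * u.
have ad : admissible c' (cabs rho^-1 + cabs b) rho^-1 b.
  by split; rewrite ?lerDl ?lerDr ?cabs_ge0.
have h := @gauss_mesh_hassum 1 isT _ _ _ _ hn ad.
have := hassumZ (cexp (- (pi : R)%:K * rho ^+ 2 * u ^+ 2)) h.
set s := (X in hassum _ X); move=> {}h; apply: (@hassum_tsum _ _ _ s); apply: eq_hassum h => j.
rewrite /gauss -cexpD /dual_term; congr cexp.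
rewrite divr1 rmorph_int /b /tpi; have i2 := @sqrc_i R; rewrite -expr2 in i2.
apply/eqP; rewrite -subr_eq0; apply/eqP.
transitivity (- (pi : R)%:K * (('i%C ^+ 2 + 1) * rho ^+ 2 * u ^+ 2) : C).
  by field; exact: sector_neq0.
by rewrite i2; ring.
Qed.

(** The [j]-th Fourier coefficient of [x |-> gauss (rho x + rho u)], computed on the mesh of step
    [1 / l]. It has period [l] in [j], which is why later [l = 2 J + 1] and [|j| <= J]. *)
Definition mesh_coef (l : nat) (j : int) : C :=
  l%:R^-1 * tsum (fun k : int => gauss (rho * (k%:~R / l%:R : R)%:K + rho * u) *
    cexp (- tpi * (j%:~R * (k%:~R / l%:R)))).

(** Completing the square absorbs the character into a displacement of the line by [i j / rho], so
    the limit of the coefficient is again governed by [riemann_close]. *)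
Lemma mesh_coefE (l : nat) (j : int) : (0 < l)%N ->
  mesh_coef l j = dual_term j / rho * riemann l rho (rho * u + 'i%C * j%:~R / rho).
Proof.
move=> l0; set b := rho * u + _; have h := riemann_hassum l0 c0 (admM b).
have h2 := hassumZ (l%:R * (dual_term j / rho)) h.
rewrite /mesh_coef (tsumE (s := l%:R * (dual_term j / rho) * riemann l rho b)).
  by rewrite !mulrA mulVf ?mul1r// pnatr_eq0 -lt0n.
apply: eq_hassum h2 => k; set x : R := k%:~R / l%:R.
have -> : (k%:~R / l%:R : C) = x%:K by rewrite /x rmorphM /= fmorphV rmorph_int rmorph_nat.
have l1 : (l%:R : C) != 0 by rewrite pnatr_eq0 -lt0n.
transitivity (dual_term j * gauss (rho * x%:K + b)).
  by field; rewrite ?sector_neq0 ?l1.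
rewrite /gauss /dual_term -!cexpD; congr cexp.
have i2 := @sqrc_i R; rewrite -expr2 in i2.
apply/eqP; rewrite -subr_eq0; apply/eqP; rewrite /b /tpi.
transitivity (- (pi : R)%:K * (('i%C ^+ 2 + 1) * j%:~R ^+ 2 / rho ^+ 2) : C).
  by field; exact: sector_neq0.
by rewrite i2; ring.
Qed.

Lemma mesh_coef_hassum (l : nat) (j : int) : (0 < l)%N ->
  hassum (fun k : int => gauss (rho * (k%:~R / l%:R : R)%:K + rho * u) *
    cexp (- tpi * (j%:~R * (k%:~R / l%:R)))) (l%:R * mesh_coef l j).
Proof.
move=> l0; have l1 : (l%:R : C) != 0 by rewrite pnatr_eq0 -lt0n.
rewrite /mesh_coef mulrA divff// mul1r; apply: summable_hassum.
have [h _] := gauss_mesh_hassum l0 c0 (admM (rho * u)).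
apply: bsums_le h => k; rewrite cabsM cabs_cexp.
have -> : (k%:~R / l%:R : C) = (k%:~R / l%:R : R)%:K by rewrite rmorphM /= fmorphV rmorph_int rmorph_nat.
by rewrite tpiE -(rmorph_int (real_complex R)) !ReIm /=; rewrite !(mul0r, mulr0, oppr0, subr0, addr0) expR0 mulr1.
Qed.

Lemma sin_ge_half (x : R) : 0 <= x <= pi / 2 -> x / 2 <= sin x.
Proof.
move=> /andP[x0 x1]; move: x0; rewrite le_eqVlt => /predU1P[<-|x0].
  by rewrite mul0r sin0.
set k : R := cos (pi / 4).
have p0 := pi_gt0 R.
have k2 : k ^+ 2 = 1 / 2.
  have : cos ((pi / 4 : R) *+ 2) = 0.
    by rewrite (_ : _ *+ 2 = pi / 2 :> R) ?cos_pihalf// -mulr_natr; field.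
  by rewrite cos_mulr2n -/k => h; lra.
have k0 : 0 <= k by rewrite cos_ge0_pihalf//; apply/andP; split; lra.
set t := x / 2; have t0 : 0 < t by rewrite divr_gt0.
have t1 : t <= pi / 4 by rewrite /t; lra.
have hk s : 0 <= s <= pi / 4 -> k <= cos s.
  move=> /andP[s0]; rewrite le_eqVlt => /predU1P[->//|s1].
  by rewrite ltW// ltr_cos// ?in_itv /=; [apply/andP; split; lra|apply/andP; split; lra].
have hc : {within `[0, t], continuous (@sin R)}.
  by apply: continuous_subspaceT; exact: continuous_sin.
have [d dt] := MVT t0 (fun y _ => is_derive_sin y) hc.
rewrite sin0 !subr0 => hs.
have hd : k <= cos d.
  by apply: hk; move: dt; rewrite in_itv /= => /andP[d0 d1]; apply/andP; split; lra.
have ht : k <= cos t by apply: hk; rewrite (ltW t0).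
have -> : sin x = 2 * (cos t * sin t).
  by rewrite mulr_natl -sin_mulr2n -mulr_natr /t divfK.
have h1 : k * t <= sin t by rewrite hs ler_wpM2r// ltW.
have h2 : k * (k * t) <= cos t * sin t.
  by apply: ler_pM => //; rewrite mulr_ge0// ltW.
have : k * (k * t) = t / 2 by rewrite mulrA -expr2 k2; field.
by move: h2; lra.
Qed.

Lemma two_cos_sub2 (x : R) : `|2 * cos (2 * x) - 2| = 4 * sin x ^+ 2.
Proof.
have -> : 2 * x = x *+ 2 by rewrite mulr_natl.
rewrite cos_mulr2n cos2sin2 -normrN ger0_norm; last first.
  by rewrite -mulr_natl; have := sqr_ge0 (sin x); lra.
by rewrite -mulr_natl; ring.
Qed.

(** Two summations by parts. The factor they produce has modulus [4 sin^2 (pi j / l)], at least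
    [(j / l)^2] for [2 |j| <= l], whereas the second difference of the Gaussian is of size [l^-2]. A
    majorant independent of [J] is what [hassum_dominated] requires. *)
Lemma mesh_coef_bound : exists2 A : R, 0 <= A & forall (J : nat) (j : int), (`|j| <= J)%N ->
  cabs (mesh_coef (J.*2.+1) j) <= A / (1 + `|j|%:R ^+ 2).
Proof.
have [A1 A10 h1] := gauss_bound (M (rho * u)) c0.
have [A2 A20 h2] := gauss_diff2 (2 * M (rho * u)) c0.
exists (10 * A1 + 10 * A2); first by rewrite addr_ge0 ?mulr_ge0.
move=> J j jJ; set r : R := `|j|%:R.
have : (`|j|.*2 < J.*2.+1)%N by rewrite ltnS leq_double.
move: J.*2.+1 => l {jJ J} jl.
have l0 : (0 < l)%N by apply: leq_ltn_trans jl.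
have l1 : 0 < l%:R :> R by rewrite ltr0n.
have hs := mesh_coef_hassum j l0; set f := (X in hassum X _) in hs.
pose x_ (k : int) : R := k%:~R / l%:R; pose d : R := l%:R^-1.
have kx (k : int) : (k%:~R / l%:R : C) = (x_ k)%:K by rewrite rmorphM /= fmorphV rmorph_int rmorph_nat.
have fE k : f k = gauss (rho * (x_ k)%:K + rho * u) * cexp (- tpi * (j%:~R * (x_ k)%:K)).
  by rewrite /f; congr (_ * cexp (- tpi * (j%:~R * _))); exact: kx.
have cchi (x : R) : cabs (cexp (- tpi * (j%:~R * x%:K))) = 1.
  rewrite cabs_cexp tpiE -(rmorph_int (real_complex R)) !ReIm /=.
  by rewrite !(mul0r, mulr0, oppr0, subr0, addr0) expR0.
have hl : cabs (l%:R : C) = l%:R by rewrite -(rmorph_nat (real_complex R)) cabs_real normr_nat.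
have b1 : cabs (mesh_coef l j) <= 10 * A1.
  rewrite -(ler_pM2r l1) mulrC -hl -cabsM hl; apply: (mesh_le l0 A10 hs) => k.
  have hk := h1 _ _ (admM (rho * u)) (x_ k).
  rewrite fE cabsM cchi mulr1; apply: (le_trans _ hk).
  by rewrite ler_peMl ?cabs_ge0// exprn_ege1// lerDl.
have b2 : cabs (mesh_coef l j) * r ^+ 2 <= 10 * A2.
  pose om : C := cexp (tpi * (j%:~R * d%:K)).
  have om0 : om != 0 by exact: cexp_neq0.
  (* Shifting the index does not change a sum, so this combination sums to [om + om^-1 - 2] times
     the coefficient. The weights cancel the variation of the character and leave a second
     difference of the Gaussian alone. *)
  have hS : hassum (fun k => om * f (k + 1) + om^-1 * f (k + -1) - 2 * f k)
      ((om + om^-1 - 2) * (l%:R * mesh_coef l j)).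
    rewrite mulrBl mulrDl; apply: hassumB; last exact: hassumZ.
    by apply: hassumD; apply/hassumZ/shiftz_hassum.
  have hd : 0 <= d <= 1 by rewrite invr_ge0 ler0n/= invf_le1// ler1n.
  have xS (k : int) : x_ (k + 1) = x_ k + d by rewrite /x_ rmorphD /= mulrDl div1r.
  have xN (k : int) : x_ (k + -1) = x_ k - d by rewrite /x_ rmorphD /= rmorphN mulrDl mulNr div1r.
  have hrd : cabs (rho * d%:K) <= M (rho * u).
    rewrite cabsM cabs_real ger0_norm; last by case/andP: hd.
    have : cabs rho * d <= cabs rho * 1 by rewrite ler_wpM2l ?cabs_ge0//; case/andP: hd.
    by rewrite /M; have := cabs_ge0 rho; have := cabs_ge0 (rho * u); lra.
  have M0 : 0 <= M (rho * u) by apply: le_trans hrd; exact: cabs_ge0.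
  have dA : 0 <= d ^+ 2 * A2 by rewrite mulr_ge0 ?sqr_ge0.
  have hb : cabs ((om + om^-1 - 2) * (l%:R * mesh_coef l j)) <= 10 * (d ^+ 2 * A2) * l%:R.
    apply: (mesh_le l0 dA hS) => k.
    have -> : om * f (k + 1) + om^-1 * f (k + -1) - 2 * f k =
      (gauss (rho * (x_ k + d)%:K + rho * u) + gauss (rho * (x_ k - d)%:K + rho * u)
       - 2 * gauss (rho * (x_ k)%:K + rho * u)) * cexp (- tpi * (j%:~R * (x_ k)%:K)).
      rewrite !fE xS xN /om -cexpN.
      have e1 : cexp (- tpi * (j%:~R * (x_ k + d)%:K)) = cexp (- tpi * (j%:~R * (x_ k)%:K)) * cexp (- (tpi * (j%:~R * d%:K))).
        by rewrite -cexpD rmorphD /=; congr cexp; ring.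
      have e2 : cexp (- tpi * (j%:~R * (x_ k - d)%:K)) = cexp (- tpi * (j%:~R * (x_ k)%:K)) * cexp (tpi * (j%:~R * d%:K)).
        by rewrite -cexpD rmorphB /=; congr cexp; ring.
      rewrite e1 e2 cexpN; field; exact: cexp_neq0.
    rewrite cabsM cchi mulr1 -mulrA mulrA; apply: h2 => //.
    - by apply: admissible_le (admM _); lra.
    - exact: admissible_shift.
    - by apply: admissible_shift; rewrite ?cabsN.
  pose th : R := pi * (r / l%:R).
  have hth : 0 <= th <= pi / 2.
    rewrite /th mulr_ge0 ?pi_ge0 ?divr_ge0//= ler_pM2l ?pi_gt0//.
    rewrite ler_pdivrMr// ler_pdivlMl// -natrM ler_nat mul2n; exact: ltnW.
  have hom : cabs (om + om^-1 - 2) = 4 * sin th ^+ 2.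
    have -> : om + om^-1 - 2 = (2 * cos (2 * th) - 2)%:K.
      rewrite /om -cexpN.
      have -> : tpi * (j%:~R * d%:K) = Complex 0 (2 * (pi * (j%:~R / l%:R : R))) :> C.
        rewrite tpiE -(rmorph_int (real_complex R)) /d; apply: complex_ext; rewrite !ReIm /=; ring.
      have -> : cos (2 * th) = cos (2 * (pi * (j%:~R / l%:R : R))).
        rewrite /th /r; have [j0|j0] := leP 0 j; first by rewrite -{2}(gez0_abs j0).
        by rewrite -{2}(opprK j) -(ltz0_abs j0) rmorphN /= mulNr !mulrN cosN.
      by apply: complex_ext; rewrite !ReIm /cexp /= ?oppr0 ?expR0 ?cosN ?sinN; ring.
    by rewrite cabs_real two_cos_sub2.
  have hsin := sin_ge_half hth.
  have hsin2 : (r / l%:R) ^+ 2 <= 4 * sin th ^+ 2.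
    have : (th / 2) ^+ 2 <= sin th ^+ 2.
      by rewrite lerXn2r ?nnegrE//; [case/andP: hth => h0 _; rewrite divr_ge0 | apply: le_trans hsin; case/andP: hth => h0 _; rewrite divr_ge0].
    have : (r / l%:R) ^+ 2 <= th ^+ 2.
      rewrite lerXn2r ?nnegrE ?divr_ge0//; first by case/andP: hth.
      by rewrite /th ler_peMl ?divr_ge0//; have := pi_ge2 R; lra.
    by rewrite expr_div_n; lra.
  move: hb; rewrite [cabs (_ * (l%:R * _))]cabsM [cabs (l%:R * _)]cabsM hom hl /d => hb.
  have l2 : 0 < l%:R ^+ 2 :> R by rewrite exprn_gt0.
  have : (r / l%:R) ^+ 2 * (l%:R * cabs (mesh_coef l j)) <= 10 * (l%:R^-1 ^+ 2 * A2) * l%:R.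
    by apply: le_trans hb; rewrite ler_wpM2r ?mulr_ge0 ?cabs_ge0.
  rewrite [leLHS](_ : _ = cabs (mesh_coef l j) * r ^+ 2 / l%:R); last by field; rewrite gt_eqF.
  rewrite [leRHS](_ : _ = 10 * A2 / l%:R); last by field; rewrite gt_eqF.
  by rewrite ler_pM2r ?invr_gt0.
rewrite ler_pdivlMr; first by rewrite mulrDr mulr1 lerD.
by rewrite ltr_wpDr ?sqr_ge0.
Qed.

Lemma root_sum (l : nat) (k j0 : int) : (0 < l)%N ->
  \sum_(i < l) cexp (- tpi * (((i : nat)%:Z - j0)%:~R * (k%:~R / l%:R))) =
  (if (l %| k)%Z then l%:R else 0) :> C.
Proof.
move=> l0; have l1 : (l%:R : C) != 0 by rewrite pnatr_eq0 -lt0n.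
pose om : C := cexp (- tpi * (k%:~R / l%:R)).
have e (i : 'I_l) : cexp (- tpi * (((i : nat)%:Z - j0)%:~R * (k%:~R / l%:R))) =
    cexp (tpi * (j0%:~R * (k%:~R / l%:R))) * om ^+ i.
  by rewrite /om -cexpMn -cexpD -mulr_natr rmorphB /=; congr cexp; ring.
rewrite (eq_bigr _ (fun i _ => e i)) -mulr_sumr.
have oml : om ^+ l = 1.
  rewrite /om -cexpMn -[RHS](cexp_tpi_int (- k)) -mulr_natr rmorphN /=; congr cexp.
  by field.
case: ifPn => [/dvdzP[q kq]|nd].
  have -> : om = 1.
    rewrite /om kq -[RHS](cexp_tpi_int (- q)) intrM rmorphN /=; congr cexp; by field.
  under eq_bigr do rewrite expr1n.
  rewrite sumr_const card_ord (_ : cexp _ = 1) ?mul1r//.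
  rewrite kq -[RHS](cexp_tpi_int (j0 * q)) !intrM; congr cexp; by field.
have om1 : om - 1 != 0.
  apply: contra nd; rewrite subr_eq0 => /eqP h.
  have [q hq] : exists q : int, (- k%:~R / l%:R : R) = q%:~R.
    apply: cexp_tpi_eq1; rewrite -h /om; congr cexp.
    by rewrite rmorphM rmorphN /= fmorphV rmorph_int rmorph_nat; ring.
  apply/dvdzP; exists (- q); apply: (@intr_inj R); rewrite rmorphM rmorphN /= -hq.
  by field; rewrite pnatr_eq0 -lt0n.
apply/eqP; rewrite mulf_eq0 (negbTE (cexp_neq0 _)) /=.
by rewrite -(mulrI_eq0 _ (mulfI om1)) -subrX1 oml subrr.
Qed.

(** Since [j] runs through a full residue system modulo [l = 2 J + 1], orthogonality of characters
    keeps only the mesh points [k / l] that are integers. The identity is exact for every [J]. *)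
Lemma mesh_coef_sum (J : nat) (t : C) :
  hassum (fun k : int => gauss (rho * k%:~R + rho * u)) t ->
  \sum_(i < J.*2.+1) mesh_coef J.*2.+1 ((i : nat)%:Z - J%:Z) = t.
Proof.
move=> ht; move: J.*2.+1 (ltn0Sn J.*2) => l l0.
have l1 : (l%:R : C) != 0 by rewrite pnatr_eq0 -lt0n.
have h := hassum_bigsum (I := 'I_l) (index_enum 'I_l) (P := xpredT)
  (fun i _ => mesh_coef_hassum ((i : nat)%:Z - J%:Z) l0).
have h2 : hassum (fun k : int => \sum_(i < l) gauss (rho * (k%:~R / l%:R : R)%:K + rho * u) *
    cexp (- tpi * (((i : nat)%:Z - J%:Z)%:~R * (k%:~R / l%:R)))) (t * l%:R).
  apply: (@hassum_reindex _ _ _ (fun k : int => k * l%:Z)).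
  - by apply: mulIf; rewrite eqz_nat -lt0n.
  - move=> k; rewrite -mulr_sumr root_sum//; case: ifPn => [/dvdzP[q ->] _|_].
      by exists q.
    by rewrite mulr0 eqxx.
  apply: eq_hassum (hassumZr l%:R ht) => k /=.
  have ek : ((k * l%:Z)%:~R / l%:R : R)%:K = k%:~R.
    by rewrite intrM mulfK ?rmorph_int// pnatr_eq0 -lt0n.
  by rewrite ek -mulr_sumr root_sum// dvdz_mull.
have := hassum_unique h h2; rewrite -mulr_sumr => /eqP.
by rewrite mulrC (inj_eq (mulIf l1)) => /eqP.
Qed.

Lemma riemann_bounded : exists2 A : R, 0 <= A & forall l, (0 < l)%N -> cabs (riemann l 1 0) <= A.
Proof.
have [A A0 hA] := gauss_bound 1 (ltr01 : 0 < 1 :> R).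
have ad : admissible (1 : R) 1 1 0 by split; rewrite /= ?normr0 ?subr0 ?cabs1 ?cabs0.
exists (10 * A); first by rewrite mulr_ge0.
move=> l l0; have l1 : 0 < l%:R :> R by rewrite ltr0n.
have h := riemann_hassum l0 (ltr01 : 0 < 1 :> R) ad.
rewrite [leRHS](_ : _ = 10 * (l%:R^-1 * A) * l%:R); last by field; rewrite gt_eqF.
apply: (mesh_le l0 _ h); first by rewrite mulr_ge0 ?invr_ge0.
move=> k; have hk := hA _ _ ad (k%:~R / l%:R).
rewrite mul1r cabsM -(rmorph_nat (real_complex R)) -fmorphV /= cabs_real ger0_norm ?invr_ge0//.
rewrite -mulrA ler_wpM2l ?invr_ge0//; apply: (le_trans _ hk).
by rewrite ler_peMl ?cabs_ge0// exprn_ege1// lerDl.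
Qed.

Lemma bsums_int_sqr : bsums (fun j : int => (1 + `|j|%N%:R ^+ 2)^-1 : R).
Proof.
have key (L : nat) : \sum_(i < L) (1 + (i : nat)%:R ^+ 2)^-1 <= 3 :> R.
  case: L => [|L]; first by rewrite big_ord0.
  have : \sum_(i < L.+1) (1 + (i : nat)%:R ^+ 2)^-1 <= 3 - 2 / L.+1%:R :> R.
    elim: L => [|L IH]; first by rewrite big_ord_recr big_ord0 /= add0r expr0n addr0 invr1; lra.
    rewrite big_ord_recr /=; apply: (le_trans (lerD IH (lexx _))).
    have x0 : 0 <= L%:R :> R by [].
    have e1 : L.+1%:R = L%:R + 1 :> R by rewrite natr1.
    have e2 : L.+2%:R = L%:R + 2 :> R by rewrite -!natr1; ring.
    rewrite e1 e2; set x : R := L%:R in x0 *.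
    have p1 : 0 < x + 1 by lra.
    have p2 : 0 < x + 2 by lra.
    have p3 : 0 < 1 + (x + 1) ^+ 2 by rewrite ltr_wpDr ?sqr_ge0.
    rewrite -lerBrDl (_ : _ - (3 - _) = 2 / ((x + 1) * (x + 2))); last by field; rewrite !gt_eqF.
    by rewrite ler_pdivlMr ?mulr_gt0// mulrC ler_pdivrMr//; nra.
  by move/le_trans; apply; rewrite gerBl divr_ge0.
exists (3 + 3); apply: sum_int_le => [k|L|L].
- by rewrite invr_ge0 addr_ge0 ?sqr_ge0.
- exact: key.
- apply: le_trans (key L.+1); rewrite big_ord_recl /=.
  by rewrite ler_wpDl// invr_ge0 addr_ge0 ?sqr_ge0.
Qed.

(** Each mesh coefficient differs by a vanishing amount from the dual term divided by [rho], times
    one normalisation [riemann 1 0] common to all [j]; this normalisation is merely bounded at this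
    stage, so it is kept inside the limit. *)
Lemma fourier_limit (t : C) (e : R) : 0 < e ->
  hassum (fun k : int => gauss (rho * k%:~R + rho * u)) t ->
  exists N : nat, forall J, (N <= J)%N ->
    cabs (t - tsum dual_term / rho * riemann J.*2.+1 1 0) <= e.
Proof.
move=> e0 ht; have [A A0 hA] := mesh_coef_bound.
have [S S0 hS] := riemann_bounded.
pose D (J : nat) (j : int) : C := (if (`|j| <= J)%N then mesh_coef J.*2.+1 j else 0) -
  dual_term j * (rho^-1 * riemann J.*2.+1 1 0).
have hD J : hassum (D J) (t - tsum dual_term / rho * riemann J.*2.+1 1 0).
  apply: hassumB; last by rewrite -mulrA; apply: hassumZr; exact: dual_term_hassum.
  rewrite -(mesh_coef_sum J ht).
  apply: (@hassum_reindex _ 'I_J.*2.+1 _ (fun i => (i : nat)%:Z - J%:Z)).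
  - by move=> i i' /addIr [] /ord_inj.
  - move=> j; case: ifPn => [jJ _|]; last by rewrite eqxx.
    have h : (absz (j + J%:Z)%R < J.*2.+1)%N by rewrite -muln2; lia.
    exists (Ordinal h) => /=; rewrite gez0_abs ?addrK//; lia.
  apply: eq_hassum (hassum_fin _) => i /=.
  have hi : (nat_of_ord i < (J + J).+1)%N by rewrite addnn.
  by case: ifPn => //; lia.
apply: (@hassum_dominated _ _ D _ (fun j => A * (1 + `|j|%N%:R ^+ 2)^-1 + cabs (rho^-1) * S * cabs (dual_term j))) => //.
- apply: bsumsD; first by apply: bsumsZ => //; exact: bsums_int_sqr.
  by apply: bsumsZ; [rewrite mulr_ge0 ?cabs_ge0 | exact: dual_term_hassum.1].
- move=> J j; rewrite (le_trans (cabsB _ _))// lerD//.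
    case: ifPn => jJ; first exact: hA.
    by rewrite cabs0 divr_ge0// addr_ge0 ?sqr_ge0.
  rewrite cabsM mulrC; apply: ler_wpM2r; first exact: cabs_ge0.
  by rewrite cabsM; apply: ler_wpM2l; [exact: cabs_ge0 | exact: hS].
move=> j {}e {}e0.
(* Pointwise convergence for a fixed [j]: the displaced line is compared with the real axis, and
   [c1] and [M1] are chosen to make both parameters admissible. *)
set b := rho * u + 'i%C * j%:~R / rho.
pose c1 := Num.min c 1; have c10 : 0 < c1 by rewrite lt_min c0 ltr01.
pose M1 := 1 + M b; have M10 : 0 <= M1.
  by rewrite addr_ge0// mulr_ge0// addr_ge0 ?cabs_ge0.
have [B B0 hB] := riemann_close c10 M10.
have ad1 : admissible c1 M1 1 0.
  split; rewrite /= ?normr0 ?subr0 ?ge_min ?lexx ?orbT ?cabs1 ?cabs0//.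
  by rewrite lerDl mulr_ge0// addr_ge0 ?cabs_ge0.
have ad2 : admissible c1 M1 rho b.
  by case: (admM b) => h1 h2 h3; split; rewrite ?ge_min ?lexx ?h1// /M1; lra.
set K := cabs (dual_term j / rho).
have [N hN] : exists N : nat, K * B < N%:R * e.
  exists (Num.truncn (K * B / e)).+1; rewrite -ltr_pdivrMr//.
  by have := @truncnS_gt; apply.
exists (maxn `|j| N) => J; rewrite geq_max => /andP[jJ NJ].
have -> : D J j = dual_term j / rho * (riemann J.*2.+1 rho b - riemann J.*2.+1 1 0).
  by rewrite /D jJ mesh_coefE// -/b; ring.
rewrite cabsM -/K.
have l1 : 0 < (J.*2.+1)%:R :> R by rewrite ltr0n.
have hc := hB J.*2.+1 _ _ _ _ isT ad1 ad2.
apply: (@le_trans _ _ (K * (B / (J.*2.+1)%:R))); first by rewrite ler_wpM2l ?cabs_ge0.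
rewrite mulrA ler_pdivrMr// ltW// (lt_le_trans hN)// mulrC ler_wpM2l 1?ltW//.
by rewrite ltr_nat -muln2; lia.
Qed.

End Fourier.

(** This is the value 1 of the Gaussian integral. At [rho = 1], [u = 0] the two sides of the
    inversion formula are the same sum, which is at least 1 because of its term at 0, so the
    normalisation must tend to 1. *)
Lemma riemann_limit (e : R) : 0 < e -> exists N : nat, forall J, (N <= J)%N ->
  cabs (1 - riemann J.*2.+1 1 0) <= e.
Proof.
move=> e0; have r1 : `|complex.Im (1 : C)| < complex.Re (1 : C) by rewrite /= normr0.
pose g (k : int) : R := expR (- pi * k%:~R ^+ 2).
have eg (k : int) : dual_term 1 0 k = (g k)%:K.
  rewrite /dual_term /g expr1n divr1 !mulr0 addr0 -cexp_real; congr cexp.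
  by rewrite rmorphM rmorphN rmorphXn /= rmorph_int.
have hd := dual_term_hassum 0 r1; set t := tsum _ in hd.
have ht : hassum (fun k : int => gauss (1 * k%:~R + 1 * 0)) t.
  apply: eq_hassum hd => k; rewrite /dual_term /gauss; congr cexp.
  by rewrite expr1n; field.
have t1 : 1 <= cabs t.
  have g0 k : 0 <= g k by exact: expR_ge0.
  have bg : bsums g.
    by apply: bsums_le hd.1 => k; rewrite eg cabs_real ler_norm.
  have [s hs] := hassum_real_ge0 g0 bg.
  have -> : t = s%:K by apply: hassum_unique hs; apply: eq_hassum hd.
  rewrite cabs_real (le_trans _ (ler_norm _))//.
  have := hassum_ge0_le [fset (0 : int)]%fset g0 hs; rewrite big_seq_fset1.
  by rewrite /g expr0n /= mulr0 expR0.
have t0 : 0 < cabs t by apply: lt_le_trans t1.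
have [N hN] := fourier_limit r1 e0 ht; exists N => J NJ.
have := hN J NJ; rewrite -/t divr1 -{1}(mulr1 t) -mulrBr cabsM.
by apply: le_trans; rewrite ler_peMl ?cabs_ge0.
Qed.

Theorem gauss_inversion (rho u : C) : `|complex.Im rho| < complex.Re rho ->
  exists t, hassum (fun k : int => gauss (rho * (k%:~R + u))) t /\
    hassum (fun j : int => cexp (- (pi : R)%:K * j%:~R ^+ 2 / rho ^+ 2 + tpi * (j%:~R * u))) (rho * t).
Proof.
move=> hr; have r0 := sector_neq0 hr.
have c0 : 0 < complex.Re rho - `|complex.Im rho| by rewrite subr_gt0.
have ad : admissible (complex.Re rho - `|complex.Im rho|) (cabs rho + cabs (rho * u)) rho (rho * u).
  by split; rewrite ?lerDl ?lerDr ?cabs_ge0.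
have ht := @gauss_mesh_hassum 1 isT _ _ _ _ c0 ad; set t := tsum _ in ht.
have {}ht : hassum (fun k : int => gauss (rho * k%:~R + rho * u)) t.
  by apply: eq_hassum ht => k; rewrite divr1 rmorph_int.
exists t; split; first by apply: eq_hassum ht => k; rewrite mulrDr.
have hd := dual_term_hassum u hr; set s := tsum _ in hd.
suff -> : rho * t = s by exact: hd.
suff : t - s / rho = 0 by move/eqP; rewrite subr_eq0 => /eqP ->; rewrite mulrC divfK.
apply/eqP; rewrite -cabs_eq0 eq_le cabs_ge0 andbT; apply/ler_addgt0Pr => e e0; rewrite add0r.
have e2 : 0 < e / 2 by rewrite divr_gt0.
have e3 : 0 < e / 2 / (cabs (s / rho) + 1) by rewrite divr_gt0// ltr_wpDl ?cabs_ge0.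
have [N hN] := fourier_limit hr e2 ht; have [N' hN'] := riemann_limit e3.
have := hN (maxn N N') (leq_maxl _ _); have := hN' (maxn N N') (leq_maxr _ _).
set S := riemann _ 1 0; rewrite -/s => h1 h2.
have -> : t - s / rho = (t - s / rho * S) - s / rho * (1 - S) by ring.
rewrite (le_trans (cabsB _ _))// (splitr e) lerD// cabsM.
apply: (@le_trans _ _ ((cabs (s / rho) + 1) * (e / 2 / (cabs (s / rho) + 1)))).
  by rewrite ler_pM ?cabs_ge0 ?lerDl.
by rewrite mulrC divfK// gt_eqF// ltr_wpDl ?cabs_ge0.
Qed.

End Inversion.

(** * Coefficients of generating functions *)

Section PowerSeries.
Context {R : realType}.
Local Notation C := (R[i]).
Local Notation "x %:K" := (x%:C%C : C) (at level 2, format "x %:K").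

Lemma hassum_series_ReIm (u v : nat -> R) (a b : R) (s : C) :
  hassum (fun k => (u k)%:K + 'i%C * (v k)%:K) s ->
  series u @ \oo --> a -> series v @ \oo --> b -> s = a%:K + 'i%C * b%:K.
Proof.
move=> hs hu hv; apply/eqP; rewrite -subr_eq0 -cabs_eq0 eq_le cabs_ge0 andbT.
apply/ler_addgt0Pr => e e0; rewrite add0r.
have e3 : 0 < e / 3 by rewrite divr_gt0.
have [N hN] := hassum_nat_cvg hs e3.
move/cvgrPdist_le : hu => /(_ _ e3) [N1 _ h1].
move/cvgrPdist_le : hv => /(_ _ e3) [N2 _ h2].
pose l := maxn N (maxn N1 N2).
have {hN} := hN l (leq_maxl _ _); have {h1} := h1 l (leq_trans (leq_maxl _ _) (leq_maxr _ _)).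
have {h2} := h2 l (leq_trans (leq_maxr _ _) (leq_maxr _ _)).
rewrite !seriesEord big_split /= -mulr_sumr -!rmorph_sum /=.
set U := \sum_(k < l) u k; set V := \sum_(k < l) v k => h2 h1 h.
rewrite (le_trans (cabs_triangle (U%:K + 'i%C * V%:K) _ _))//.
have -> : e = e / 3 + (e / 3 + e / 3) by field.
apply: lerD; first by rewrite cabsBC.
rewrite opprD addrACA -mulrBr -!rmorphB (le_trans (cabsD _ _))// cabsM cabs_i mul1r !cabs_real.
by rewrite lerD// distrC.
Qed.

Lemma hassum_antidiag (f : nat * nat -> C) (s : C) : hassum f s ->
  hassum (fun k => \sum_(i < k.+1) f (nat_of_ord i, (k - i)%N)) s.
Proof.
move=> h; apply: (hassum_fiber (p := fun p : nat * nat => (p.1 + p.2)%N) h) => k.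
apply: (@hassum_reindex _ 'I_k.+1 _ (fun i => (nat_of_ord i, (k - i)%N))).
- by move=> i j [/ord_inj].
- case=> i j /=; case: ((i + j)%N =P k) => [e _|_]; last by rewrite eqxx.
  have ik : (i < k.+1)%N by rewrite -e ltnS leq_addr.
  by exists (Ordinal ik) => /=; rewrite -e addKn.
apply: eq_hassum (hassum_fin _) => i /=.
by rewrite subnKC ?eqxx// -ltnS.
Qed.

Lemma expR_partial (x : R) (l : nat) : 0 <= x -> \sum_(k < l) (x ^+ k / k`!%:R) <= expR x.
Proof.
move=> x0; rewrite -(big_mkord xpredT (fun k => x ^+ k / k`!%:R)).
have -> : \sum_(0 <= k < l) x ^+ k / k`!%:R = series (exp_coeff x) l by rewrite seriesEnat.
apply: nondecreasing_cvgn_le; last exact: is_cvg_series_exp_coeff.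
by apply: nondecreasing_series => k _ _; exact: exp_coeff_ge0.
Qed.

Lemma exp_bsums (z : C) : bsums (fun k : nat => cabs (z ^+ k / k`!%:R)).
Proof.
apply: (@bsums_nat R _ (expR (cabs z))) => [k|l]; first exact: cabs_ge0.
under eq_bigr do rewrite cabsM cabsX cabsV -(rmorph_nat (real_complex R)) cabs_real normr_nat.
by apply: expR_partial; exact: cabs_ge0.
Qed.

Let E (z : C) : C := tsum (fun k : nat => z ^+ k / k`!%:R).

Let E_hassum z : hassum (fun k : nat => z ^+ k / k`!%:R) (E z).
Proof. exact/summable_hassum/exp_bsums. Qed.

Let E_add z w : E (z + w) = E z * E w.
Proof.
have h := hassum_antidiag (hassum_mul (E_hassum z) (E_hassum w)).
apply: hassum_unique (E_hassum _) _; apply: eq_hassum h => k /=.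
rewrite addrC exprDn mulr_suml; apply: eq_bigr => i _.
have ik : (i <= k)%N by rewrite -ltnS.
have f0 j : (j`!%:R : C) != 0 by rewrite pnatr_eq0 -lt0n fact_gt0.
rewrite -mulr_natr -(bin_fact ik) !natrM; field.
by rewrite !f0 pnatr_eq0 -lt0n bin_gt0.
Qed.

Let E_real (x : R) : E x%:K = (expR x)%:K.
Proof.
have h : hassum (fun k => (exp_coeff x k)%:K + 'i%C * (0 : R)%:K) (E x%:K).
  apply: eq_hassum (E_hassum _) => k; rewrite mulr0 addr0 /exp_coeff /=.
  by rewrite rmorphM rmorphXn /= fmorphV rmorph_nat.
have h0 : series (fun _ : nat => 0 : R) @ \oo --> (0 : R).
  rewrite (_ : series _ = fun=> 0); first exact: cvg_cst.
  by apply/funext => l; rewrite seriesEnat; apply: big1.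
have h1 : series (exp_coeff x) @ \oo --> expR x by exact: is_cvg_series_exp_coeff.
by rewrite (hassum_series_ReIm h h1 h0) mulr0 addr0.
Qed.

Let E_imag (y : R) : E ('i%C * y%:K) = (cos y)%:K + 'i%C * (sin y)%:K.
Proof.
have h : hassum (fun k => (cos_coeff y k)%:K + 'i%C * (sin_coeff y k)%:K) (E ('i%C * y%:K)).
  apply: eq_hassum (E_hassum _) => k; rewrite /cos_coeff /sin_coeff /=.
  rewrite exprMn !rmorphM /= !rmorphXn /= rmorphN1 !fmorphV !rmorph_nat.
  have i2 : ('i%C : C) ^+ 2 = -1 by rewrite expr2 sqrc_i.
  have ik : ('i%C : C) ^+ k = (~~ odd k)%:R * (-1) ^+ k./2 + 'i%C * ((odd k)%:R * (-1) ^+ k.-1./2).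
    rewrite -[in LHS](odd_double_half k) exprD -mul2n exprM i2.
    by case: (boolP (odd k)) => ok /=; rewrite ?expr1 ?expr0;
      [rewrite mul0r add0r mul1r; congr (_ * _ ^+ _); case: (k) ok => //= k' ok; rewrite uphalf_half (negbTE ok) | rewrite mul0r mulr0 addr0 mul1r].
  by rewrite ik; ring.
apply: (hassum_series_ReIm h).
  rewrite cos.unlock; exact: is_cvg_series_cos_coeff.
rewrite sin.unlock; exact: is_cvg_series_sin_coeff.
Qed.

(** As [cexp] is defined from [expR], [cos] and [sin], its series is identified through
    multiplicativity ([E_add]) and through its values on the real and imaginary axes. *)
Lemma cexp_hassum (z : C) : hassum (fun k : nat => z ^+ k / k`!%:R) (cexp z).
Proof.
suff <- : E z = cexp z by exact: E_hassum.
rewrite {1}(ReImE z) E_add E_real E_imag /cexp; apply: complex_ext; rewrite !ReIm /=; ring.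
Qed.

(** Vanishing is known only for real [s] in []0, 1]], so coefficients are removed one at a time: the
    terms beyond [k] are at most [s^(k+1) M], and division by [s^k] gives [|p k| <= s M] for every
    such [s]. *)
Lemma power_series_unique (p : nat -> C) :
  (exists M : R, forall l, \sum_(i < l) cabs (p i) <= M) ->
  (forall s : R, 0 < s <= 1 -> hassum (fun k => p k * s%:K ^+ k) 0) -> forall k, p k = 0.
Proof.
move=> [M hM] h k; elim/ltn_ind: k => k IH.
have M0 : 0 <= M by have := hM 0%N; rewrite big_ord0.
apply/eqP; rewrite -cabs_eq0 eq_le cabs_ge0 andbT.
suff hs (s : R) : 0 < s <= 1 -> cabs (p k) <= s * M.
  apply/ler_addgt0Pr => e e0; rewrite add0r.
  pose s := Num.min 1 (e / (M + 1)).
  have M1 : 0 < M + 1 by rewrite ltr_wpDl.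
  have s0 : 0 < s by rewrite lt_min ltr01 divr_gt0.
  apply: (le_trans (hs s _)); first by rewrite s0 ge_min lexx.
  apply: (@le_trans _ _ (e / (M + 1) * (M + 1))); last by rewrite divfK// gt_eqF.
  by rewrite ler_pM ?ge_min ?lexx ?orbT ?lerDl// ltW.
move=> /andP[s0 s1].
have hk : hassum (fun i : nat => if i == k then p k * s%:K ^+ k else 0) (p k * s%:K ^+ k).
  apply: (@hassum_reindex _ unit _ (fun=> k)); first by case; case.
    by move=> i; case: (i =P k) => [->|_]; [exists tt | rewrite eqxx].
  have := hassum_fin (fun _ : unit => p k * s%:K ^+ k).
  rewrite big_const /= card_unit /= addr0; apply: eq_hassum => x /=.
  by rewrite eqxx.
have hd := hassumB (h s _) hk; rewrite s0 s1 sub0r in hd.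
have {hd}hb : cabs (p k * s%:K ^+ k) <= s ^+ k.+1 * M.
  rewrite -cabsN; apply: (hassum_cabs_le (hd isT)) => A.
  have [B hB] : exists M' : R, bsums (fun i => cabs (p i)) /\ M' = M.
    by exists M; split=> //; apply: (bsums_nat (fun=> cabs_ge0 _) hM).
  have hA : \sum_(i <- A) cabs (p i) <= M.
    apply: (@le_trans _ _ (\sum_(i < (\max_(x <- A) x).+1) cabs (p i))); last exact: hM.
    rewrite -(big_mkord xpredT (fun i => cabs (p i))) /index_iota subn0.
    have -> : \sum_(i <- iota 0 (\max_(x <- A) x).+1) cabs (p i) =
      \sum_(i <- [fset i | i in iota 0 (\max_(x <- A) x).+1]%fset) cabs (p i).
      apply/perm_big/uniq_perm; rewrite ?iota_uniq ?fset_uniq// => i.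
      by rewrite !inE.
    apply: sum_fset_le => [i|]; first exact: cabs_ge0.
    apply/fsubsetP => x xA; apply/imfsetP; exists x => //.
    suff hx : x \in iota 0 (\max_(x <- A) x).+1 by exact: hx.
    by rewrite mem_iota /= add0n ltnS; exact: (@leq_bigmax_seq _ (enum_fset A) xpredT id x xA).
  apply: (@le_trans _ _ (\sum_(i <- A) s ^+ k.+1 * cabs (p i))); last first.
    by rewrite -mulr_sumr ler_wpM2l// exprn_ge0// ltW.
  apply: ler_sum => i _; case: (i =P k) => [->|/eqP ik].
    by rewrite subrr cabs0 mulr_ge0 ?exprn_ge0 ?cabs_ge0// ltW.
  rewrite subr0 cabsM cabsX cabs_real (gtr0_norm s0) mulrC.
  have [ik'|ki] := ltnP i k.
    by rewrite IH// cabs0 !mulr0.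
  rewrite ler_wpM2r ?cabs_ge0// ler_wiXn2l// ?ltW//.
  by rewrite ltn_neqAle eq_sym ik.
move: hb; rewrite cabsM cabsX cabs_real (gtr0_norm s0) exprSr mulrC -mulrA.
by rewrite ler_pM2l// exprn_gt0.
Qed.

(** * Taylor coefficients of exponential sums *)

Section Moments.
Variables (T : choiceType) (a al : T -> C).
Hypothesis ha : bsums (fun x => cabs (a x) * expR (cabs (al x))).

(** The coefficient of [s^k] in the sum of [a x * cexp (s * al x)] over [x]. *)
Definition moment (k : nat) : C := tsum (fun x => a x * (al x ^+ k / k`!%:R)).

Lemma moment_pair_bsums : bsums (fun p : T * nat => cabs (a p.1 * (al p.1 ^+ p.2 / p.2`!%:R))).
Proof.
apply: (bsums_pair _ ha) => [p|x A]; first exact: cabs_ge0.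
under eq_bigr do rewrite cabsM.
rewrite /= -mulr_sumr ler_wpM2l ?cabs_ge0//.
have [s hs] := hassum_real_ge0 (fun k => cabs_ge0 (al x ^+ k / k`!%:R)) (exp_bsums (al x)).
rewrite (le_trans (hassum_ge0_le A (fun k => cabs_ge0 _) hs))//.
have h := cexp_hassum (cabs (al x))%:K; rewrite cexp_real in h.
have : s%:K = (expR (cabs (al x)))%:K.
  apply: hassum_unique hs _; apply: eq_hassum h => k.
  by rewrite cabsM cabsX cabsV -(rmorph_nat (real_complex R)) cabs_real normr_nat rmorphM /= rmorphXn fmorphV.
by move=> /complexI ->.
Qed.

Lemma moment_hassum k : hassum (fun x => a x * (al x ^+ k / k`!%:R)) (moment k).
Proof.
apply: summable_hassum; have [M hM] := moment_pair_bsums.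
exists M => A; have := hM [fset (x, k) | x in A]%fset.
by rewrite big_imfset //= => x y _ _ [].
Qed.

Lemma moment_sum_le : exists M : R, forall l, \sum_(k < l) cabs (moment k) <= M.
Proof.
have [M hM] := (hassum_pair (hassum_swap (summable_hassum moment_pair_bsums)) moment_hassum).1.
exists M => l; have := hM [fset i | i in iota 0 l]%fset.
rewrite -(big_mkord xpredT (fun i => cabs (moment i))) /index_iota subn0.
rewrite (_ : \sum_(i <- [fset i | i in iota 0 l]%fset) cabs (moment i) = \sum_(i <- iota 0 l) cabs (moment i))//.
by apply/perm_big/uniq_perm; rewrite ?iota_uniq ?fset_uniq// => i; rewrite !inE.
Qed.

Lemma moment_series (s : R) : 0 <= s <= 1 ->
  hassum (fun k => moment k * s%:K ^+ k) (tsum (fun x => a x * cexp (s%:K * al x))) /\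
  hassum (fun x => a x * cexp (s%:K * al x)) (tsum (fun x => a x * cexp (s%:K * al x))).
Proof.
move=> /andP[s0 s1].
pose F (p : T * nat) := a p.1 * (al p.1 ^+ p.2 / p.2`!%:R) * s%:K ^+ p.2.
have hF : hassum F (tsum F).
  apply: summable_hassum; apply: bsums_le moment_pair_bsums => p.
  rewrite [cabs (F p)]cabsM ler_piMr ?cabs_ge0// cabsX cabs_real ger0_norm//.
  exact: exprn_ile1.
have h1 : hassum (fun x => a x * cexp (s%:K * al x)) (tsum F).
  apply: (hassum_pair hF) => x; apply: eq_hassum (hassumZ (a x) (cexp_hassum _)) => k.
  by rewrite /F exprMn /=; ring.
have h2 := hassum_pair (hassum_swap hF) (fun k => hassumZr (s%:K ^+ k) (moment_hassum k)).
by rewrite (tsumE h1).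
Qed.

End Moments.

(** The coefficient of [s^k] in [exp (B s^2)]. *)
Definition gauss_coef (B : C) (k : nat) : C := if odd k then 0 else B ^+ k./2 / k./2`!%:R.

Lemma gauss_coef_hassum (B : C) (s : R) :
  hassum (fun k => gauss_coef B k * s%:K ^+ k) (cexp (B * s%:K ^+ 2)).
Proof.
apply: (@hassum_reindex _ _ _ double); first exact: double_inj.
  move=> k; rewrite /gauss_coef; case: ifPn => [|ok _]; first by rewrite mul0r eqxx.
  by exists k./2; rewrite even_halfK.
apply: eq_hassum (cexp_hassum _) => k /=; rewrite /gauss_coef odd_double doubleK exprMn -exprM mul2n.
ring.
Qed.

(** Comparison of Taylor coefficients, the right-hand side being a Cauchy product. It is the device
    by which a Poisson formula with exponential weights yields one with polynomial weights. *)
Lemma moment_identity (T1 T2 : choiceType) (a al : T1 -> C) (b be : T2 -> C) (B : C) :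
  bsums (fun x => cabs (a x) * expR (cabs (al x))) ->
  bsums (fun x => cabs (b x) * expR (cabs (be x))) ->
  (forall s : R, 0 < s <= 1 -> tsum (fun x => a x * cexp (s%:K * al x)) =
     cexp (B * s%:K ^+ 2) * tsum (fun x => b x * cexp (s%:K * be x))) ->
  forall e, moment a al e = \sum_(k < e.+1) gauss_coef B k * moment b be (e - k).
Proof.
move=> ha hb h e; apply/eqP; rewrite -subr_eq0; apply/eqP; move: e.
pose q e := \sum_(k < e.+1) gauss_coef B k * moment b be (e - k).
have hq (s : R) : 0 < s <= 1 -> hassum (fun e => q e * s%:K ^+ e)
    (cexp (B * s%:K ^+ 2) * tsum (fun x => b x * cexp (s%:K * be x))).
  move=> /andP[s0 s1]; have [|h2 _] := moment_series hb (s := s); first by rewrite ltW.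
  apply: eq_hassum (hassum_antidiag (hassum_mul (gauss_coef_hassum B s) h2)) => e /=.
  rewrite /q mulr_suml; apply: eq_bigr => i _.
  have -> : s%:K ^+ e = s%:K ^+ i * s%:K ^+ (e - i) by rewrite -exprD subnKC// -ltnS.
  by ring.
apply: power_series_unique.
  have [M hM] := moment_sum_le ha.
  have [M' hM'] : exists M' : R, forall l, \sum_(k < l) cabs (q k) <= M'.
    have [|[M' h'] _] := hq 1; first by rewrite ltr01 lexx.
    exists M' => l; have := h' [fset i | i in iota 0 l]%fset.
    rewrite -(big_mkord xpredT (fun i => cabs (q i))) /index_iota subn0.
    rewrite (_ : \sum_(i <- [fset i | i in iota 0 l]%fset) _ = \sum_(i <- iota 0 l) cabs (q i))//.
    under eq_bigr do rewrite rmorph1 expr1n mulr1.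
    by apply/perm_big/uniq_perm; rewrite ?iota_uniq ?fset_uniq// => i; rewrite !inE.
  exists (M + M') => l; apply: le_trans (lerD (hM l) (hM' l)).
  by rewrite -big_split; apply: ler_sum => i _; exact: cabsB.
move=> s hs; have /andP[s0 s1] := hs.
have [|h1 _] := moment_series ha (s := s); first by rewrite ltW.
have := hassumB h1 (hq s hs); rewrite h// subrr; apply: eq_hassum => k.
by rewrite mulrBl.
Qed.

End PowerSeries.

(** * Harmonic polynomials and the zonal kernel *)

Section LinearForms.
Context {R : realType} {n : nat}.
Implicit Types (v w xi : 'rV[R]_n) (f g h : mpoly n R) (s : seq (R * 'rV[R]_n)).

Definition linform xi : mpoly n R := \sum_i xi 0 i *: mpolyX R (mnm1 i).

Definition ev v f : R := meval (fun i => v 0 i) f.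

Lemma dotC v w : dot v w = dot w v.
Proof. by apply: eq_bigr => i _; rewrite mulrC. Qed.

Lemma dotDl v v' w : dot (v + v') w = dot v w + dot v' w.
Proof. by rewrite /dot -big_split; apply: eq_bigr => i _; rewrite mxE mulrDl. Qed.

Lemma dotZl (a : R) v w : dot (a *: v) w = a * dot v w.
Proof. by rewrite /dot mulr_sumr; apply: eq_bigr => i _; rewrite mxE mulrA. Qed.

Lemma dotDr v w w' : dot v (w + w') = dot v w + dot v w'.
Proof. by rewrite dotC dotDl !(dotC v). Qed.

Lemma dotZr (a : R) v w : dot v (a *: w) = a * dot v w.
Proof. by rewrite dotC dotZl dotC. Qed.

Lemma dot_mx v w : dot v w = (v *m w^T) 0 0.
Proof. by rewrite mxE; apply: eq_bigr => i _; rewrite mxE. Qed.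

Lemma dot_ge0 v : 0 <= dot v v.
Proof. by apply: sumr_ge0 => i _; rewrite -expr2 sqr_ge0. Qed.

Lemma dot_eq0 v : (dot v v == 0) = (v == 0).
Proof.
apply/eqP/eqP => [/eqP|->]; last by apply: big1 => i _; rewrite mxE mul0r.
rewrite psumr_eq0 => [/allP h|i _]; last by rewrite -expr2 sqr_ge0.
apply/rowP => i; rewrite mxE; apply/eqP.
by have := h i (mem_index_enum _); rewrite /= -expr2 sqrf_eq0.
Qed.

Lemma enorm_sqr v : enorm v ^+ 2 = dot v v.
Proof. by rewrite /enorm sqr_sqrtr// dot_ge0. Qed.

Lemma ev_linform v xi : ev v (linform xi) = dot xi v.
Proof.
rewrite /ev /linform raddf_sum; apply: eq_bigr => i _ /=.
by rewrite mevalZ mevalXU.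
Qed.

Lemma linformD v w : linform (v + w) = linform v + linform w.
Proof. by rewrite /linform -big_split; apply: eq_bigr => i _; rewrite mxE scalerDl. Qed.

Lemma linformZ (a : R) v : linform (a *: v) = a *: linform v.
Proof. by rewrite /linform scaler_sumr; apply: eq_bigr => i _; rewrite mxE scalerA. Qed.

Lemma mderiv_linform i xi : mderiv i (linform xi) = mpolyC n (xi 0 i).
Proof.
rewrite /linform raddf_sum (bigD1 i)//= big1 => [|j ji].
  rewrite addr0 mderivZ mderivX mnm1E eqxx scale1r.
  have -> : mnm_sub (mnm1 i) (mnm1 i) = mnm0 by apply/mnmP => k; rewrite mnmBE subnn mnm0E.
  by rewrite mpolyX0 -mul_mpolyC mulr1.
by rewrite mderivZ mderivX mnm1E (negbTE ji) scale0r scaler0.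
Qed.

Lemma mderivXn i f k : mderiv i (f ^+ k.+1) = k.+1%:R *: (f ^+ k * mderiv i f).
Proof.
elim: k => [|k IH]; first by rewrite expr1 expr0 mul1r scale1r.
rewrite exprS mderivM IH -scalerAr mulrA -exprS [mderiv i f * _]mulrC.
by rewrite -[X in X + _]scale1r -scalerDl nat1r.
Qed.

Lemma linform_homog xi : linform xi \is ishomog1 1 mdeg.
Proof.
rewrite /linform; apply: rpred_sum => i _; apply: rpredZ.
by rewrite dhomogX; apply/eqP; exact: mdeg1.
Qed.

Lemma linformX_homog xi e : linform xi ^+ e \is ishomog1 e mdeg.
Proof. by have := dhomogMn e (linform_homog xi); rewrite mul1n. Qed.

(** Weights at the nodes [0, ..., e+1] that extract the coefficient of [t] from a polynomial of
    degree at most [e+1]; they solve a Vandermonde system. *)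
Lemma interpolation_coef (e : nat) : exists c : 'I_e.+2 -> R,
  forall k, (k < e.+2)%N -> \sum_t c t * (nat_of_ord t)%:R ^+ k = (k == 1%N)%:R.
Proof.
pose a : 'rV[R]_e.+2 := \row_j (nat_of_ord j)%:R.
pose V := Vandermonde e.+2 a.
have uV : V \in unitmx.
  rewrite unitmxE unitfE det_Vandermonde; apply/prodf_neq0 => i _; apply/prodf_neq0 => j ij.
  by rewrite !mxE subr_eq0 eqr_nat neq_ltn ij orbT.
pose c : 'cV[R]_e.+2 := invmx V *m delta_mx (inord 1) 0.
have hc : V *m c = delta_mx (inord 1) 0 by rewrite mulmxA mulmxV// mul1mx.
exists (fun t => c t 0) => k ke.
move/matrixP : hc => /(_ (Ordinal ke) 0); rewrite !mxE => h.
transitivity (\sum_j V (Ordinal ke) j * c j 0).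
  by apply: eq_bigr => t _; rewrite !mxE mulrC.
rewrite h eqxx andbT; congr (nat_of_bool _)%:R.
by rewrite -val_eqE /= inordK.
Qed.

Definition powsum (e : nat) s : mpoly n R := \sum_(p <- s) p.1 *: linform p.2 ^+ e.

Lemma powsumZ (a : R) e s : a *: powsum e s = powsum e [seq (a * p.1, p.2) | p <- s].
Proof. by rewrite /powsum big_map scaler_sumr; apply: eq_bigr => p _; rewrite scalerA. Qed.

Lemma powsum_cat e s s' : powsum e (s ++ s') = powsum e s + powsum e s'.
Proof. by rewrite /powsum big_cat. Qed.

(** Polarisation: [linform v ^+ e * linform xi] is, up to the factor [e+1], the coefficient of [t]
    in [linform (v + t xi) ^+ e.+1], and [interpolation_coef] expresses this coefficient by finitely
    many values of [t]. *)
Lemma powsum_mul_linform e s xi : exists s', powsum e s * linform xi = powsum e.+1 s'.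
Proof.
elim: s => [|[a v] s [s' IH]].
  by exists [::]; rewrite /powsum !big_nil mul0r.
suff [s'' h] : exists s'', a *: linform v ^+ e * linform xi = powsum e.+1 s''.
  exists (s'' ++ s'); rewrite powsum_cat -h -IH /powsum big_cons mulrDl//.
have [c hc] := interpolation_coef e.
exists [seq (a / e.+1%:R * c t, v + (nat_of_ord t)%:R *: xi) | t <- index_enum 'I_e.+2].
rewrite /powsum big_map /=.
transitivity ((a / e.+1%:R) *: \sum_(t < e.+2) c t *: (linform v + (nat_of_ord t)%:R *: linform xi) ^+ e.+1); last first.
  rewrite scaler_sumr; apply: eq_bigr => t _.
  by rewrite scalerA linformD linformZ.
have -> : \sum_(t < e.+2) c t *: (linform v + (nat_of_ord t)%:R *: linform xi) ^+ e.+1 =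
    \sum_(k < e.+2) (\sum_(t < e.+2) c t * (nat_of_ord t)%:R ^+ k) *: (linform v ^+ (e.+1 - k) * linform xi ^+ k *+ 'C(e.+1, k)).
  under eq_bigr do rewrite exprDn scaler_sumr.
  rewrite exchange_big /=; apply: eq_bigr => k _; rewrite scaler_suml; apply: eq_bigr => t _.
  by rewrite exprZn -scalerAr scalerMnr scalerA.
rewrite (bigD1 (inord 1))//= [X in _ + X]big1 ?addr0 => [|k k1].
  rewrite inordK// hc// eqxx scale1r subSS subn0 expr1 bin1 -[(_ * _) *+ _]scaler_nat scalerA divfK ?pnatr_eq0//.
  by rewrite -scalerAl.
rewrite hc// (_ : (nat_of_ord k == 1%N) = false) ?scale0r//.
by apply: contra_neqF k1 => /eqP k1; apply/val_inj; rewrite /= inordK// k1.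
Qed.

Lemma monomial_powsum e (m : multinom n) : mdeg m = e -> exists s, mpolyX R m = powsum e s.
Proof.
elim: e m => [|e IH] m hm.
  exists [:: (1, 0)]; rewrite /powsum big_seq1 expr0 scale1r.
  by move/eqP : hm; rewrite mdeg_eq0 => /eqP ->; rewrite mpolyX0.
have [i hi] : exists i, (0 < m i)%N.
  apply/existsP; rewrite -[X in is_true X]negbK negb_exists; apply/negP => /forallP h.
  move: hm; rewrite mdegE big1// => i _; apply/eqP.
  by move: (h i); rewrite -eqn0Ngt.
have hle : mpoly.lem (mnm1 i) m by rewrite lep1mP -lt0n.
have hm' : mdeg (mnm_sub m (mnm1 i)) = e.
  by have := mdegD (mnm_sub m (mnm1 i)) (mnm1 i); rewrite submK// hm mdeg1 addn1 => -[].
have [s hs] := IH _ hm'.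
have [s' hs'] := powsum_mul_linform e s (delta_mx 0 i).
exists s'; rewrite -hs' -hs.
have -> : linform (delta_mx 0 i) = mpolyX R (mnm1 i).
  rewrite /linform (bigD1 i)//= big1 => [|j ji]; first by rewrite mxE !eqxx scale1r addr0.
  by rewrite mxE eqxx (negbTE ji) scale0r.
by rewrite -mpolyXD submK.
Qed.

Lemma homog_powsum e f : f \is ishomog1 e mdeg -> exists s, f = powsum e s.
Proof.
move=> /dhomogP hf; rewrite (mpolyE f).
have : forall m, m \in msupp f -> mdeg m = e by exact: hf.
elim: (msupp f : seq _) => [|m r IH] hr.
  by exists [::]; rewrite /powsum !big_nil.
have [s hs] : exists s, \sum_(m <- r) mcoeff m f *: mpolyX R m = powsum e s.
  by apply: IH => m' m'r; apply: hr; rewrite inE m'r orbT.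
have [s' hs'] := monomial_powsum (hr m (mem_head _ _)).
exists ([seq (mcoeff m f * p.1, p.2) | p <- s'] ++ s).
by rewrite big_cons powsum_cat -powsumZ -hs -hs'.
Qed.

Lemma ev_powsum v e s : ev v (powsum e s) = \sum_(p <- s) p.1 * dot p.2 v ^+ e.
Proof.
rewrite /ev /powsum raddf_sum; apply: eq_bigr => p _ /=.
by rewrite mevalZ rmorphXn /= -/(ev v _) ev_linform.
Qed.

Lemma laplacianD f g : laplacian (f + g) = laplacian f + laplacian g.
Proof. by rewrite /laplacian -big_split; apply: eq_bigr => i _; rewrite !mderivD. Qed.

Lemma laplacianZ (a : R) f : laplacian (a *: f) = a *: laplacian f.
Proof. by rewrite /laplacian scaler_sumr; apply: eq_bigr => i _; rewrite !mderivZ. Qed.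

Lemma laplacian0 : laplacian (0 : mpoly n R) = 0.
Proof. by rewrite -(scale0r 0) laplacianZ !scale0r. Qed.

Lemma laplacian_sum (I : Type) (r : seq I) (P : pred I) (F : I -> mpoly n R) :
  laplacian (\sum_(i <- r | P i) F i) = \sum_(i <- r | P i) laplacian (F i).
Proof. exact: (big_morph _ laplacianD laplacian0). Qed.

Lemma laplacian_linformX xi e :
  laplacian (linform xi ^+ e.+2) = (e.+2%:R * e.+1%:R * dot xi xi) *: linform xi ^+ e.
Proof.
rewrite /laplacian /dot mulr_sumr scaler_suml; apply: eq_bigr => i _.
rewrite mderivXn mderiv_linform mderivZ mulrC mul_mpolyC mderivZ mderivXn mderiv_linform.
by rewrite mulrC mul_mpolyC !scalerA; congr (_ *: _); ring.
Qed.

(** Each Laplacian multiplies the weight of [xi] by [|xi|^2], lowers the degree by 2 and brings out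
    a nonzero number. These relations eliminate the lower-order terms both in [zonal_kernel] and in
    [harmonic_poisson]. *)
Lemma harm_powsum_vanish e s k : laplacian (powsum e s) = 0 -> (0 < k)%N -> (2 * k <= e)%N ->
  powsum (e - 2 * k) [seq (p.1 * dot p.2 p.2 ^+ k, p.2) | p <- s] = 0.
Proof.
move=> h0; have step s' j : laplacian (powsum j.+2 s') = 0 ->
    powsum j [seq (p.1 * dot p.2 p.2, p.2) | p <- s'] = 0.
  move=> h; have : (j.+2%:R * j.+1%:R : R) *: powsum j [seq (p.1 * dot p.2 p.2, p.2) | p <- s'] = 0.
    rewrite -h /powsum big_map laplacian_sum scaler_sumr; apply: eq_bigr => p _ /=.
    by rewrite laplacianZ laplacian_linformX !scalerA; congr (_ *: _); ring.
  by move/eqP; rewrite scaler_eq0 mulf_eq0 !pnatr_eq0 /= => /eqP.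
elim: k => [//|k IH] _ ke; case: k IH ke => [|k] IH ke.
  case: e h0 ke {IH} => [|[|e]]// h0 _; rewrite muln1 subn2 /=.
  have -> : [seq (p.1 * dot p.2 p.2 ^+ 1, p.2) | p <- s] = [seq (p.1 * dot p.2 p.2, p.2) | p <- s] by [].
  exact: step.
have ke' : (2 * k.+1 <= e)%N by lia.
have := IH isT ke'; have -> : (e - 2 * k.+1 = (e - 2 * k.+2).+2)%N by lia.
move=> h; have := step [seq (p.1 * dot p.2 p.2 ^+ k.+1, p.2) | p <- s] (e - 2 * k.+2)%N.
rewrite h laplacian0 => /(_ erefl) <-; rewrite -map_comp; congr powsum; apply: eq_map => p /=.
by rewrite exprSr mulrA.
Qed.

(** Powers of linear forms represent point evaluation for the pairing; together with [homog_powsum]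
    this reduces every pairing to evaluations. *)
Lemma pairing_linformX e g xi : g \is ishomog1 e mdeg ->
  pairing g (linform xi ^+ e) = e`!%:R * ev xi g.
Proof.
have key : forall e (m : multinom n), mdeg m = e ->
    meval (fun=> 0) (mderivm m (linform xi ^+ e)) = e`!%:R * \prod_i xi 0 i ^+ m i.
  elim=> [|{}e IH] m hm.
    have /eqP : mdeg m == 0%N by rewrite hm.
    move/eqP; rewrite mdeg_eq0 => /eqP ->; rewrite mderivm0m expr0 meval1 fact0 mul1r.
    by rewrite big1// => i _; rewrite mnm0E expr0.
  have [i hi] : exists i, (0 < m i)%N.
    apply/existsP; rewrite -[X in is_true X]negbK negb_exists; apply/negP => /forallP h.
    move: hm; rewrite mdegE big1// => i _; apply/eqP.
    by move: (h i); rewrite -eqn0Ngt.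
  have hle : mpoly.lem (mnm1 i) m by rewrite lep1mP -lt0n.
  set m' := mnm_sub m (mnm1 i).
  have em : m = mnm_add (mnm1 i) m' by rewrite addmC submK.
  have hm' : mdeg m' = e by move: hm; rewrite em mdegD mdeg1 add1n => -[].
  rewrite [in LHS]em mderivmDm mderivmU1m mderivXn mderiv_linform mulrC mul_mpolyC.
  rewrite !mderivmZ !mevalZ IH// factS natrM.
  have -> : \prod_i0 xi 0 i0 ^+ m i0 = xi 0 i * \prod_i0 xi 0 i0 ^+ m' i0.
    rewrite (bigD1 i)//= [in RHS](bigD1 i)//= mulrA; congr (_ * _).
      by rewrite -exprS; congr (_ ^+ _); rewrite em mnmDE mnm1E eqxx.
    by apply: eq_bigr => j ji; rewrite em mnmDE mnm1E eq_sym (negbTE ji).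
  ring.
move=> /dhomogP hg; rewrite /pairing /diff_op raddf_sum /ev mevalE mulr_sumr /=.
rewrite big_seq [RHS]big_seq; apply: eq_bigr => m mg.
by rewrite mevalZ key; [ring | exact: hg].
Qed.

Lemma pairingDr g f f' : pairing g (f + f') = pairing g f + pairing g f'.
Proof.
rewrite /pairing /diff_op -mevalD -big_split /=; congr meval; apply: eq_bigr => m _.
by rewrite mderivmD scalerDr.
Qed.

Lemma pairingZr (a : R) g f : pairing g (a *: f) = a * pairing g f.
Proof.
rewrite /pairing /diff_op -mevalZ scaler_sumr; congr meval; apply: eq_bigr => m _.
by rewrite mderivmZ !scalerA mulrC.
Qed.

Lemma pairing_sumr (I : Type) (r : seq I) g (F : I -> mpoly n R) :
  pairing g (\sum_(i <- r) F i) = \sum_(i <- r) pairing g (F i).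
Proof.
apply: (big_morph (pairing g)); first exact: pairingDr.
by rewrite -(scale0r 0) pairingZr mul0r.
Qed.

Lemma powsum_homog e s : powsum e s \is ishomog1 e mdeg.
Proof. by apply: rpred_sum => p _; apply: rpredZ; exact: linformX_homog. Qed.

Lemma pairing_powsum e s f : f \is ishomog1 e mdeg ->
  pairing (powsum e s) f = e`!%:R * \sum_(p <- s) p.1 * ev p.2 f.
Proof.
move=> /homog_powsum[s' ->]; rewrite {2}/powsum pairing_sumr.
under eq_bigr do rewrite pairingZr pairing_linformX ?powsum_homog// ev_powsum.
rewrite mulr_sumr; under [RHS]eq_bigr do rewrite ev_powsum mulr_sumr mulr_sumr.
under eq_bigr do rewrite mulr_sumr mulr_sumr.
rewrite exchange_big; apply: eq_bigr => p _; apply: eq_bigr => p' _.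
by rewrite dotC; ring.
Qed.

Definition sqform : mpoly n R := \sum_i mpolyX R (mnm1 i) ^+ 2.

Lemma ev_sqform v : ev v sqform = dot v v.
Proof.
rewrite /ev /sqform raddf_sum; apply: eq_bigr => i _ /=.
by rewrite rmorphXn /= mevalXU expr2.
Qed.

Lemma sqform_homog : sqform \is ishomog1 2 mdeg.
Proof.
apply: rpred_sum => i _; rewrite mpolyXn dhomogX; apply/eqP.
by rewrite /= mdegMn mdeg1.
Qed.

Lemma mderivX1 i j : mderiv i (mpolyX R (mnm1 j)) = (i == j)%:R :> mpoly n R.
Proof.
rewrite mderivX mnm1E eq_sym; case: eqP => [->|_]; last by rewrite scale0r.
have -> : mnm_sub (mnm1 j) (mnm1 j) = mnm0 by apply/mnmP => k; rewrite mnmBE subnn mnm0E.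
by rewrite mpolyX0 scale1r.
Qed.

Lemma mderiv_sqform i : mderiv i sqform = 2 *: mpolyX R (mnm1 i).
Proof.
rewrite /sqform raddf_sum (bigD1 i)//= big1 => [|j ji].
  by rewrite addr0 mderivXn mderivX1 eqxx mulr1 expr1.
by rewrite mderivXn mderivX1 eq_sym (negbTE ji) mulr0 scaler0.
Qed.

Lemma laplacianM f g : laplacian (f * g) =
  laplacian f * g + 2 *: \sum_i mderiv i f * mderiv i g + f * laplacian g.
Proof.
rewrite /laplacian mulr_suml mulr_sumr scaler_sumr -!big_split; apply: eq_bigr => i _ /=.
rewrite mderivM mderivD !mderivM scaler_nat; ring.
Qed.

Lemma laplacian_sqformX k :
  laplacian (sqform ^+ k) = (2 * k%:R * (n%:R + 2 * k%:R - 2)) *: sqform ^+ k.-1.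
Proof.
case: k => [|k].
  by rewrite expr0 mulr0 mul0r scale0r /laplacian big1// => i _; rewrite -mpolyC1 mderivC mderiv0.
rewrite /laplacian; under eq_bigr do rewrite mderivXn mderivZ mderiv_sqform mderivM mderivZ mderivX1 eqxx.
rewrite -scaler_sumr big_split /= sumr_const card_ord.
have -> : \sum_(i < n) mderiv i (sqform ^+ k) * (2 *: mpolyX R (mnm1 i)) = (4 * k%:R) *: sqform ^+ k.
  case: k => [|k].
    by rewrite expr0 mulr0 scale0r big1// => i _; rewrite -mpolyC1 mderivC mul0r.
  under eq_bigr do rewrite mderivXn mderiv_sqform -!scalerAr -!scalerAl scalerA -mulrA -expr2 scalerA.
  rewrite -scaler_sumr -mulr_sumr -/sqform -exprSr; congr (_ *: _); ring.
rewrite -scalerAr mulr1 -[X in _ + X]scaler_nat scalerA -scalerDl scalerA; congr (_ *: _).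
by rewrite -[k.+1%:R]natr1; ring.
Qed.

Lemma laplacian_linformX' xi j :
  laplacian (linform xi ^+ j) = (j%:R * (j%:R - 1) * dot xi xi) *: linform xi ^+ (j - 2).
Proof.
case: j => [|[|j]].
- by rewrite expr0 !mul0r scale0r /laplacian big1// => i _; rewrite -mpolyC1 mderivC mderiv0.
- rewrite subrr mulr0 mul0r scale0r /laplacian big1// => i _.
  by rewrite expr1 mderiv_linform mderivC.
by rewrite laplacian_linformX subn2 /=; congr (_ *: _); rewrite -![j.+2%:R]natr1 -natr1; ring.
Qed.

Lemma linform_sum xi : \sum_i mpolyX R (mnm1 i) * mpolyC n (xi 0 i) = linform xi.
Proof. by apply: eq_bigr => i _; rewrite mulrC mul_mpolyC. Qed.

Lemma laplacian_term xi k j : laplacian (sqform ^+ k * linform xi ^+ j) =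
  (2 * k%:R * (n%:R + 2 * k%:R - 2 + 2 * j%:R)) *: (sqform ^+ k.-1 * linform xi ^+ j) +
  (j%:R * (j%:R - 1) * dot xi xi) *: (sqform ^+ k * linform xi ^+ (j - 2)).
Proof.
rewrite laplacianM laplacian_sqformX laplacian_linformX' -scalerAl -scalerAr.
have -> : \sum_i mderiv i (sqform ^+ k) * mderiv i (linform xi ^+ j) =
    (2 * k%:R * j%:R) *: (sqform ^+ k.-1 * linform xi ^+ j).
  case: k => [|k].
    by rewrite mulr0 mul0r scale0r big1// => i _; rewrite expr0 -mpolyC1 mderivC mul0r.
  case: j => [|j].
    by rewrite mulr0 scale0r big1// => i _; rewrite expr0 -mpolyC1 mderivC mulr0.
  transitivity ((2 * k.+1%:R * j.+1%:R) *: \sum_i (sqform ^+ k * linform xi ^+ j) * (mpolyX R (mnm1 i) * mpolyC n (xi 0 i))).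
    rewrite scaler_sumr; apply: eq_bigr => i _.
    by rewrite !mderivXn mderiv_sqform mderiv_linform -!mul_mpolyC !rmorphM /=; ring.
  by rewrite -mulr_sumr linform_sum exprSr mulrA.
rewrite scalerA -scalerDl; congr (_ *: _ + _); ring.
Qed.

(** * The zonal harmonic and the reproducing kernel *)

Section Zonal.
Variable m : nat.

Definition zcoef (k : nat) : R :=
  (-1) ^+ k / ((2 * m - 2 * k)`!%:R * k`!%:R * 2 ^+ k * pfactor_prod n m k).

(** The zonal harmonic with pole [w], normalised so that pairing a harmonic polynomial of degree
    [2m] with it gives the value at [w]. *)
Definition zonal_form w : mpoly n R :=
  \sum_(k < m.+1) (zcoef k * dot w w ^+ k) *: (sqform ^+ k * linform w ^+ (2 * m - 2 * k)).

Lemma zonal_form_homog w : zonal_form w \is ishomog1 (2 * m) mdeg.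
Proof.
apply: rpred_sum => k _; apply: rpredZ.
have h := dhomogM (dhomogMn k sqform_homog) (linformX_homog w (2 * m - 2 * k)).
by move: h; rewrite subnKC// leq_mul2l -ltnS ltn_ord.
Qed.

Lemma pfactor_gt0 k : (0 < n)%N -> (k <= m)%N -> 0 < (pfactor_prod n m k : R).
Proof.
move=> n0 km; apply: prodr_gt0 => l _.
have h : (l < m)%N by apply: leq_trans km.
have h1 : l%:R + 1 <= m%:R :> R by rewrite natr1 ler_nat.
have h2 : 1 <= n%:R :> R by rewrite ler1n.
have h3 : 0 <= l%:R :> R by [].
lra.
Qed.

(** The Laplacian of the [k]-th summand has a part with [sqform ^+ k.-1] and a part with
    [sqform ^+ k]; the coefficients are such that the second part for [k] cancels the first part for
    [k+1]. The case [n = 0], where the denominators may vanish, is split off: there the Laplacian is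
    an empty sum. *)
Lemma zonal_form_harmonic w : laplacian (zonal_form w) = 0.
Proof.
have [n0|n0] := posnP n.
  by rewrite /laplacian big1// => i; have := ltn_ord i; rewrite {2}n0.
rewrite /zonal_form laplacian_sum.
under eq_bigr do rewrite laplacianZ laplacian_term scalerDr !scalerA.
rewrite big_split /= big_ord_recl [X in _ + X]big_ord_recr /=.
rewrite !mulr0 !mul0r mulr0 scale0r add0r subnn !mul0r mulr0 scale0r addr0 -big_split big1// => k _ /=.
have km := ltn_ord k; rewrite /bump /= add1n.
have -> : (2 * m - 2 * k - 2 = 2 * m - 2 * k.+1)%N by lia.
rewrite -scalerDl; apply/eqP; rewrite scaler_eq0; apply/orP; left; apply/eqP.
have e1 : (2 * m - 2 * k = (2 * m - 2 * k.+1).+2)%N by lia.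
rewrite /zcoef e1; set j := (2 * m - 2 * k.+1)%N.
have hj : j%:R = 2 * m%:R - 2 * k%:R - 2 :> R.
  rewrite /j natrB; last by lia.
  by rewrite !natrM -natr1; ring.
rewrite !factS /pfactor_prod big_ord_recr /= -/(pfactor_prod n m k).
have p0 : (pfactor_prod n m k : R) != 0 by rewrite gt_eqF// pfactor_gt0// ltnW.
have p1 : (pfactor_prod n m k.+1 : R) != 0 by rewrite gt_eqF// pfactor_gt0.
move: p1; rewrite /pfactor_prod big_ord_recr /= -/(pfactor_prod n m k) mulf_eq0 negb_or => /andP[_ p1].
have f0 i : (i`!%:R : R) != 0 by rewrite pnatr_eq0 -lt0n fact_gt0.
have s0 i : (i.+1%:R : R) != 0 by rewrite pnatr_eq0.
rewrite !natrM !exprS.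
have t0 : (2 ^+ k : R) != 0 by rewrite expf_neq0// pnatr_eq0.
have -> : j.+2%:R - 1 = j.+1%:R :> R by rewrite -(natr1 j.+1) addrK.
(* The numerical factor produced by the Laplacian is exactly the new factor of [pfactor_prod]. *)
have ek : n%:R + 2 * k.+1%:R - 2 + 2 * j%:R = n%:R + 4 * m%:R - 4 - 2 * k%:R :> R.
  by rewrite hj -natr1; ring.
rewrite ek; field.
have a1 i : 1 + i%:R != 0 :> R by rewrite nat1r.
have a2 i : 2 + i%:R != 0 :> R by rewrite -natrD pnatr_eq0.
by rewrite !f0 !a1 !a2 p0 p1 t0.
Qed.

Lemma ev_zonal_form v w :
  ev v (zonal_form w) = \sum_(k < m.+1) zcoef k * dot v w ^+ (2 * m - 2 * k) * (dot v v * dot w w) ^+ k.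
Proof.
rewrite /ev /zonal_form raddf_sum; apply: eq_bigr => k _ /=.
rewrite mevalZ mevalM !rmorphXn /= -!/(ev v _) ev_sqform ev_linform dotC exprMn; ring.
Qed.

(** The division in [cos_angle] is cleared. The resulting polynomial in inner products agrees with
    the convention at zero vectors, which is why these need a separate case. *)
Lemma zonal_termE v w :
  zonal_term m v w = \sum_(k < m.+1) zcoef k * dot v w ^+ (2 * m - 2 * k) * (dot v v * dot w w) ^+ k.
Proof.
rewrite /zonal_term /zonal_poly -mulrA mulr_suml; apply: eq_bigr => k _.
rewrite /cos_angle /zcoef -exprMn -!enorm_sqr; set a := enorm v; set b := enorm w.
have km := ltn_ord k.
have [ab0|ab0] := eqVneq (a * b) 0.
  have d0 : dot v w = 0.
    move/eqP: ab0; rewrite mulf_eq0 !sqrtr_eq0 => /orP[] h.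
      have /eqP : dot v v == 0 by rewrite eq_le h dot_ge0.
      by move/eqP; rewrite dot_eq0 => /eqP ->; rewrite dot_mx mul0mx mxE.
    have /eqP : dot w w == 0 by rewrite eq_le h dot_ge0.
    by move/eqP; rewrite dot_eq0 => /eqP ->; rewrite dotC dot_mx mul0mx mxE.
  have [m0|m0] := posnP m.
    have k0 : nat_of_ord k = 0%N by apply/eqP; rewrite -leqn0 -m0 -ltnS.
    by rewrite k0 m0 !muln0 !expr0 !mulr1.
  have z (x : R) (i : nat) : x = 0 -> (0 < i)%N -> x ^+ i = 0 by move=> -> i0; rewrite expr0n gtn_eqF.
  rewrite (z _ _ ab0) ?muln_gt0// mulr0; have [k0|k0] := posnP k.
    by rewrite k0 (z _ _ d0) ?mulr0 ?mul0r// muln0 subn0 muln_gt0.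
  by rewrite -exprMn (z (_ ^+ 2))// ?mulr0// ab0 expr0n.
have e2 : (a * b) ^+ (2 * m) = (a * b) ^+ (2 * m - 2 * k) * (a ^+ 2 * b ^+ 2) ^+ k.
  by rewrite -exprMn -exprM -exprD subnK// leq_mul2l -ltnS km.
have h1 : (a * b) ^+ (2 * m - 2 * k) != 0 by rewrite expf_neq0.
rewrite e2 expr_div_n; set D := _%:R * _ * _ * _; set X := (a * b) ^+ _ in h1 *.
by move: D^-1 => Dv; field.
Qed.

Theorem zonal_kernel (d : nat) (h : 'I_d -> mpoly n R) v w :
  Harm_orthonormal_basis (2 * m) h -> \sum_j ev v (h j) * ev w (h j) = zonal_term m v w.
Proof.
move=> [hH hO hS].
have [c hc] := hS (zonal_form w) (conj (zonal_form_homog w) (zonal_form_harmonic w)).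
have cE i : c i = ev w (h i).
  have e1 : pairing (h i) (zonal_form w) = c i.
    rewrite hc pairing_sumr (bigD1 i)//= big1 => [|j ji].
      by rewrite pairingZr hO eqxx mulr1 addr0.
    by rewrite pairingZr hO eq_sym (negbTE ji) mulr0.
  rewrite -e1; have [hom lap] := hH i; have [s hs] := homog_powsum hom.
  (* With [h i] written through powers of linear forms, the pairing evaluates the zonal form at the
     points [p.2]. The summands with [k > 0] contain [|p.2|^(2k)] and vanish by harmonicity; in the
     first one [zcoef 0] is [1 / (2m)!], which cancels the factorial of the pairing. *)
  rewrite hs in lap *; rewrite pairing_powsum ?zonal_form_homog//.
  under eq_bigr do rewrite ev_zonal_form mulr_sumr.
  rewrite exchange_big /= big_ord_recl [X in _ * (_ + X)]big1 => [|k _].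
    rewrite addr0 ev_powsum /zcoef muln0 subn0 /pfactor_prod big_ord0 expr0 !mulr1.
    rewrite mulr_sumr; apply: eq_bigr => p _; rewrite !expr0 !mulr1.
    by field; rewrite pnatr_eq0 -lt0n fact_gt0.
  have hk : (0 < (lift ord0 k : nat))%N by [].
  have hk' : (2 * (lift ord0 k : nat) <= 2 * m)%N by have := ltn_ord k; rewrite /= /bump /=; lia.
  have := harm_powsum_vanish lap hk hk' => /(congr1 (ev w)).
  rewrite ev_powsum big_map /ev meval0 => h0.
  transitivity (zcoef (lift ord0 k) * dot w w ^+ (lift ord0 k) * 0); last by rewrite mulr0.
  rewrite -[X in _ = _ * X]h0 mulr_sumr.
  by apply: eq_bigr => p _ /=; rewrite exprMn; ring.
rewrite zonal_termE -ev_zonal_form hc /ev raddf_sum; apply: eq_bigr => j _ /=.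
by rewrite mevalZ -/(ev v _) cE mulrC.
Qed.

End Zonal.

End LinearForms.

(** * Poisson summation with a periodic weight *)

(** Over an abstract field with an element [i] of square [-1], the two sides differ by a multiple of
    [i * i + 1]; this isolates the only fact about [i] that [field] cannot see. *)
Lemma square_completion (F : numFieldType) (i p W t q G k : F) :
  i * i = -1 -> p != 0 -> W != 0 -> q != 0 ->
  i * t ^+ 2 / (8 * p * W) +
  - p * (- 2 * i * W * q ^+ 2 * (k + (G / q + t / (4 * i * p * W * q))) ^+ 2) =
  2 * p * i * W * (G + q * k) ^+ 2 + t * (G + q * k).
Proof.
move=> i2 p0 W0 q0; have i0 : i != 0 by apply: contra_eq_neq i2 => ->; rewrite mul0r eq_sym oppr_eq0 oner_eq0.
apply/eqP; rewrite -subr_eq0; apply/eqP.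
transitivity ((i * i + 1) * t ^+ 2 / (8 * i * p * W)); last by rewrite i2 addNr !mul0r.
by field; rewrite p0 W0 q0 i0.
Qed.

Lemma dual_exponent (F : numFieldType) (i p W t q G j : F) :
  i * i = -1 -> p != 0 -> W != 0 -> q != 0 ->
  - p * j ^+ 2 / (- 2 * i * W * q ^+ 2) + 2 * p * i * (j * (G / q + t / (4 * i * p * W * q))) =
  2 * p * i * - W^-1 * (j ^+ 2 / (4 * q ^+ 2)) + t / W * (j / (2 * q)) + 2 * p * i * (j * G / q).
Proof.
move=> i2 p0 W0 q0; have i0 : i != 0 by apply: contra_eq_neq i2 => ->; rewrite mul0r eq_sym oppr_eq0 oner_eq0.
apply/eqP; rewrite -subr_eq0; apply/eqP.
transitivity (p * j ^+ 2 * (1 + i * i) / (2 * i * W * q ^+ 2)); last by rewrite i2 subrr mulr0 mul0r.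
by field; rewrite p0 W0 q0 i0.
Qed.

Lemma inv_neg2i (F : numFieldType) (i a q W : F) : i * i = -1 -> a != 0 -> W != 0 -> q != 0 ->
  (- 2 * i * (a * W) * q ^+ 2)^-1 = i / (2 * W * a * q ^+ 2).
Proof.
move=> i2 p0 W0 q0; have i0 : i != 0 by apply: contra_eq_neq i2 => ->; rewrite mul0r eq_sym oppr_eq0 oner_eq0.
apply/eqP; rewrite -subr_eq0; apply/eqP.
transitivity (- (1 + i * i) / (2 * i * W * a * q ^+ 2)); last by rewrite i2 subrr oppr0 mul0r.
by field; rewrite p0 W0 q0 i0.
Qed.

Lemma gauss_factor_split (F : numFieldType) (i p W t a : F) : p != 0 -> W != 0 -> a != 0 ->
  i * (t ^+ 2 / a) / (8 * p * W) = i * t ^+ 2 / (8 * p * (a * W)).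
Proof. by move=> p0 W0 a0; field; rewrite p0 W0 a0. Qed.

Lemma dual_exponentN (F : numFieldType) (c W t q j a : F) : W != 0 -> a != 0 -> q != 0 ->
  c * - (a * W)^-1 * (j ^+ 2 / (4 * q ^+ 2)) + t / (a * W) * (j / (2 * q)) =
  c * - W^-1 * (a * (j / (2 * a * q)) ^+ 2) + t * (j / (2 * a * q)) / W.
Proof. by move=> W0 a0 q0; field; rewrite W0 a0 q0. Qed.

Section PoissonSummation.
Context {R : realType}.
Local Notation C := (R[i]).
Local Notation "x %:K" := (x%:C%C : C) (at level 2, format "x %:K").

(** [Re (rho^2) > 0] says [|Im rho| < |Re rho|], so the root with nonnegative real part lies in the
    sector required by [gauss_inversion]. *)
Lemma sqrt_sector (w : C) : 0 < complex.Re w ->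
  exists2 rho : C, rho ^+ 2 = w & `|complex.Im rho| < complex.Re rho.
Proof.
move=> w0; pose r := sqrtc w; have hr : r ^+ 2 = w := sqr_sqrtc w.
have key (rho : C) : rho ^+ 2 = w -> 0 <= complex.Re rho -> `|complex.Im rho| < complex.Re rho.
  move=> h p0; have : complex.Re rho ^+ 2 - complex.Im rho ^+ 2 = complex.Re w.
    by rewrite -h !expr2 !ReIm.
  move=> h2; rewrite -(@ltr_pXn2r _ 2)// ?nnegrE// real_normK ?num_real//; lra.
have [p0|p0] := leP 0 (complex.Re r); first by exists r => //; exact: key.
exists (- r); first by rewrite sqrrN.
by apply: key; [rewrite sqrrN | rewrite !ReIm oppr_ge0 ltW].
Qed.

(* [gauss_inversion] after completing the square in [tpi W X^2 + t X], [X = g + q k]. *)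
Lemma poisson1 (W rho t : C) (q : nat) (g : int) : (0 < q)%N -> W != 0 ->
  rho ^+ 2 = - 2 * 'i%C * W * q%:R ^+ 2 -> `|complex.Im rho| < complex.Re rho ->
  exists S, hassum (fun k : int => cexp (tpi * W * (g + q%:Z * k)%:~R ^+ 2 + t * (g + q%:Z * k)%:~R))
      (rho^-1 * cexp ('i%C * t ^+ 2 / (8 * (pi : R)%:K * W)) * S) /\
    hassum (fun j : int => cexp (tpi * (- W^-1) * (j%:~R ^+ 2 / (4 * q%:R ^+ 2)) + t / W * (j%:~R / (2 * q%:R)) +
      tpi * (j%:~R * g%:~R / q%:R))) S.
Proof.
move=> q0 W0 hrho hs; have r0 := sector_neq0 hs.
have q1 : (q%:R : C) != 0 by rewrite pnatr_eq0 -lt0n.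
have p0 := @cpi_neq0 R; have i0 := @ci_neq0 R.
have i2 : 'i%C * 'i%C = -1 :> C by exact: sqrc_i.
have iV : 'i%C^-1 = - 'i%C :> C by exact: invc_i.
pose u : C := g%:~R / q%:R + t / (4 * 'i%C * (pi : R)%:K * W * q%:R).
have [S [h1 h2]] := gauss_inversion u hs.
exists (rho * S); split.
  have := hassumZ (cexp ('i%C * t ^+ 2 / (8 * (pi : R)%:K * W))) h1.
  rewrite (_ : rho^-1 * _ * (rho * S) = cexp ('i%C * t ^+ 2 / (8 * (pi : R)%:K * W)) * S); last by field.
  apply: eq_hassum => k; rewrite /gauss -cexpD; congr cexp.
  rewrite exprMn hrho /u /tpi intrD intrM; exact: square_completion.
by apply: eq_hassum h2 => j; congr cexp; rewrite hrho /u /tpi; exact: dual_exponent.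
Qed.

Lemma hassum_row_prod (n : nat) (f : 'I_n -> int -> C) (s : 'I_n -> C) :
  (forall i, hassum (f i) (s i)) ->
  hassum (fun x : 'rV[int]_n => \prod_i f i (x 0 i)) (\prod_i s i).
Proof.
elim: n f s => [|n IH] f s hf.
  rewrite big_ord0; apply: (@hassum_reindex _ unit _ (fun=> 0)); first by case; case.
    by move=> x _; exists tt; apply/rowP => -[].
  have := hassum_fin (fun _ : unit => 1 : C).
  rewrite big_const /= card_unit /= addr0; apply: eq_hassum => x /=.
  by rewrite big_ord0.
pose phi (x : 'rV[int]_n.+1) : int * 'rV[int]_n := (x 0 ord0, \row_j x 0 (lift ord0 j)).
pose psi (p : int * 'rV[int]_n) : 'rV[int]_n.+1 :=
  \row_i (if unlift ord0 i is Some j then p.2 0 j else p.1).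
have h := hassum_mul (hf ord0) (IH _ _ (fun i => hf (lift ord0 i))).
have k1 : cancel phi psi.
  move=> x; apply/rowP => i; rewrite !mxE; case: unliftP => [j ->|->] //=.
  by rewrite mxE.
have k2 : cancel psi phi.
  case=> a y; rewrite /phi /psi /=; congr pair; first by rewrite mxE unlift_none.
  by apply/rowP => j; rewrite !mxE liftK.
rewrite big_ord_recl; apply: eq_hassum (hassum_bij k1 k2 h) => x.
rewrite /= big_ord_recl; congr (_ * _); apply: eq_bigr => i _.
by rewrite mxE.
Qed.

(** * Residue systems in Z^n *)

Section Box.
Variables (n q : nat).
Hypothesis q0 : (0 < q)%N.
Implicit Types (x k : 'rV[int]_n).

Definition box := {ffun 'I_n -> 'I_q}.

Definition brow (g : box) : 'rV[int]_n := \row_i (nat_of_ord (g i))%:Z.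

Definition boxof x : box := [ffun i => Ordinal (ltn_pmod (absz ((x 0 i)%R %% q%:Z)%Z) q0)].

Lemma absz_modz_lt (a : int) : (absz (a %% q%:Z)%Z < q)%N.
Proof.
rewrite -ltz_nat gez0_abs ?modz_ge0// ?eqz_nat -?lt0n//.
by rewrite ltz_pmod// ltz_nat.
Qed.

Lemma boxofE x i : (nat_of_ord (boxof x i))%:Z = ((x 0 i)%R %% q%:Z)%Z.
Proof.
rewrite ffunE /= modn_small ?absz_modz_lt// gez0_abs// modz_ge0//.
by rewrite eqz_nat -lt0n.
Qed.

Lemma boxof_decomp x : exists k, x = brow (boxof x) + q%:Z *: k.
Proof.
exists (\row_i ((x 0 i)%R %/ q%:Z)%Z); apply/rowP => i; rewrite !mxE boxofE.
by rewrite [LHS](divz_eq _ q%:Z) addrC mulrC.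
Qed.

Lemma boxof_add (g : box) k : boxof (brow g + q%:Z *: k) = g.
Proof.
apply/ffunP => i; apply/val_inj; apply/eqP; rewrite -eqz_nat; apply/eqP.
rewrite [LHS]boxofE !mxE addrC [_ * k 0 i]mulrC modzMDl modz_small//.
by rewrite lez_nat leq0n /= ltz_nat ltn_ord.
Qed.

Lemma hassum_box (F : 'rV[int]_n -> C) (S : box -> C) :
  (forall g, hassum (fun k => F (brow g + q%:Z *: k)) (S g)) -> hassum F (\sum_g S g).
Proof.
move=> h.
have h1 (g : box) : hassum (fun x => if boxof x == g then F x else 0) (S g).
  apply: (@hassum_reindex _ _ _ (fun k => brow g + q%:Z *: k)).
  - move=> k k' /addrI /(congr1 (fun y : 'rV[int]_n => y)) e; apply/rowP => i.
    move/rowP : e => /(_ i); rewrite !mxE => /mulfI; apply.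
    by rewrite eqz_nat -lt0n.
  - move=> x; case: (boxof x =P g) => [<- _|_]; last by rewrite eqxx.
    exact: boxof_decomp.
  by apply: eq_hassum (h g) => k /=; rewrite boxof_add eqxx.
have := hassum_bigsum (I := box) (index_enum box) (P := xpredT) (fun g _ => h1 g).
apply: eq_hassum => x; rewrite (bigD1 (boxof x))//= eqxx big1 ?addr0// => g.
by rewrite eq_sym => /negbTE ->.
Qed.

Lemma sum_box_shift (V : nmodType) (F : 'rV[int]_n -> V) (u : 'rV[int]_n) :
  (forall x k, F (x + q%:Z *: k) = F x) ->
  \sum_(g : box) F (brow g + u) = \sum_(g : box) F (brow g).
Proof.
move=> hF; pose s (g : box) : box := boxof (brow g + u).
have hs g : F (brow (s g)) = F (brow g + u).
  by have [k hk] := boxof_decomp (brow g + u); rewrite [in RHS]hk hF.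
have si : injective s.
  move=> g g' e; have [k hk] := boxof_decomp (brow g + u).
  have [k' hk'] := boxof_decomp (brow g' + u).
  have : brow g = brow g' + q%:Z *: (k - k').
    apply: (addIr u); rewrite addrAC hk' -/(s g') -e hk /s.
    by rewrite scalerBr -addrA; congr (_ + _); rewrite addrC subrK.
  move=> h; have := boxof_add g' (k - k'); rewrite -h.
  have := boxof_add g 0; rewrite scaler0 addr0 => -> <-//.
rewrite [RHS](reindex_inj si); apply: eq_bigr => g _; exact/esym/hs.
Qed.

End Box.

Section PoissonN.
Variables (n : nat) (mu : 'I_n -> R).
Hypothesis mu0 : forall i, 0 < mu i.

Definition qf (y : 'I_n -> R) : R := \sum_i mu i * y i ^+ 2.

Definition cdot (t : 'I_n -> C) (y : 'I_n -> R) : C := \sum_i t i * (y i)%:K.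

Definition zc (x : 'rV[int]_n) (i : 'I_n) : R := (x 0 i)%:~R.

(** Coordinates of the lattice dual, for the pairing [2 <v, w>], to [q] times the orthogonal
    lattice. *)
Definition yc (q : nat) (j : 'rV[int]_n) (i : 'I_n) : R := (j 0 i)%:~R / (2 * mu i * q%:R).

(** The finite Fourier transform of the periodic weight, taken over one box of representatives. *)
Definition ftcoef (q : nat) (psi : 'rV[int]_n -> C) (j : 'rV[int]_n) : C :=
  \sum_(g : box n q) psi (brow g) * cexp (tpi * (\sum_i (j 0 i)%:~R * (brow g 0 i)%:~R / q%:R)).

(** The order of quantifiers matters: one root [r] serves every weight [psi] and every [t]. A
    product of one-variable formulas is applied on each residue class modulo [q], and the classes
    are then recombined into [ftcoef]. *)
Lemma poissonN (W : C) (q : nat) : (0 < q)%N -> 0 < complex.Im W ->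
  exists2 r : C, r ^+ 2 = \prod_i ('i%C / (2 * W * (mu i)%:K * q%:R ^+ 2)) &
  forall (psi : 'rV[int]_n -> C) (t : 'I_n -> C),
  (forall x k, psi (x + q%:Z *: k) = psi x) ->
  exists S,
  hassum (fun x => psi x * cexp (tpi * W * (qf (zc x))%:K + cdot t (zc x)))
    (r * cexp ('i%C * (\sum_i t i ^+ 2 / (mu i)%:K) / (8 * (pi : R)%:K * W)) * S) /\
  hassum (fun j => ftcoef q psi j * cexp (tpi * (- W^-1) * (qf (yc q j))%:K + cdot t (yc q j) / W)) S.
Proof.
move=> q0 hW; have W0 : W != 0 by apply: contraTneq hW => ->; rewrite ltxx.
have muK i : (mu i)%:K != 0 by rewrite -(rmorph0 (real_complex R)) (inj_eq (@complexI R)) gt_eqF.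
have q1 : (q%:R : C) != 0 by rewrite pnatr_eq0 -lt0n.
have hsec i : exists rho : C, rho ^+ 2 = - 2 * 'i%C * ((mu i)%:K * W) * q%:R ^+ 2 /\ `|complex.Im rho| < complex.Re rho.
  have [|rho h1 h2] := @sqrt_sector (- 2 * 'i%C * ((mu i)%:K * W) * q%:R ^+ 2); last by exists rho.
  have -> : - 2 * 'i%C * ((mu i)%:K * W) * q%:R ^+ 2 = (2 * mu i * q%:R ^+ 2)%:K * (- 'i%C * W).
    have -> : (2 * mu i * q%:R ^+ 2)%:K = 2 * (mu i)%:K * q%:R ^+ 2.
      by rewrite (rmorphM (real_complex R)) (rmorphM (real_complex R) 2) (rmorphXn (real_complex R)) /= !(rmorph_nat (real_complex R)).
    by ring.
  rewrite !ReIm /= !(mul0r, mulr0, oppr0, subr0, sub0r, mulN1r, opprK, addr0).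
  by rewrite !mulr_gt0 ?exprn_gt0 ?ltr0n.
have /choice[rho hrho] := hsec.
exists (\prod_i (rho i)^-1).
  rewrite -prodrXl; apply: eq_bigr => i _; have [h1 _] := hrho i.
  by rewrite exprVn h1; exact: inv_neg2i (@sqrc_i R) (muK i) W0 q1.
move=> psi t hpsi.
have /choice[S1 hS1] : forall p : 'I_n * int, exists S, _ := fun p =>
  poisson1 (t p.1) p.2 q0 (mulf_neq0 (muK p.1) W0) (hrho p.1).1 (hrho p.1).2.
set E := cexp _.
pose Sg (g : box n q) := \prod_i S1 (i, brow g 0 i).
exists (\sum_(g : box n q) psi (brow g) * Sg g).
have eE : E = \prod_i cexp ('i%C * t i ^+ 2 / (8 * (pi : R)%:K * ((mu i)%:K * W))).
  rewrite -cexp_sum /E; congr cexp; rewrite mulr_sumr mulr_suml; apply: eq_bigr => i _.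
  by apply: gauss_factor_split; rewrite ?cpi_neq0 ?muK.
split.
  rewrite mulr_sumr; apply: (hassum_box q0) => g.
  have h := hassum_row_prod (fun i => (hS1 (i, brow g 0 i)).1).
  rewrite !big_split /= -eE -/(Sg g) in h.
  rewrite mulrCA; apply: eq_hassum (hassumZ (psi (brow g)) h) => k.
  rewrite hpsi; congr (_ * _); rewrite -cexp_sum; congr cexp.
  rewrite /qf /cdot rmorph_sum mulr_sumr -big_split; apply: eq_bigr => i _ /=.
  rewrite /zc !mxE rmorphM rmorphXn /= !rmorph_int; ring.
have hj (g : box n q) := hassumZ (psi (brow g)) (hassum_row_prod (fun i => (hS1 (i, brow g 0 i)).2)).
have := hassum_bigsum (I := box n q) (index_enum _) (P := xpredT) (fun g _ => hj g).
apply: eq_hassum => j; rewrite /ftcoef mulr_suml; apply: eq_bigr => g _.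
rewrite -mulrA; congr (_ * _); rewrite -cexpD -cexp_sum; congr cexp.
rewrite /qf /cdot rmorph_sum !mulr_sumr mulr_suml -!big_split; apply: eq_bigr => i _ /=.
rewrite /yc; have m0 : mu i != 0 by rewrite gt_eqF.
rewrite !(rmorphM, rmorphXn, fmorphV) /= !rmorph_int !rmorph_nat.
rewrite [LHS]addrC -[X in _ * - W^-1 * (_ * X)]expr2; congr (_ + _).
by apply: dual_exponentN.
Qed.

End PoissonN.

End PoissonSummation.

(** * Poisson summation with harmonic coefficients *)

Section HarmonicPoisson.
Context {R : realType}.
Local Notation C := (R[i]).
Local Notation "x %:K" := (x%:C%C : C) (at level 2, format "x %:K").

Lemma Im_negV (W : C) : 0 < complex.Im W -> 0 < complex.Im (- W^-1).
Proof.
case: W => a b /= b0; rewrite opprK divr_gt0//.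
by rewrite ltr_wpDl ?sqr_ge0// exprn_gt0.
Qed.

Lemma Re_tpi_mul (Z : C) (x : R) : complex.Re (tpi * Z * x%:K) = - (2 * pi * complex.Im Z * x).
Proof. by rewrite tpiE !ReIm /=; ring. Qed.

Lemma cabs_cexp_tpi_real (x : R) : cabs (cexp (tpi * x%:K)) = 1.
Proof. by rewrite cabs_cexp -[X in X * _]mulr1 Re_tpi_mul /= mulr0 mul0r oppr0 expR0. Qed.

Lemma bsums_int_gauss (A B : R) : 0 < A ->
  bsums (fun k : int => expR (- A * k%:~R ^+ 2 + B * `|k%:~R|)).
Proof.
move=> A0; pose M := expR ((B + 1) ^+ 2 / (4 * A)).
apply: (@bsums_le _ _ _ (fun k : int => M * (1%:R^-1 * expR (- `|k%:~R / 1%:R|)))); last first.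
  apply: bsumsZ; first exact: expR_ge0.
  by exists 10 => D; exact: bsums_int_exp.
move=> k; rewrite [1%:R^-1]invr1 mul1r mulr1 /M -expRD ler_expR.
have := expR_quad_le (B + 1) A0 `|k%:~R|; rewrite real_normK ?num_real//; lra.
Qed.

Lemma bsums_row_gauss (n : nat) (A B : R) : 0 < A ->
  bsums (fun x : 'rV[int]_n =>
    expR (- A * (\sum_i (x 0 i)%:~R ^+ 2) + B * (\sum_i `|(x 0 i)%:~R|))).
Proof.
move=> A0; have [s hs] := hassum_real_ge0 (fun k => expR_ge0 _) (bsums_int_gauss B A0).
have [h _] := hassum_row_prod (n := n) (fun=> hs).
apply: bsums_le h => x; rewrite /= -(rmorph_prod (real_complex R)) cabs_real ger0_norm; last by apply: prodr_ge0 => i _; exact: expR_ge0.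
by rewrite -expR_sum ler_expR big_split /= !mulr_sumr.
Qed.

Lemma sumr_mul_le (n : nat) (a b : 'I_n -> R) : (forall i, 0 <= a i) -> (forall i, 0 <= b i) ->
  \sum_i a i * b i <= (\sum_i a i) * (\sum_i b i).
Proof.
move=> a0 b0; rewrite mulr_suml; apply: ler_sum => i _; apply: ler_wpM2l => //.
by rewrite (bigD1 i)//= lerDl sumr_ge0.
Qed.

Lemma pos_lower_bound (n : nat) (a : 'I_n -> R) : (forall i, 0 < a i) ->
  exists2 A, 0 < A & forall i, A <= a i.
Proof.
move=> a0; have s0 : 0 <= \sum_i (a i)^-1 by apply: sumr_ge0 => i _; rewrite invr_ge0 ltW.
exists (1 + \sum_i (a i)^-1)^-1; first by rewrite invr_gt0; lra.
move=> i; rewrite -[leRHS]invrK lef_pV2 ?posrE ?invr_gt0//; last by lra.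
rewrite (bigD1 i)//= addrCA lerDl addr_ge0// sumr_ge0// => j _.
by rewrite invr_ge0 ltW.
Qed.

Section Diagonal.
Variables (n : nat) (mu : 'I_n -> R).
Hypothesis mu0 : forall i, 0 < mu i.

(** Gaussian decay leaves room for an exponential factor of any rate [B]; this is the form of
    summability that [moment_identity] asks for. *)
Lemma qf_bsums (s : 'I_n -> R) (y : 'rV[int]_n -> 'I_n -> R) (b : 'rV[int]_n -> C) (M : R) (Z : C) (B : R) :
  (forall i, 0 < s i) -> (forall x i, y x i = s i * (x 0 i)%:~R) ->
  (forall x, cabs (b x) <= M) -> 0 < complex.Im Z ->
  bsums (fun x => cabs (b x * cexp (tpi * Z * (qf mu (y x))%:K)) * expR (B * \sum_i `|y x i|)).
Proof.
move=> s0 hy hb Z0.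
have [|A A0 hA] := @pos_lower_bound n (fun i => mu i * s i ^+ 2).
  by move=> i; rewrite mulr_gt0// exprn_gt0.
have M0 : 0 <= M by exact: le_trans (cabs_ge0 _) (hb 0).
have tp : 0 < 2 * pi * complex.Im Z by rewrite !mulr_gt0 ?pi_gt0.
apply: bsums_le (bsumsZ M0 (@bsums_row_gauss n (2 * pi * complex.Im Z * A) (`|B| * \sum_i s i) (mulr_gt0 tp A0))) => x.
rewrite [cabs (_ * _)]cabsM cabs_cexp Re_tpi_mul -mulrA -expRD.
apply: ler_pM => //; rewrite ?cabs_ge0 ?expR_ge0// ler_expR; apply: lerD.
  rewrite mulNr lerN2 -[leLHS]mulrA; apply: ler_wpM2l; first exact: ltW.
  rewrite /qf mulr_sumr; apply: ler_sum => i _; rewrite hy exprMn [leRHS]mulrA.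
  by apply: ler_wpM2r; [rewrite sqr_ge0 | exact: hA].
rewrite -mulrA; apply: (@le_trans _ _ (`|B| * \sum_i `|y x i|)).
  by apply: ler_wpM2r; [apply: sumr_ge0 => i _; exact: normr_ge0 | exact: ler_norm].
apply: ler_wpM2l; first exact: normr_ge0.
under eq_bigr do rewrite hy normrM (gtr0_norm (s0 _)).
by apply: sumr_mul_le => i; rewrite ?normr_ge0 ?ltW.
Qed.

Lemma cdot_le (t : 'I_n -> C) (y : 'I_n -> R) :
  cabs (cdot t y) <= (\sum_i cabs (t i)) * \sum_i `|y i|.
Proof.
apply: le_trans (cabs_sum _ _ _) _.
under eq_bigr do rewrite cabsM cabs_real.
by apply: sumr_mul_le => i; rewrite ?cabs_ge0 ?normr_ge0.
Qed.

Lemma periodic_bounded (q : nat) (psi : 'rV[int]_n -> C) : (0 < q)%N ->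
  (forall x k, psi (x + q%:Z *: k) = psi x) ->
  forall x, cabs (psi x) <= \sum_(g : box n q) cabs (psi (brow g)).
Proof.
move=> q0 h x; have [k ->] := boxof_decomp q0 x; rewrite h.
by rewrite (bigD1 (boxof q0 x))//= lerDl sumr_ge0// => g _; exact: cabs_ge0.
Qed.

Lemma ftcoef_bounded (q : nat) (psi : 'rV[int]_n -> C) (j : 'rV[int]_n) :
  cabs (ftcoef q psi j) <= \sum_(g : box n q) cabs (psi (brow g)).
Proof.
apply: le_trans (cabs_sum _ _ _) _; apply: ler_sum => g _.
rewrite cabsM; have -> : \sum_i (j 0 i)%:~R * (brow g 0 i)%:~R / q%:R =
    (\sum_i (j 0 i)%:~R * (brow g 0 i)%:~R / q%:R : R)%:K.
  rewrite rmorph_sum; apply: eq_bigr => i _.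
  by rewrite !(rmorphM (real_complex R)) /= (fmorphV (real_complex R)) !(rmorph_int (real_complex R)) (rmorph_nat (real_complex R)).
by rewrite cabs_cexp_tpi_real mulr1.
Qed.

End Diagonal.

Section OrthogonalRows.
Variables (n : nat) (mu : 'I_n -> R) (P : 'M[R]_n).
Hypothesis mu0 : forall i, 0 < mu i.
Hypothesis hP : forall i j, dot (row i P) (row j P) = if i == j then mu i else 0.

Definition comb (y : 'I_n -> R) : 'rV[R]_n := (\row_i y i) *m P.

Lemma dot_suml (I : Type) (r : seq I) (F : I -> 'rV[R]_n) v : dot (\sum_(i <- r) F i) v = \sum_(i <- r) dot (F i) v.
Proof.
elim: r => [|a r IH]; last by rewrite !big_cons dotDl IH.
by rewrite !big_nil -(scale0r 0) dotZl mul0r.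
Qed.

Lemma comb_sum y : comb y = \sum_i y i *: row i P.
Proof. by rewrite /comb mulmx_sum_row; apply: eq_bigr => i _; rewrite mxE. Qed.

Lemma dot_comb xi y : dot xi (comb y) = \sum_i dot (row i P) xi * y i.
Proof.
by rewrite dotC comb_sum dot_suml; apply: eq_bigr => i _; rewrite dotZl mulrC.
Qed.

Lemma comb_comb y y' : dot (comb y) (comb y') = \sum_i mu i * y i * y' i.
Proof.
rewrite dot_comb; apply: eq_bigr => i _; congr (_ * _); rewrite dot_comb (bigD1 i)//= big1.
  by rewrite hP eqxx addr0.
by move=> j ji; rewrite hP (negbTE ji) mul0r.
Qed.

Lemma comb_norm y : dot (comb y) (comb y) = qf mu y.
Proof. by rewrite comb_comb; apply: eq_bigr => i _; rewrite -mulrA expr2. Qed.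

Lemma parseval xi : \sum_i dot (row i P) xi ^+ 2 / mu i = dot xi xi.
Proof.
pose Q : 'M[R]_n := \matrix_(i, j) (P j i / mu j).
have PQ : P *m Q = 1%:M.
  apply/matrixP => i j; rewrite !mxE.
  transitivity (dot (row i P) (row j P) / mu j).
    by rewrite /dot mulr_suml; apply: eq_bigr => k _; rewrite !mxE mulrA.
  by rewrite hP; case: (i =P j) => [->|_]; rewrite ?divff ?mul0r// gt_eqF.
have hxi : xi = comb (fun i => dot (row i P) xi / mu i).
  rewrite -[LHS]mulmx1 -(mulmx1C PQ) mulmxA /comb; congr (_ *m _).
  apply/rowP => i; rewrite !mxE /dot mulr_suml; apply: eq_bigr => k _.
  by rewrite !mxE mulrA [xi _ _ * _]mulrC.
by rewrite [in RHS]hxi comb_norm; apply: eq_bigr => i _; field; rewrite gt_eqF.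
Qed.

Lemma cdot_comb xi y : cdot (fun i => (dot (row i P) xi)%:K) y = (dot xi (comb y))%:K.
Proof. by rewrite dot_comb (rmorph_sum (real_complex R)); apply: eq_bigr => i _; rewrite rmorphM. Qed.

Theorem harmonic_poisson (W : C) (q : nat) : (0 < q)%N -> 0 < complex.Im W ->
  exists2 r : C, r ^+ 2 = \prod_i ('i%C / (2 * W * (mu i)%:K * q%:R ^+ 2)) &
  forall (psi : 'rV[int]_n -> C) (e : nat) (h : mpoly n R),
  (forall x k, psi (x + q%:Z *: k) = psi x) -> Harm e h ->
  exists S,
  hassum (fun x => psi x * (ev (comb (zc x)) h)%:K * cexp (tpi * W * (qf mu (zc x))%:K))
    (r * W^-1 ^+ e * S) /\
  hassum (fun j => ftcoef q psi j * (ev (comb (yc mu q j)) h)%:K *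
    cexp (tpi * (- W^-1) * (qf mu (yc mu q j))%:K)) S.
Proof.
move=> q0 hW; have [r hr hps] := poissonN mu0 q0 hW; exists r => //.
move=> psi e h hpsi [hom lap]; have W0 : W != 0 by apply: contraTneq hW => ->; rewrite ltxx.
have [s hs] := homog_powsum hom.
pose a x := psi x * cexp (tpi * W * (qf mu (zc x))%:K).
pose b j := ftcoef q psi j * cexp (tpi * (- W^-1) * (qf mu (yc mu q j))%:K).
pose al (xi : 'rV[R]_n) (x : 'rV[int]_n) : C := (dot xi (comb (zc x)))%:K.
pose be (xi : 'rV[R]_n) (j : 'rV[int]_n) : C := (dot xi (comb (yc mu q j)))%:K / W.
have le_dom (xi : 'rV[R]_n) : exists B, forall y : 'I_n -> R,
    cabs (dot xi (comb y))%:K <= B * \sum_i `|y i|.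
  exists (\sum_i cabs (dot (row i P) xi)%:K) => y'; rewrite -cdot_comb; exact: cdot_le.
have ha xi : bsums (fun x => cabs (a x) * expR (cabs (al xi x))).
  have [B hB] := le_dom xi.
  apply: bsums_le (qf_bsums mu0 (s := fun=> 1) (y := @zc R n) B _ _ (periodic_bounded q0 hpsi) hW) => // x.
    by rewrite ler_wpM2l ?cabs_ge0// ler_expR hB.
  by move=> i; rewrite mul1r.
have hb xi : bsums (fun x => cabs (b x) * expR (cabs (be xi x))).
  have [B hB] := le_dom xi.
  apply: bsums_le (qf_bsums mu0 (s := fun i => (2 * mu i * q%:R)^-1) (y := yc mu q) (B / cabs W) _ _ (ftcoef_bounded q psi) (Im_negV hW)).
  - move=> x; rewrite ler_wpM2l ?cabs_ge0// ler_expR /be cabsM cabsV mulrAC.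
    by rewrite ler_wpM2r ?invr_ge0 ?cabs_ge0.
  - by move=> i; rewrite invr_gt0 !mulr_gt0 ?ltr0n.
  - by move=> x i; rewrite /yc mulrC.
(* The exponent of the prefactor of [poissonN] at [t i = u * dot (row i P) xi] is [B xi * u^2],
   because [parseval] evaluates the sum of the [t i ^+ 2 / mu i]. *)
pose B (xi : 'rV[R]_n) : C := 'i%C * (dot xi xi)%:K / (8 * (pi : R)%:K * W).
have hrb xi : bsums (fun x => cabs (r * b x) * expR (cabs (be xi x))).
  apply: bsums_le (bsumsZ (cabs_ge0 r) (hb xi)) => x.
  by rewrite [cabs (r * _)]cabsM mulrA.
have rmom xi k : moment (fun x => r * b x) (be xi) k = r * moment b (be xi) k.
  apply: tsumE; apply: eq_hassum (hassumZ r (moment_hassum (hb xi) k)) => x.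
  by rewrite mulrA.
have id_ xi : moment a (al xi) e =
    \sum_(k < e.+1) gauss_coef (B xi) k * (r * moment b (be xi) (e - k)).
  rewrite (moment_identity (B := B xi) (ha xi) (hrb xi)).
    by apply: eq_bigr => k _; rewrite rmom.
  move=> u _; have [S [h1 h2]] := hps psi (fun i => (u * dot (row i P) xi)%:K) hpsi.
  have cd y : cdot (fun i => (u * dot (row i P) xi)%:K) y = u%:K * (dot xi (comb y))%:K.
    by rewrite -cdot_comb mulr_sumr; apply: eq_bigr => i _; rewrite rmorphM mulrA.
  have eB : 'i%C * (\sum_i (u * dot (row i P) xi)%:K ^+ 2 / (mu i)%:K) / (8 * (pi : R)%:K * W) = B xi * u%:K ^+ 2.
    have -> : \sum_i (u * dot (row i P) xi)%:K ^+ 2 / (mu i)%:K = u%:K ^+ 2 * (dot xi xi)%:K.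
      rewrite -parseval (rmorph_sum (real_complex R)) mulr_sumr; apply: eq_bigr => i _ /=.
      rewrite rmorphM exprMn -mulrA; congr (_ * _).
      by rewrite [in RHS](rmorphM (real_complex R)) (fmorphV (real_complex R)) (rmorphXn (real_complex R)).
    by rewrite /B; ring.
  rewrite eB in h1.
  have -> : tsum (fun x => a x * cexp (u%:K * al xi x)) = r * cexp (B xi * u%:K ^+ 2) * S.
    apply: tsumE; apply: eq_hassum h1 => x; rewrite cexpD cd mulrA; congr (_ * _).
  have -> : tsum (fun x => r * b x * cexp (u%:K * be xi x)) = r * S.
    apply: tsumE; apply: eq_hassum (hassumZ r h2) => x; by rewrite cexpD cd /be /b !mulrA.
  by rewrite [RHS]mulrCA [RHS]mulrA.
have bsum_mom (l k : nat) : hassum (fun j => b j * ((ev (comb (yc mu q j))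
      (powsum k [seq (p.1 * dot p.2 p.2 ^+ l, p.2) | p <- s]))%:K * (W^-1 ^+ k / k`!%:R)))
    (\sum_(p <- s) (p.1 * dot p.2 p.2 ^+ l)%:K * moment b (be p.2) k).
  have := hassum_bigsum s (P := xpredT) (fun p _ => hassumZ (p.1 * dot p.2 p.2 ^+ l)%:K (moment_hassum (hb p.2) k)).
  apply: eq_hassum => j; rewrite ev_powsum big_map (rmorph_sum (real_complex R)) mulr_suml mulr_sumr.
  apply: eq_bigr => p _ /=; rewrite !(rmorphM (real_complex R)) !(rmorphXn (real_complex R)) /= /be exprMn.
  by ring.
have van l : (0 < l)%N -> (2 * l <= e)%N ->
    \sum_(p <- s) (p.1 * dot p.2 p.2 ^+ l)%:K * moment b (be p.2) (e - 2 * l) = 0.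
  move=> l0 le; apply: hassum_unique (bsum_mom l (e - 2 * l)%N) _.
  rewrite harm_powsum_vanish -?hs//; apply: eq_hassum (hassum0 _) => j.
  by rewrite /ev raddf0 mul0r mulr0.
pose S0 := \sum_(p <- s) (p.1)%:K * moment b (be p.2) e.
have hS : \sum_(p <- s) (p.1)%:K * moment a (al p.2) e = r * S0.
  under eq_bigr do rewrite id_ mulr_sumr.
  rewrite exchange_big big_ord_recl /= [X in _ + X]big1 => [|k _].
    rewrite addr0 mulr_sumr; apply: eq_bigr => p _.
    by rewrite subn0 /gauss_coef /= expr0 fact0 divr1 mul1r mulrCA.
  (* Only even indices [2l] occur in the prefactor, and each contributes [|xi|^(2l)] times a moment
     of order [e - 2l], the combination annihilated by [van]. *)
  rewrite /bump leq0n add1n; case: (boolP (odd k.+1)) => ok.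
    by apply: big1 => p _; rewrite /gauss_coef ok mul0r mulr0.
  rewrite /gauss_coef (negbTE ok).
  have ek : k.+1 = (2 * (k.+1)./2)%N by rewrite mul2n even_halfK.
  set l := (k.+1)./2 in ek *.
  have := van l; rewrite -ek => /(_ _ (ltn_ord k)) hv.
  have {}hv : \sum_(p <- s) (p.1 * dot p.2 p.2 ^+ l)%:K * moment b (be p.2) (e - k.+1) = 0.
    by apply: hv; case: (l) ek.
  transitivity (('i%C / (8 * (pi : R)%:K * W)) ^+ l / l`!%:R * r *
      \sum_(p <- s) (p.1 * dot p.2 p.2 ^+ l)%:K * moment b (be p.2) (e - k.+1)).
    rewrite mulr_sumr; apply: eq_bigr => p _.
    rewrite (rmorphM (real_complex R)) (rmorphXn (real_complex R)) /=.
    have -> : B p.2 = 'i%C / (8 * (pi : R)%:K * W) * (dot p.2 p.2)%:K by rewrite /B; ring.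
    by rewrite exprMn; ring.
  by rewrite hv mulr0.
have e0 : (e`!%:R : C) != 0 by rewrite pnatr_eq0 -lt0n fact_gt0.
(* [e!] undoes the factorial in [moment], and [W ^+ e] undoes the division by [W] in [be]. *)
exists (e`!%:R * W ^+ e * S0); split.
  have := hassumZ e`!%:R (hassum_bigsum s (P := xpredT) (fun p _ => hassumZ (p.1)%:K (moment_hassum (ha p.2) e))).
  have -> : r * W^-1 ^+ e * (e`!%:R * W ^+ e * S0) = e`!%:R * \sum_(p <- s) (p.1)%:K * moment a (al p.2) e.
    rewrite hS exprVn.
    have We : W ^+ e != 0 by rewrite expf_neq0.
    by move: (W ^+ e) We (e`!%:R : C) => w w0 f; field.
  apply: eq_hassum => x; rewrite hs ev_powsum (rmorph_sum (real_complex R)) mulrAC -/(a x) !mulr_sumr.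
  apply: eq_bigr => p _ /=; rewrite !(rmorphM (real_complex R)) !(rmorphXn (real_complex R)) /= /al.
  by move: (dot _ _)%:K => z; field.
have := hassumZ (e`!%:R * W ^+ e) (bsum_mom 0%N e).
have -> : \sum_(p <- s) (p.1 * dot p.2 p.2 ^+ 0)%:K * moment b (be p.2) e = S0.
  by apply: eq_bigr => p _; rewrite expr0 mulr1.
apply: eq_hassum => j; have -> : powsum e [seq (p.1 * dot p.2 p.2 ^+ 0, p.2) | p <- s] = h.
  by rewrite hs /powsum big_map; apply: eq_bigr => p _; rewrite /= expr0 mulr1.
rewrite [RHS]mulrAC -/(b j); have We : W ^+ e != 0 by rewrite expf_neq0.
rewrite exprVn; move: (W ^+ e) We (e`!%:R : C) e0 (ev _ _)%:K => w w0 f f0 z.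
by field; rewrite w0 f0.
Qed.

End OrthogonalRows.

End HarmonicPoisson.

(** * An orthogonal superlattice *)

(** Symmetric Gaussian elimination: definiteness makes the pivot [a] positive, [T1] clears its row
    and column, and the Schur complement [G'] is again positive definite. No square roots are
    extracted, so everything stays rational. *)
Lemma rat_diagonalization (n : nat) (G : 'M[rat]_n) :
  G^T = G -> (forall x : 'rV[rat]_n, x != 0 -> 0 < (x *m G *m x^T) 0 0) ->
  exists T : 'M[rat]_n, exists d : 'rV[rat]_n,
    [/\ T \in unitmx, T *m G *m T^T = diag_mx d & forall i, 0 < d 0 i].
Proof.
elim: n G => [|n IH] G symG posG.
  exists 1%:M, 0; split; [exact: unitmx1 | by apply/matrixP => -[] | by case].
pose G1 : 'M[rat]_(1 + n) := G.
pose a : 'M[rat]_1 := ulsubmx G1; pose b := ursubmx G1; pose D := drsubmx G1.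
have dlb : dlsubmx G1 = b^T by rewrite /b trmx_ursub /G1 symG.
have defG : G1 = block_mx a b b^T D by rewrite -dlb submxK.
have symD : D^T = D by rewrite /D trmx_drsub /G1 symG.
have syma : a^T = a by rewrite /a trmx_ulsub /G1 symG.
have posG1 : forall x : 'rV[rat]_(1 + n), x != 0 -> 0 < (x *m G1 *m x^T) 0 0 by exact: posG.
pose e1 : 'rV[rat]_(1 + n) := row_mx 1 0.
have a0 : 0 < a 0 0.
  have := posG1 e1; have -> : e1 *m G1 *m e1^T = a.
    rewrite defG /e1 mul_row_block tr_row_mx mul_row_col trmx1 trmx0 mulmx0 addr0.
    by rewrite !mul0mx !addr0 mul1mx mulmx1.
  apply; apply/eqP => /(congr1 (fun v : 'rV[rat]_(1 + n) => lsubmx v 0 0)).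
  by rewrite row_mxKl !mxE => /eqP; rewrite eqxx oner_eq0.
have ua : a \in unitmx by rewrite unitmxE det_mx11 unitfE gt_eqF.
pose G' := D - b^T *m invmx a *m b.
have symia : (invmx a)^T = invmx a by rewrite trmx_inv syma.
have symG' : G'^T = G' by rewrite /G' linearB /= !trmx_mul trmxK symD symia mulmxA.
pose T1 : 'M[rat]_(1 + n) := block_mx 1%:M 0 (- (b^T *m invmx a)) 1%:M.
have hT1 : T1 *m G1 *m T1^T = block_mx a 0 0 G'.
  rewrite defG /T1 tr_block_mx mulmx_block !mul1mx !mul0mx !addr0.
  rewrite mulNmx -mulmxA mulVmx// mulmx1 addNr mulmx_block !trmx1 !trmx0 !mulmx1 !mulmx0 !mul0mx !addr0 add0r.
  rewrite linearN /= trmx_mul trmxK symia mulmxN mulKVmx// addNr.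
  by rewrite /G' mulNmx addrC.
have posG' (x : 'rV[rat]_n) : x != 0 -> 0 < (x *m G' *m x^T) 0 0.
  move=> x0; pose y : 'rV[rat]_(1 + n) := row_mx 0 x *m T1.
  have -> : x *m G' *m x^T = y *m G1 *m y^T.
    transitivity ((row_mx 0 x : 'rV[rat]_(1 + n)) *m (T1 *m G1 *m T1^T) *m (row_mx 0 x)^T).
      by rewrite hT1 mul_row_block tr_row_mx mul_row_col !(mul0mx, mulmx0, trmx0, addr0, add0r).
    by rewrite /y trmx_mul !mulmxA.
  apply: posG1; apply/eqP => /(congr1 (fun v : 'rV[rat]_(1 + n) => rsubmx v)).
  rewrite /y mul_row_block row_mxKr mulmx0 mulmx1 add0r.
  have -> : rsubmx (0 : 'rV[rat]_(1 + n)) = 0 by apply/rowP => i; rewrite !mxE.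
  by move=> h; rewrite h eqxx in x0.
have [T' [d' [uT' hT' d0']]] := IH G' symG' posG'.
pose T2 : 'M[rat]_(1 + n) := block_mx 1%:M 0 0 T'.
have u1 : T1 \in unitmx by rewrite unitmxE /T1 det_lblock !det1 mulr1 unitr1.
have u2 : T2 \in unitmx by rewrite unitmxE /T2 det_lblock !det1 mul1r -unitmxE.
have u12 : T2 *m T1 \in unitmx by rewrite unitmx_mul u1 u2.
have h12 : T2 *m T1 *m G1 *m (T2 *m T1)^T = diag_mx (row_mx a d').
  transitivity (T2 *m (T1 *m G1 *m T1^T) *m T2^T); first by rewrite trmx_mul !mulmxA.
  rewrite hT1 /T2 tr_block_mx !mulmx_block.
  rewrite !(mul1mx, mulmx1, mul0mx, mulmx0, trmx0, trmx1, addr0, add0r) hT' diag_mx_row.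
  by congr block_mx; apply/matrixP => i j; rewrite !mxE !ord1 eqxx mulr1n.
exists (T2 *m T1), (row_mx a d' : 'rV[rat]_(1 + n)); split => //.
- move=> i; rewrite mxE; case: splitP => j _ //.
  by rewrite !ord1.
Qed.

Lemma clear_denominators (m n : nat) (M : 'M[rat]_(m, n)) :
  exists D : nat, exists Z : 'M[int]_(m, n), (0 < D)%N /\ D%:R *: M = map_mx intr Z.
Proof.
pose D := (\prod_(i : 'I_m) \prod_(j : 'I_n) `|denq (M i j)|)%N.
have hD i j : exists k, D = (`|denq (M i j)| * k)%N.
  exists ((\prod_(j' | j' != j) `|denq (M i j')|) *
    (\prod_(i' | i' != i) \prod_(j' : 'I_n) `|denq (M i' j')|))%N.
  by rewrite /D (bigD1 i)//= (bigD1 j)//= mulnA.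
have /choice[k hk] : forall p : 'I_m * 'I_n, exists k, D = (`|denq (M p.1 p.2)| * k)%N.
  by case=> i j; exact: hD.
exists D, (\matrix_(i, j) ((k (i, j))%:Z * numq (M i j))); split.
  by rewrite prodn_gt0// => i; rewrite prodn_gt0// => j; rewrite absz_gt0 denq_neq0.
apply/matrixP => i j; rewrite !mxE intrM numqE (hk (i, j)) natrM /=.
rewrite -!mulrA mulrCA; congr (_ * _); rewrite mulrC; congr (_ * _).
by rewrite [LHS]pmulrn gez0_abs// ltW// denq_gt0.
Qed.

Section OrthogonalSuperlattice.
Context {R : realType}.
Variables (n : nat) (B : 'M[R]_n) (L : set 'rV[R]_n).
Hypothesis hB : lattice_basis L B.
Hypothesis hint : integral_lattice L.

Lemma lattice0 : L 0.
Proof. by rewrite hB.2; exists 0; rewrite map_mx0 mul0mx. Qed.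

Lemma latticeD v w : L v -> L w -> L (v + w).
Proof.
by rewrite hB.2 => -[x ->] [y ->]; exists (x + y); rewrite map_mxD mulmxDl.
Qed.

Lemma latticeZ (k : int) v : L v -> L (k%:~R *: v).
Proof.
rewrite hB.2 => -[x ->]; exists (k *: x).
by rewrite scalemxAl; congr (_ *m _); apply/rowP => i; rewrite !mxE rmorphM.
Qed.

Lemma lattice_norm_int v : L v -> exists k : int, dot v v = k%:~R.
Proof. by move=> Lv; have /intrP[k hk] := hint Lv; exists k; rewrite -enorm_sqr. Qed.

Lemma lattice_dot_int v w : L v -> L w -> exists k : int, 2 * dot v w = k%:~R.
Proof.
move=> Lv Lw; have [a ha] := lattice_norm_int (latticeD Lv Lw).
have [b hb] := lattice_norm_int Lv; have [c hc] := lattice_norm_int Lw.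
exists (a - b - c); rewrite !rmorphB /= -ha -hb -hc !dotDl !dotDr (dotC w v); ring.
Qed.

Lemma lattice_row i : L (row i B).
Proof.
rewrite hB.2; exists (delta_mx 0 i); rewrite rowE; congr (_ *m _).
by apply/rowP => j; rewrite !mxE rmorph_nat.
Qed.

(** The Gram matrix is half-integral, hence [T] is rational. The rows of [P = D1^-1 T B] are
    orthogonal; since [D1] clears the denominators of [T^-1], their integral span contains [L], and
    since [D2] clears those of [T], the multiple [K = D1 D2] of the span lies in [L]. *)
Lemma orthogonal_superlattice : exists (P : 'M[R]_n) (mu : 'I_n -> R) (K : nat),
  [/\ (0 < K)%N, forall i, 0 < mu i,
      forall i j, dot (row i P) (row j P) = if i == j then mu i else 0,
      forall v, L v -> exists x, v = comb P (zc x) &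
      forall k : 'rV[int]_n, L (comb P (zc (K%:Z *: k)))].
Proof.
have /choice[g hg] : forall p : 'I_n * 'I_n, exists k : int, 2 * dot (row p.1 B) (row p.2 B) = k%:~R.
  by move=> p; apply: lattice_dot_int; exact: lattice_row.
pose G : 'M[rat]_n := \matrix_(i, j) ((g (i, j))%:~R / 2).
pose rm (m k : nat) (M : 'M[rat]_(m, k)) : 'M[R]_(m, k) := map_mx ratr M.
have hG : rm _ _ G = B *m B^T.
  apply/matrixP => i j; rewrite !mxE rmorphM fmorphV /= ratr_int ratr_nat -(hg (i, j)) /=.
  rewrite mulrAC divff// mul1r /dot; apply: eq_bigr => k _; by rewrite !mxE.
have symG : G^T = G.
  apply: (@map_mx_inj _ _ (@ratr R)).
  by rewrite -map_trmx -/(rm _ _ G) hG trmx_mul trmxK.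
have posG (x : 'rV[rat]_n) : x != 0 -> 0 < (x *m G *m x^T) 0 0.
  move=> x0; rewrite -(ltr_rat R) rmorph0.
  have -> : ratr ((x *m G *m x^T) 0 0) = (rm _ _ (x *m G *m x^T)) 0 0 by rewrite [RHS]mxE.
  rewrite /rm !map_mxM -map_trmx -/(rm _ _ G) hG -!mulmxA -trmx_mul mulmxA -dot_mx.
  rewrite lt_neqAle dot_ge0 andbT eq_sym dot_eq0; apply: contraNneq x0 => /(congr1 (mulmx^~ (invmx B))).
  rewrite mul0mx mulmxK ?hB.1// => h; apply/eqP; apply: (@map_mx_inj _ _ (@ratr R)).
  by rewrite h map_mx0.
have [T [d [uT hT d0]]] := rat_diagonalization symG posG.
have [D1 [Z1 [D10 h1]]] := clear_denominators (invmx T).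
have [D2 [Z2 [D20 h2]]] := clear_denominators T.
have D1R : (D1%:R : R) != 0 by rewrite pnatr_eq0 -lt0n.
pose Q := rm _ _ T *m B; pose P := D1%:R^-1 *: Q.
have QQ : Q *m Q^T = diag_mx (rm _ _ d).
  rewrite /Q trmx_mul mulmxA -[_ *m B *m B^T]mulmxA -hG /rm map_trmx -!map_mxM hT.
  by apply/matrixP => i j; rewrite !mxE rmorphMn.
have rz m k (Z : 'M[int]_(m, k)) : rm _ _ (map_mx intr Z) = map_mx intr Z :> 'M[R]_(m, k).
  by apply/matrixP => i j; rewrite !mxE ratr_int.
exists P, (fun i => ratr (d 0 i) / D1%:R ^+ 2), (D1 * D2)%N; split.
- by rewrite muln_gt0 D10.
- by move=> i; rewrite divr_gt0 ?ltr0q ?exprn_gt0 ?ltr0n.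
- move=> i j; have rP l : row l P = D1%:R^-1 *: row l Q by apply/rowP => k; rewrite !mxE.
  rewrite !rP dotZl dotZr.
  have -> : dot (row i Q) (row j Q) = (Q *m Q^T) i j.
    by rewrite mxE; apply: eq_bigr => k _; rewrite !mxE.
  rewrite QQ !mxE; case: eqP => _; last by rewrite mulr0n !mulr0.
  by rewrite mulr1n; field.
- move=> v; rewrite hB.2 => -[z ->]; exists (z *m Z1).
  have -> : comb P (zc (z *m Z1)) = map_mx intr (z *m Z1) *m P.
    by congr (_ *m _); apply/rowP => i; rewrite mxE [RHS]mxE.
  rewrite map_mxM -(rz _ _ Z1) -h1 /rm /P /Q -scalemxAr.
  rewrite map_mxZ rmorph_nat -scalemxAr -scalemxAl scalerA mulVf// scale1r map_invmx -!mulmxA.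
  by rewrite mulKmx// map_unitmx.
- move=> k; rewrite hB.2; exists (k *m Z2).
  have -> : comb P (zc ((D1 * D2)%N%:Z *: k)) = (D1%:R * D2%:R) *: (map_mx intr k *m P).
    rewrite scalemxAl; congr (_ *m _); apply/rowP => i; rewrite mxE /zc [RHS]mxE !mxE intrM.
    by rewrite -natrM.
  rewrite map_mxM -(rz _ _ Z2) -h2 /rm map_mxZ rmorph_nat /P /Q.
  by rewrite -!scalemxAr scalerA mulrAC divff// mul1r -scalemxAl mulmxA.
Qed.

End OrthogonalSuperlattice.

(** * Theta series at the cusps *)

Section ThetaTransformation.
Context {R : realType}.
Local Notation C := (R[i]).
Local Notation "x %:K" := (x%:C%C : C) (at level 2, format "x %:K").

Lemma cexp_tpi_mod (x y : R) (k : int) : x = y + k%:~R -> cexp (tpi * x%:K) = cexp (tpi * y%:K).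
Proof.
move=> ->; rewrite (rmorphD (real_complex R)) mulrDr cexpD /=.
by rewrite (rmorph_int (real_complex R)) cexp_tpi_int mulr1.
Qed.

Lemma dot0r (k : nat) (v : 'rV[R]_k) : dot v 0 = 0.
Proof. by rewrite -(scale0r (0 : 'rV[R]_k)) dotZr mul0r. Qed.

Definition gauss_sum (u : int) (d : nat) : C :=
  \sum_(x < d) cexp (tpi * (u%:~R * (x : nat)%:R ^+ 2 / d%:R : R)%:K).

Definition tends (S : nat -> C) (s : C) : Prop :=
  forall e : R, 0 < e -> exists N0 : nat, forall l, (N0 <= l)%N -> cabs (S l - s) <= e.

(** Squaring is continuous, so identities known only between squares survive the limit at the
    cusp. *)
Lemma tends_sqr_eq (A B s1 s2 : C) (S1 S2 : nat -> C) : tends S1 s1 -> tends S2 s2 ->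
  (forall l, A * S1 l ^+ 2 = B * S2 l ^+ 2) -> A * s1 ^+ 2 = B * s2 ^+ 2.
Proof.
move=> h1 h2 h; apply/eqP; rewrite -subr_eq0 -cabs_eq0 eq_le cabs_ge0 andbT.
pose M := cabs A * (2 * cabs s1 + 1) + cabs B * (2 * cabs s2 + 1).
have key (D S s : C) (e : R) : 0 < e <= 1 -> cabs (S - s) <= e ->
    cabs (D * S ^+ 2 - D * s ^+ 2) <= cabs D * (2 * cabs s + 1) * e.
  move=> /andP[e0 e1] he.
  have -> : D * S ^+ 2 - D * s ^+ 2 = D * ((S + s) * (S - s)) by ring.
  rewrite [cabs (D * _)]cabsM [cabs (_ * (S - s))]cabsM -[leRHS]mulrA.
  apply: ler_wpM2l; first exact: cabs_ge0.
  apply: ler_pM => //; rewrite ?cabs_ge0//.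
  have -> : S + s = (S - s) + 2 * s by ring.
  apply: le_trans (cabsD _ _) _; rewrite [cabs (2 * s)]cabsM.
  have -> : cabs (2 : C) = 2 by rewrite -(rmorph_nat (real_complex R)) cabs_real normr_nat.
  by rewrite addrC lerD2l (le_trans he).
have M0 : 0 <= M by rewrite addr_ge0// mulr_ge0 ?cabs_ge0// addr_ge0 ?mulr_ge0 ?cabs_ge0.
apply/ler_addgt0Pr => e e0; rewrite add0r.
pose e' := Num.min 1 (e / (M + 1)).
have M1 : 0 < M + 1 by lra.
have e'0 : 0 < e' <= 1 by rewrite lt_min ltr01 divr_gt0//= ge_min lexx.
have [N1 k1] := h1 e' (andP e'0).1; have [N2 k2] := h2 e' (andP e'0).1.
pose l := maxn N1 N2.
have {}k1 := key A _ _ _ e'0 (k1 l (leq_maxl _ _)); have {}k2 := key B _ _ _ e'0 (k2 l (leq_maxr _ _)).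
apply: le_trans (cabs_triangle (A * S1 l ^+ 2) _ _) _.
rewrite {2}(h l) (cabsBC (A * s1 ^+ 2)); apply: le_trans (lerD k1 k2) _.
rewrite -mulrDl -/M; apply: (@le_trans _ _ ((M + 1) * e')); first by rewrite ler_wpM2r ?lerDl// ltW// (andP e'0).1.
by rewrite mulrC -ler_pdivlMr// ge_min lexx orbT.
Qed.

Variables (n : nat) (L : set 'rV[R]_n) (P : 'M[R]_n) (mu : 'I_n -> R) (K : nat).
Hypothesis mu0 : forall i, 0 < mu i.
Hypothesis hP : forall i j, dot (row i P) (row j P) = if i == j then mu i else 0.
Hypothesis K0 : (0 < K)%N.
Hypothesis L0 : L 0.
Hypothesis LD : forall v w, L v -> L w -> L (v + w).
Hypothesis LZ : forall (k : int) v, L v -> L (k%:~R *: v).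
Hypothesis Ln : forall v, L v -> exists k : int, dot v v = k%:~R.
Hypothesis Ld : forall v w, L v -> L w -> exists k : int, 2 * dot v w = k%:~R.
Hypothesis LP : forall v, L v -> exists x, v = comb P (zc x).
Hypothesis PL : forall k : 'rV[int]_n, L (comb P (zc (K%:Z *: k))).

(** [vz] runs over the orthogonal superlattice and [vw] over the dual of [K] times it. Both contain
    [L], so a theta series can be summed over either; Poisson summation passes from the first to the
    second. *)
Definition vz (x : 'rV[int]_n) : 'rV[R]_n := comb P (zc x).
Definition vw (j : 'rV[int]_n) : 'rV[R]_n := comb P (yc mu K j).
Definition indL v : C := (`[< L v >])%:R.

Lemma vzD x y : vz (x + y) = vz x + vz y.
Proof.
rewrite /vz /comb -mulmxDl; congr (_ *m _); apply/rowP => i.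
by rewrite mxE [RHS]mxE !mxE /zc mxE intrD.
Qed.

Lemma vzZ (a : int) x : vz (a *: x) = a%:~R *: vz x.
Proof.
rewrite /vz /comb scalemxAl; congr (_ *m _); apply/rowP => i.
by rewrite mxE [RHS]mxE mxE /zc mxE intrM.
Qed.

Lemma comb_inj (y y' : 'I_n -> R) : comb P y = comb P y' -> y =1 y'.
Proof.
move=> h i; have : dot (row i P) (comb P y) = dot (row i P) (comb P y') by rewrite h.
rewrite !dot_comb (bigD1 i)//= [in RHS](bigD1 i)//= !big1 => [|j ji|j ji]; last 2 first.
- by rewrite hP (negbTE ji) mul0r.
- by rewrite hP (negbTE ji) mul0r.
by rewrite !addr0 hP eqxx => /mulfI; apply; rewrite gt_eqF.
Qed.

Lemma vz_inj : injective vz.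
Proof.
move=> x y /comb_inj h; apply/rowP => i; apply: (@intr_inj R); exact: h i.
Qed.

Lemma vw_inj : injective vw.
Proof.
move=> x y /comb_inj h; apply/rowP => i; apply: (@intr_inj R).
have := h i; rewrite /yc => /mulIf; apply.
by rewrite invr_eq0 gt_eqF// !mulr_gt0 ?ltr0n.
Qed.

Lemma vw_dual k j : 2 * dot (vz (K%:Z *: k)) (vw j) = (\sum_i k 0 i * j 0 i)%:~R.
Proof.
rewrite /vz /vw (comb_comb hP) mulr_sumr rmorph_sum; apply: eq_bigr => i _.
rewrite /zc /yc mxE !rmorphM /=.
have mi : mu i != 0 by rewrite gt_eqF.
have Ki : (K%:R : R) != 0 by rewrite pnatr_eq0 -lt0n.
by field; rewrite mi Ki.
Qed.

Lemma vw_surj v : L v -> exists j, v = vw j.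
Proof.
move=> Lv; have [x hx] := LP Lv.
have /choice[j hj] : forall i, exists k : int, 2 * mu i * K%:R * (x 0 i)%:~R = k%:~R.
  move=> i; have [k hk] := Ld (PL (delta_mx 0 i)) Lv; exists k; rewrite -hk hx (comb_comb hP).
  rewrite (bigD1 i)//= big1 => [|l li]; last by rewrite /zc !mxE (negbTE li) mulr0 mulr0 mul0r.
  by rewrite /zc !mxE !eqxx mulr1 addr0 !mulrA.
exists (\row_i j i); rewrite hx /vw; congr (_ *m _); apply/rowP => i.
rewrite mxE [RHS]mxE /yc mxE -hj /zc.
have mi : mu i != 0 by rewrite gt_eqF.
have Ki : (K%:R : R) != 0 by rewrite pnatr_eq0 -lt0n.
by field; rewrite mi Ki.
Qed.

Lemma indL_add u v : L u -> indL (v + u) = indL v.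
Proof.
move=> Lu; rewrite /indL; congr (nat_of_bool _)%:R; apply/asboolP/asboolP => [h|h]; last exact: LD.
by have := LD h (LZ (-1) Lu); rewrite scaleN1r addrK.
Qed.

Lemma theta_hassum f tau S :
  hassum (fun x => indL (vz x) * (ev (vz x) f)%:K * cexp (tpi * tau * (dot (vz x) (vz x))%:K)) S ->
  theta f L tau = S.
Proof.
move=> h; apply: sum_over_hassum; apply: (hassum_reindex vz_inj).
  move=> y; rewrite /patch; case: ifPn => [|_]; last by rewrite eqxx.
  by rewrite inE => Ly _; exact: LP.
apply: eq_hassum h => x /=; rewrite /patch /indL.
have -> : (vz x \in L) = `[< L (vz x) >] by [].
case: asboolP => _; last by rewrite !mul0r.
rewrite mul1r; congr (_ * _); rewrite /expi2pi; congr cexp.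
rewrite enorm_sqr !(rmorphM (real_complex R)) (rmorph_nat (real_complex R)) /= /tpi.
by ring.
Qed.

Lemma theta_dual f tau S :
  hassum (fun j => indL (vw j) * (ev (vw j) f)%:K * cexp (tpi * tau * (dot (vw j) (vw j))%:K)) S ->
  theta f L tau = S.
Proof.
move=> h; apply: sum_over_hassum; apply: (hassum_reindex vw_inj).
  move=> y; rewrite /patch; case: ifPn => [|_]; last by rewrite eqxx.
  by rewrite inE => Ly _; exact: vw_surj.
apply: eq_hassum h => x /=; rewrite /patch /indL.
have -> : (vw x \in L) = `[< L (vw x) >] by [].
case: asboolP => _; last by rewrite !mul0r.
rewrite mul1r; congr (_ * _); rewrite /expi2pi; congr cexp.
rewrite enorm_sqr !(rmorphM (real_complex R)) (rmorph_nat (real_complex R)) /= /tpi.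
by ring.
Qed.

Lemma ev_scale e (a : R) (v : 'rV[R]_n) (f : mpoly n R) : f \is ishomog1 e mdeg -> ev (a *: v) f = a ^+ e * ev v f.
Proof.
move=> /homog_powsum[s ->]; rewrite !ev_powsum mulr_sumr; apply: eq_bigr => p _.
by rewrite dotZr exprMn mulrCA.
Qed.

(* The exponent of the finite Fourier coefficients at the cusp [a / c]. *)
Definition phase (a : int) (c : nat) (d : int) (v w : 'rV[R]_n) : R :=
  (a%:~R * dot v v + 2 * dot v w + d%:~R * dot w w) / c%:R.

(** The [Phi] of the overview. The indicator has period [K], and on lattice points the phase has
    period [c] along [L], so classes modulo [c * K] suffice ([phase_periodic]). *)
Definition cuspsum (a : int) (c : nat) (d : int) (w : 'rV[R]_n) : C :=
  \sum_(g : box n (c * K)) indL (vz (brow g)) * cexp (tpi * (phase a c d (vz (brow g)) w)%:K).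

Lemma phase_periodic (a : int) (c : nat) (d : int) j x k : (0 < c)%N ->
  indL (vz (x + (c * K)%N%:Z *: k)) * cexp (tpi * (phase a c d (vz (x + (c * K)%N%:Z *: k)) (vw j))%:K) =
  indL (vz x) * cexp (tpi * (phase a c d (vz x) (vw j))%:K).
Proof.
move=> c0; have cR : (c%:R : R) != 0 by rewrite pnatr_eq0 -lt0n.
have -> : (c * K)%N%:Z *: k = c%:Z *: (K%:Z *: k) by rewrite scalerA.
set u := K%:Z *: k; have Lu : L (vz u) by exact: PL.
rewrite vzD vzZ indL_add; last exact: LZ.
rewrite /indL; case: asboolP => [Lx|_]; last by rewrite !mul0r.
congr (_ * _); have [k1 h1] := Ld Lx Lu; have [k2 h2] := Ln Lu.
apply: (@cexp_tpi_mod _ _ (a * k1 + a * c%:Z * k2 + \sum_i k 0 i * j 0 i)).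
rewrite /phase !(dotDl, dotDr, dotZl, dotZr) (dotC (vz u) (vz x)) !intrD !intrM -h1 -h2 -vw_dual -/u.
have -> : (c%:Z)%:~R = c%:R :> R by [].
by field.
Qed.

(** Translation by [u] in [L] permutes the classes modulo [c * K]; the functional equations of
    [cuspsum] come from choosing [u] well. *)
Lemma cuspsum_shift (a : int) (c : nat) (d : int) j (w : 'rV[R]_n) u (de : R) : (0 < c)%N -> L (vz u) ->
  (forall v, L v -> exists k : int, phase a c d (v + vz u) (vw j) = phase a c d v w + de + k%:~R) ->
  cuspsum a c d (vw j) = cexp (tpi * de%:K) * cuspsum a c d w.
Proof.
move=> c0 Lu h; have cK : (0 < c * K)%N by rewrite muln_gt0 c0.
rewrite {1}/cuspsum -(sum_box_shift cK u (F := fun x => indL (vz x) *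
  cexp (tpi * (phase a c d (vz x) (vw j))%:K))) => [|x k]; last exact: phase_periodic.
rewrite /cuspsum mulr_sumr; apply: eq_bigr => g _; rewrite vzD indL_add//.
rewrite /indL; case: asboolP => [Lx|_]; last by rewrite !mul0r mulr0.
rewrite !mul1r -cexpD; have [k hk] := h _ Lx; rewrite (cexp_tpi_mod hk).
by congr cexp; rewrite (rmorphD (real_complex R)) /= mulrDr addrC.
Qed.

Lemma moebius_split (a b : int) (c : nat) (d : int) (tau : C) : (0 < c)%N -> a * d - b * c%:Z = 1 ->
  c%:R * tau + d%:~R != 0 ->
  (a%:~R * tau + b%:~R) / (c%:R * tau + d%:~R) = a%:~R / c%:R - (c%:R * (c%:R * tau + d%:~R))^-1 :> C.
Proof.
move=> c0 hdet J0; have cC : (c%:R : C) != 0 by rewrite pnatr_eq0 -lt0n.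
have hd : a%:~R * d%:~R = 1 + b%:~R * c%:R :> C.
  by rewrite -intrM -(subrK (b * c%:Z) (a * d)) hdet intrD intrM.
apply/eqP; rewrite -subr_eq0; apply/eqP.
transitivity ((1 + b%:~R * c%:R - a%:~R * d%:~R) / (c%:R * (c%:R * tau + d%:~R)) : C).
  by field; rewrite J0 cC.
by rewrite hd subrr mul0r.
Qed.

Lemma Im_automorphy (c : nat) (d : int) (tau : C) :
  complex.Im (c%:R * (c%:R * tau + d%:~R)) = c%:R ^+ 2 * complex.Im tau.
Proof.
by rewrite -(rmorph_nat (real_complex R)) -(rmorph_int (real_complex R)) !ReIm /=; ring.
Qed.

Theorem theta_cusp (a b : int) (c : nat) (d : int) (tau : C) : (0 < c)%N -> a * d - b * c%:Z = 1 ->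
  0 < complex.Im tau ->
  let J := c%:R * tau + d%:~R in
  exists2 r : C, r ^+ 2 = (\prod_i (- 'i%C / (2 * (mu i)%:K * K%:R ^+ 2))) / c%:R ^+ n * J ^+ n &
  forall (m : nat) h, Harm (2 * m) h -> exists S,
    theta h L ((a%:~R * tau + b%:~R) / J) = r * J ^+ (2 * m) * S /\
    hassum (fun j => cuspsum a c d (vw j) * (ev (vw j) h)%:K * cexp (tpi * tau * (dot (vw j) (vw j))%:K)) S.
Proof.
move=> c0 hdet ht J.
have cR : (c%:R : R) != 0 by rewrite pnatr_eq0 -lt0n.
have cC : (c%:R : C) != 0 by rewrite pnatr_eq0 -lt0n.
have KC : (K%:R : C) != 0 by rewrite pnatr_eq0 -lt0n.
have muC i : (mu i)%:K != 0 by rewrite -(rmorph0 (real_complex R)) (inj_eq (@complexI R)) gt_eqF.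
have hIm : 0 < complex.Im (c%:R * J) by rewrite Im_automorphy mulr_gt0 ?exprn_gt0 ?ltr0n.
have J0 : J != 0 by apply: contraTneq hIm => ->; rewrite mulr0 ltxx.
(* By [moebius_split], [g tau = a / c + W]: the rational part goes into the periodic weight [psi],
   and Poisson summation is applied at [W], whose dual parameter is [c J]. *)
pose W := - (c%:R * J)^-1; have hW : 0 < complex.Im W by exact: Im_negV.
have W0 : W != 0 by apply: contraTneq hW => ->; rewrite ltxx.
have VW : - W^-1 = c%:R * J by rewrite /W invrN opprK invrK.
have cK : (0 < c * K)%N by rewrite muln_gt0 c0.
have [r hr hps] := harmonic_poisson mu0 hP cK hW.
exists r.
  rewrite hr -[n in _ / _ ^+ n]card_ord -[n in _ * _ ^+ n]card_ord -!prodr_const -prodf_div -big_split.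
  apply: eq_bigr => i _; rewrite /W natrM /=; field.
  by rewrite J0 KC cC muC.
move=> m h hh; pose psi x := indL (vz x) * cexp (tpi * (a%:~R / c%:R * dot (vz x) (vz x))%:K).
have hpsi x k : psi (x + (c * K)%N%:Z *: k) = psi x.
  have := phase_periodic a 0 0 x k c0; have -> : vw 0 = 0.
    rewrite /vw /comb [X in X *m _](_ : _ = 0) ?mul0mx//.
    by apply/rowP => i; rewrite !mxE /yc mxE mul0r.
  have ph v : phase a c 0 v 0 = a%:~R / c%:R * dot v v.
    by rewrite /phase !dot0r mulr0 mul0r !addr0 mulrAC.
  by rewrite !ph.
have [S0 [h1 h2]] := hps psi (2 * m)%N h hpsi hh.
have J2 : J ^+ (2 * m) * (c%:R ^+ (2 * m) * S0) = W^-1 ^+ (2 * m) * S0.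
  by rewrite mulrA -exprMn [J * _]mulrC -VW exprM sqrrN -exprM.
exists (c%:R ^+ (2 * m) * S0); split.
  apply: theta_hassum.
  have -> : r * J ^+ (2 * m) * (c%:R ^+ (2 * m) * S0) = r * W^-1 ^+ (2 * m) * S0 by rewrite -mulrA J2 mulrA.
  apply: eq_hassum h1 => x; rewrite -(comb_norm hP) -/(vz x) (moebius_split c0 hdet J0) -/J -/W.
  have -> : cexp (tpi * (a%:~R / c%:R + W) * (dot (vz x) (vz x))%:K) =
      cexp (tpi * (a%:~R / c%:R * dot (vz x) (vz x))%:K) * cexp (tpi * W * (dot (vz x) (vz x))%:K).
    rewrite -cexpD; congr cexp; rewrite !(rmorphM (real_complex R)) (fmorphV (real_complex R)).
    by rewrite (rmorph_int (real_complex R)) (rmorph_nat (real_complex R)) /=; ring.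
  by rewrite /psi; ring.
have ycE j : comb P (yc mu (c * K) j) = c%:R^-1 *: vw j.
  rewrite /vw /comb scalemxAl; congr (_ *m _); apply/rowP => i; rewrite mxE [RHS]mxE mxE /yc natrM.
  have mi : mu i != 0 by rewrite gt_eqF.
  have Ki : (K%:R : R) != 0 by rewrite pnatr_eq0 -lt0n.
  by field; rewrite mi Ki cR.
apply: eq_hassum (hassumZ (c%:R ^+ (2 * m)) h2) => j.
rewrite -(comb_norm hP) ycE (ev_scale _ _ hh.1) dotZl dotZr VW.
set X := dot (vw j) (vw j).
have -> : ftcoef (c * K) psi j = \sum_(g : box n (c * K)) indL (vz (brow g)) *
    (cexp (tpi * (a%:~R / c%:R * dot (vz (brow g)) (vz (brow g)))%:K) *
     cexp (tpi * (2 * dot (vz (brow g)) (vw j) / c%:R)%:K)).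
  apply: eq_bigr => g _; rewrite /psi -mulrA; congr (_ * _); congr (_ * _); congr cexp; congr (_ * _).
  rewrite /vz /vw (comb_comb hP) mulr_sumr mulr_suml (rmorph_sum (real_complex R)); apply: eq_bigr => i _ /=.
  transitivity ((j 0 i)%:~R * (brow g 0 i)%:~R / (c * K)%:R : R)%:K.
    by rewrite !(rmorphM (real_complex R)) (fmorphV (real_complex R)) !(rmorph_int (real_complex R)) (rmorph_nat (real_complex R)).
  congr (_%:K); rewrite /yc /zc natrM.
  have mi : mu i != 0 by rewrite gt_eqF.
  have Ki : (K%:R : R) != 0 by rewrite pnatr_eq0 -lt0n.
  by field; rewrite mi Ki cR.
(* At the dual point [w / c] the exponent [c J |w|^2 / c^2] equals [tau |w|^2 + d |w|^2 / c]; the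
   second part completes the phase. *)
have -> : cexp (tpi * (c%:R * J) * (c%:R^-1 * (c%:R^-1 * X))%:K) =
    cexp (tpi * tau * X%:K) * cexp (tpi * (d%:~R / c%:R * X)%:K).
  rewrite -cexpD; congr cexp; rewrite !(rmorphM (real_complex R)) !(fmorphV (real_complex R)).
  by rewrite (rmorph_int (real_complex R)) !(rmorph_nat (real_complex R)) /= /J; field.
have -> : (c%:R^-1 ^+ (2 * m) * ev (vw j) h)%:K = c%:R^-1 ^+ (2 * m) * (ev (vw j) h)%:K.
  by rewrite (rmorphM (real_complex R)) (rmorphXn (real_complex R)) (fmorphV (real_complex R)) (rmorph_nat (real_complex R)).
rewrite /cuspsum !mulr_suml mulr_sumr; apply: eq_bigr => g _.
have -> : cexp (tpi * (phase a c d (vz (brow g)) (vw j))%:K) =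
    cexp (tpi * (a%:~R / c%:R * dot (vz (brow g)) (vz (brow g)))%:K) *
    cexp (tpi * (2 * dot (vz (brow g)) (vw j) / c%:R)%:K) * cexp (tpi * (d%:~R / c%:R * X)%:K).
  rewrite -!cexpD; congr cexp; rewrite -!mulrDr -!(rmorphD (real_complex R)); congr (_ * _%:K).
  by rewrite /phase -/X; field.
have c2 : (c%:R : C) ^+ (2 * m) != 0 by rewrite expf_neq0.
rewrite exprVn; move: (_ ^+ (2 * m)) c2 => c2 c20.
move: (cexp (tpi * (d%:~R / c%:R * X)%:K)) (cexp (tpi * tau * X%:K)) => A1 A2.
move: (cexp _) (cexp _) (indL _) => A3 A4 I.
by field.
Qed.

Lemma vw0 : vw 0 = 0.
Proof.
rewrite /vw /comb [X in X *m _](_ : _ = 0) ?mul0mx//.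
by apply/rowP => i; rewrite !mxE /yc mxE mul0r.
Qed.

Lemma theta_summable (m : nat) h (tau : C) : Harm (2 * m) h -> 0 < complex.Im tau ->
  hassum (fun x => indL (vz x) * (ev (vz x) h)%:K * cexp (tpi * tau * (dot (vz x) (vz x))%:K))
    (theta h L tau).
Proof.
move=> hh ht; have [r _ hps] := harmonic_poisson mu0 hP K0 ht.
have hpsi x k : indL (vz (x + K%:Z *: k)) = indL (vz x).
  by rewrite vzD indL_add//; exact: PL.
have [S [h1 _]] := hps (fun x => indL (vz x)) (2 * m)%N h hpsi hh.
have {}h1 : hassum (fun x => indL (vz x) * (ev (vz x) h)%:K * cexp (tpi * tau * (dot (vz x) (vz x))%:K))
    (r * tau^-1 ^+ (2 * m) * S).
  by apply: eq_hassum h1 => x; rewrite -(comb_norm hP).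
by rewrite (theta_hassum h1).
Qed.

Lemma cabs_cexp_le (tau : C) (y X : R) : y <= complex.Im tau -> 0 <= X ->
  cabs (cexp (tpi * tau * X%:K)) <= cabs (cexp (tpi * ('i%C * y%:K) * X%:K)).
Proof.
move=> hy X0; rewrite !cabs_cexp !Re_tpi_mul ler_expR lerN2.
rewrite !ReIm /= !(mul0r, mul1r, addr0, add0r); apply: ler_wpM2r => //.
by apply: ler_wpM2l => //; rewrite mulr_ge0// pi_ge0.
Qed.

(** The absolutely convergent sum at [tau = i] dominates the sums at all [tau] with imaginary part
    at least 1. *)
Lemma cusp_bounded (a b : int) (c : nat) (d : int) (m : nat) h : (0 < c)%N -> a * d - b * c%:Z = 1 ->
  Harm (2 * m) h -> exists M : R, forall tau S, 1 <= complex.Im tau ->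
  hassum (fun j => cuspsum a c d (vw j) * (ev (vw j) h)%:K * cexp (tpi * tau * (dot (vw j) (vw j))%:K)) S ->
  cabs S <= M.
Proof.
move=> c0 hdet hh; have i1 : 0 < complex.Im ('i%C * (1 : R)%:K) by rewrite !ReIm /= !(mul0r, mul1r, addr0, add0r).
have [r _ /(_ m h hh)[S0 [_ [[M hM] _]]]] := theta_cusp c0 hdet i1.
exists M => tau S ht hS; apply: (hassum_cabs_le hS) => A; apply: le_trans (hM A).
apply: ler_sum => j _; rewrite ![cabs (_ * cexp _)]cabsM; apply: ler_wpM2l; first exact: cabs_ge0.
by apply: cabs_cexp_le => //; exact: dot_ge0.
Qed.

Lemma ev1 (v : 'rV[R]_n) : ev v 1 = 1.
Proof. by rewrite /ev rmorph1. Qed.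

(** Along [i (l + 1)] every term but the one at [w = 0] decays, and the terms at [l = 0] serve as
    majorant. *)
Lemma cusp_limit (a : int) (c : nat) (d : int) (S : nat -> C) :
  (forall l, hassum (fun j => cuspsum a c d (vw j) * (ev (vw j) 1)%:K *
    cexp (tpi * ('i%C * (l.+1%:R : R)%:K) * (dot (vw j) (vw j))%:K)) (S l)) ->
  tends S (cuspsum a c d 0).
Proof.
move=> hS; pose T l j := cuspsum a c d (vw j) * (ev (vw j) 1)%:K *
    cexp (tpi * ('i%C * (l.+1%:R : R)%:K) * (dot (vw j) (vw j))%:K).
pose dl (j : 'rV[int]_n) : C := if j == 0 then cuspsum a c d 0 else 0.
have hdl : hassum dl (cuspsum a c d 0).
  apply: (@hassum_reindex _ unit _ (fun=> 0)); first by case; case.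
    by move=> y; rewrite /dl; case: (y =P 0) => [-> _|_]; [exists tt | rewrite eqxx].
  have := hassum_fin (fun _ : unit => cuspsum a c d 0).
  rewrite big_const /= card_unit /= addr0; apply: eq_hassum => x /=.
  by rewrite /dl eqxx.
apply: (hassum_dominated (f := fun l j => T l j - dl j) (g := fun j => cabs (T 0%N j))) => [||l|j e e0].
- by case: (hS 0%N).
- move=> l j; rewrite /T /dl; case: (j =P 0) => [->|_].
    rewrite vw0 ev1 mulr1 dot0r mulr0 cexp0 mulr1 subrr cabs0; exact: cabs_ge0.
  rewrite subr0 ![cabs (_ * cexp _)]cabsM; apply: ler_wpM2l; first exact: cabs_ge0.
  apply: cabs_cexp_le; last exact: dot_ge0.
  by rewrite !ReIm /= !(mul0r, mul1r, addr0, add0r) ler1n.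
- exact: hassumB (hS l) hdl.
have [->|j0] := eqVneq j 0.
  exists 0%N => l _; rewrite /T /dl eqxx vw0 ev1 mulr1 dot0r mulr0 cexp0 mulr1 subrr cabs0; exact: ltW.
set A := cabs (cuspsum a c d (vw j) * (ev (vw j) 1)%:K); set X := dot (vw j) (vw j).
have X0 : 0 < X.
  rewrite lt_neqAle dot_ge0 andbT eq_sym dot_eq0; apply: contra_neq j0 => h.
  by apply: vw_inj; rewrite h vw0.
have pX : 0 < 2 * pi * X by rewrite !mulr_gt0 ?pi_gt0.
exists (Num.bound (A / e / (2 * pi * X))) => l hl.
rewrite /T /dl (negbTE j0) subr0 [cabs (_ * cexp _)]cabsM -/A -/X cabs_cexp Re_tpi_mul.
rewrite !ReIm /= !(mul0r, mul1r, addr0, add0r) expRN.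
rewrite ler_pdivrMr ?expR_gt0//; apply: (@le_trans _ _ (e * (2 * pi * l.+1%:R * X))); last first.
  by apply: ler_wpM2l; [exact: ltW | apply: le_trans (expR_ge1Dx _); rewrite lerDr].
have A0 : 0 <= A / e / (2 * pi * X).
  by rewrite !mulr_ge0 ?cabs_ge0 ?invr_ge0 ?ltW.
have : A / e / (2 * pi * X) < l.+1%:R.
  by apply: lt_le_trans (archi_boundP A0) _; rewrite ler_nat ltnW.
rewrite !ltr_pdivrMr// => h; apply: (le_trans (ltW h)).
by rewrite le_eqVlt; apply/orP; left; apply/eqP; ring.
Qed.

Definition cusp0 (a : int) (c : nat) : C := cuspsum a c 0 0.

Lemma cuspsum0 (a : int) (c : nat) (d : int) : cuspsum a c d 0 = cusp0 a c.
Proof.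
apply: eq_bigr => g _; congr (_ * cexp (_ * _)).
by rewrite /phase !dot0r !mulr0 !addr0.
Qed.

Lemma cusp0_box (a : int) (c : nat) : cusp0 a c = \sum_(g : box n (c * K)) indL (vz (brow g)) *
  cexp (tpi * (a%:~R * dot (vz (brow g)) (vz (brow g)) / c%:R)%:K).
Proof.
apply: eq_bigr => g _; congr (_ * cexp (_ * _)).
by rewrite /phase !dot0r !mulr0 !addr0.
Qed.

(** This value counts the lattice points in a box, and the box contains 0. *)
Lemma cusp01_neq0 : cusp0 0 1 != 0.
Proof.
rewrite cusp0_box; have e1 (g : box n (1 * K)) : indL (vz (brow g)) *
    cexp (tpi * (0%:~R * dot (vz (brow g)) (vz (brow g)) / 1%:R)%:K) = (`[< L (vz (brow g)) >] : nat)%:R.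
  by rewrite mul0r mul0r mulr0 cexp0 mulr1.
rewrite (eq_bigr _ (fun g _ => e1 g)) -natr_sum pnatr_eq0.
have cK : (0 < 1 * K)%N by rewrite mul1n.
rewrite (bigD1 (boxof cK 0))//= addn_eq0 negb_and; apply/orP; left.
suff -> : brow (boxof cK (0 : 'rV[int]_n)) = 0.
  rewrite (_ : vz 0 = 0); first by case: asboolP.
  by have := vzZ 0 0; rewrite scale0r => ->; rewrite scale0r.
by apply/rowP => i; rewrite mxE boxofE !mxE mod0z.
Qed.

(** Chinese remainder theorem: [x = d y + K z] with [y] modulo [K] and [z] modulo [d]. Membership in
    [L] depends only on [y] and the phase only on [z], where the form is diagonal and splits into
    one-variable sums. *)
Lemma cusp0_gauss (b : int) (d : nat) (k : 'I_n -> int) : (0 < d)%N -> coprime d K ->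
  (forall i, K%:R ^+ 2 * mu i = (k i)%:~R) ->
  cusp0 b d = cusp0 0 1 * \prod_i gauss_sum (b * k i) d.
Proof.
move=> d0 co hk; have dK : (0 < d * K)%N by rewrite muln_gt0 d0.
have dR : (d%:R : R) != 0 by rewrite pnatr_eq0 -lt0n.
pose F x := indL (vz x) * cexp (tpi * (b%:~R * dot (vz x) (vz x) / d%:R)%:K).
have Fper x w : F (x + (d * K)%N%:Z *: w) = F x.
  have := phase_periodic b 0 0 x w d0; rewrite vw0 /F.
  have ph v : phase b d 0 v 0 = b%:~R * dot v v / d%:R by rewrite /phase !dot0r mulr0 mul0r !addr0.
  by rewrite !ph.
pose phi (p : box n K * box n d) : box n (d * K) := boxof dK (d%:Z *: brow p.1 + K%:Z *: brow p.2).
have injphi : injective phi.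
  have aux (q r : nat) (x x' : 'I_q) (z : int) : (0 < q)%N -> coprime r q ->
      r%:Z * (x : nat)%:Z - r%:Z * (x' : nat)%:Z = q%:Z * z -> x = x'.
    move=> q0 crq h; apply/val_inj => /=.
    have : (q%:Z %| r%:Z * ((x : nat)%:Z - (x' : nat)%:Z))%Z by apply/dvdzP; exists z; rewrite mulrBr h mulrC.
    rewrite Gauss_dvdzr; last by rewrite coprimez_sym /coprimez /gcdz /= eqz_nat.
    have := ltn_ord x; have := ltn_ord x'; move: (x : nat) (x' : nat) => X X' hX' hX /dvdzP[w0 hw].
    move: (w0 : int) hw => w hw; have {w0} : w <= -1 \/ w = 0 \/ 1 <= w by lia.
    by case=> [|[|]] hw1; nia.
  have arith (D E y z w y' z' w' : int) : D * y + E * z - D * E * w = D * y' + E * z' - D * E * w' ->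
      D * y - D * y' = E * (z' - z + D * (w - w')).
    move=> e; have -> : D * y = (D * y + E * z - D * E * w) - E * z + D * E * w by ring.
    by rewrite e; ring.
  move=> [y z] [y' z'] e.
  have [w1 e1] := boxof_decomp dK (d%:Z *: brow y + K%:Z *: brow z).
  have [w2 e2] := boxof_decomp dK (d%:Z *: brow y' + K%:Z *: brow z').
  have {e} : d%:Z *: brow y + K%:Z *: brow z - (d * K)%N%:Z *: w1 = d%:Z *: brow y' + K%:Z *: brow z' - (d * K)%N%:Z *: w2.
    rewrite [X in X - _]e1 [X in _ = X - _]e2 !addrK; congr brow; exact: e.
  move=> e; have ei i : d%:Z * (y i : nat)%:Z + K%:Z * (z i : nat)%:Z - d%:Z * K%:Z * w1 0 i =
      d%:Z * (y' i : nat)%:Z + K%:Z * (z' i : nat)%:Z - d%:Z * K%:Z * w2 0 i.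
    by move/rowP : e => /(_ i); rewrite !mxE PoszM.
  congr pair; apply/ffunP => i; have := ei i => eq.
    apply: (aux K d _ _ ((z' i : nat)%:Z - (z i : nat)%:Z + d%:Z * (w1 0 i - w2 0 i))) => //.
    exact: arith eq.
  apply: (aux d K _ _ ((y' i : nat)%:Z - (y i : nat)%:Z + K%:Z * (w1 0 i - w2 0 i))) => //.
    by rewrite coprime_sym.
  apply: (arith _ _ _ _ (w1 0 i) _ _ (w2 0 i)).
  by rewrite [X in X - _]addrC [X in _ = X - _]addrC [K%:Z * d%:Z]mulrC; exact: eq.
have bijphi : bijective phi.
  apply: inj_card_bij injphi _.
  by rewrite card_prod !card_ffun !card_ord expnMn mulnC.
have hF p : F (brow (phi p)) = indL (vz (brow p.1)) *
    \prod_i cexp (tpi * ((b * k i)%:~R * (p.2 i : nat)%:R ^+ 2 / d%:R : R)%:K).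
  have [w hw] := boxof_decomp dK (d%:Z *: brow p.1 + K%:Z *: brow p.2).
  transitivity (F (d%:Z *: brow p.1 + K%:Z *: brow p.2)).
    by rewrite [in RHS]hw Fper.
  rewrite /F vzD; set u := vz (K%:Z *: _); have Lu : L u by exact: PL.
  rewrite indL_add// vzZ; set v := vz (brow p.1).
  (* Here [K v] lies in [L] and [d] is invertible modulo [K]. *)
  have LL : L (d%:Z%:~R *: v) <-> L v.
    split=> [h|]; last exact: LZ.
    have LK : L (K%:Z%:~R *: v) by rewrite /v -vzZ; exact: PL.
    have [[p' q'] /= hpq] : exists z : int * int, z.1 * d%:Z + z.2 * K%:Z = 1.
      have /coprimezP[[p' q'] h'] : coprimez d%:Z K%:Z by rewrite /coprimez /gcdz /= eqz_nat.
      by exists (p', q').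
    have := LD (LZ p' h) (LZ q' LK).
    by rewrite !scalerA -scalerDl -!intrM -intrD hpq scale1r.
  rewrite /indL; case: asboolP => [/LL Lv|nL]; last first.
    by case: asboolP => [/LL//|_]; rewrite !mul0r.
  case: asboolP => // _; rewrite !mul1r -cexp_sum.
  have [k1 h1] := Ln Lv; have [k2 h2] := Ld Lv Lu.
  rewrite (@cexp_tpi_mod _ (b%:~R * dot u u / d%:R) (b * d%:Z * k1 + b * k2)); last first.
    rewrite !(dotDl, dotDr, dotZl, dotZr) (dotC u v) intrD !intrM -h1 -h2.
    have -> : (d%:Z)%:~R = d%:R :> R by [].
    by field.
  congr cexp; rewrite -mulr_sumr -(rmorph_sum (real_complex R)); congr (_ * _%:K).
  rewrite /u /vz (comb_comb hP) mulr_sumr mulr_suml; apply: eq_bigr => i _.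
  rewrite intrM -hk /zc !mxE intrM.
  have -> : (K%:Z)%:~R = K%:R :> R by [].
  have -> : ((p.2 i : nat)%:Z)%:~R = (p.2 i : nat)%:R :> R by [].
  by ring.
rewrite !cusp0_box (reindex phi); last exact: onW_bij.
rewrite (eq_bigr _ (fun p _ => hF p)) -(pair_bigA _ (fun (y : box n K) (z : box n d) => indL (vz (brow y)) *
  \prod_i cexp (tpi * ((b * k i)%:~R * (z i : nat)%:R ^+ 2 / d%:R : R)%:K))) /=.
have -> : \sum_(g : box n (1 * K)) indL (vz (brow g)) * cexp (tpi * (0%:~R * dot (vz (brow g)) (vz (brow g)) / 1%:R)%:K)
    = \sum_(g : box n K) indL (vz (brow g)).
  rewrite mul1n; apply: eq_bigr => g _.
  by rewrite mul0r mul0r mulr0 cexp0 mulr1.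
rewrite mulr_suml; apply: eq_bigr => y _; rewrite -mulr_sumr; congr (_ * _).
by rewrite /gauss_sum bigA_distr_bigA.
Qed.

Definition cusp_const : C := \prod_i (- 'i%C / (2 * (mu i)%:K * K%:R ^+ 2)).

Lemma cusp_const_neq0 : cusp_const != 0.
Proof.
apply/prodf_neq0 => i _; rewrite mulf_neq0 ?oppr_eq0 ?ci_neq0// invr_eq0 !mulf_neq0 ?pnatr_eq0//.
  by rewrite -(rmorph0 (real_complex R)) (inj_eq (@complexI R)) gt_eqF.
all: by rewrite -lt0n.
Qed.

Definition multiplier (a : int) (c : nat) : C := cusp_const / c%:R ^+ n * cusp0 a c ^+ 2.

Lemma Harm1 : Harm (2 * 0) (1 : mpoly n R).
Proof.
split; first by rewrite muln0; exact: dhomog1.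
by apply: big1 => i _; rewrite -mpolyC1 mderivC mderiv0.
Qed.

Lemma theta_period (m : nat) h (tau : C) (k : int) : Harm (2 * m) h -> 0 < complex.Im tau ->
  theta h L (tau + k%:~R) = theta h L tau.
Proof.
move=> hh ht; apply: theta_hassum; apply: eq_hassum (theta_summable hh ht) => x.
rewrite /indL; case: asboolP => [Lx|_]; last by rewrite !mul0r.
congr (_ * _); rewrite mulrDr mulrDl cexpD; have [l ->] := Ln Lx.
by rewrite (rmorph_int (real_complex R)) -[tpi * k%:~R * _]mulrA -intrM cexp_tpi_int mulr1.
Qed.

(** Needed to cancel the theta square between two transformation formulas. At [- 1 / t] with [t]
    high on the imaginary axis, the square is a nonzero factor times the square of a quantity close
    to [cusp0 0 1]. *)
Lemma theta1_neq0 : exists2 tau : C, 0 < complex.Im tau & theta 1 L tau != 0.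
Proof.
pose t l : C := 'i%C * (l.+1%:R : R)%:K.
have t0 l : 0 < complex.Im (t l) by rewrite !ReIm /= !(mul0r, mul1r, addr0, add0r) ltr0n.
have tn l : t l != 0 by apply: contraTneq (t0 l) => ->; rewrite ltxx.
have det2 : 0 * 0 - (-1) * 1%N%:Z = 1 :> int by [].
have /choice[S2 hS2] : forall l, exists S : C,
    theta 1 L ((0%:~R * t l + (-1)%:~R) / (1%:R * t l + 0%:~R)) ^+ 2 =
      cusp_const / 1%:R ^+ n * (1%:R * t l + 0%:~R) ^+ n * S ^+ 2 /\
    hassum (fun j => cuspsum 0 1 0 (vw j) * (ev (vw j) 1)%:K * cexp (tpi * t l * (dot (vw j) (vw j))%:K)) S.
  move=> l; have [r hr /(_ 0%N _ Harm1)[S [h1 h2]]] := theta_cusp (ltn0Sn 0) det2 (t0 l).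
  by exists S; split => //; rewrite h1 expr0 mulr1 exprMn hr.
have lim : tends S2 (cusp0 0 1) by rewrite -(cuspsum0 0 1 0); apply: cusp_limit => l; exact: (hS2 l).2.
have c0 : 0 < cabs (cusp0 0 1) by rewrite lt_neqAle cabs_ge0 andbT eq_sym cabs_eq0 cusp01_neq0.
have [l0 /(_ l0 (leqnn _)) hl] := lim (cabs (cusp0 0 1) / 2) (divr_gt0 c0 (ltr0Sn R 1)).
have S0 : S2 l0 != 0.
  by apply: contraTneq hl => ->; rewrite sub0r cabsN -ltNge; lra.
exists (- (t l0)^-1); first exact: Im_negV.
have [h _] := hS2 l0; move: h; rewrite mul0r add0r mul1r addr0 mulrNz mulN1r => h.
rewrite -sqrf_eq0 h !mulf_neq0 ?expf_neq0 ?cusp_const_neq0//.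
Qed.

(** * Transformation under the group of level N *)

Section Level.
(** [u] is a basis of the dual of [L] for the pairing [2 <v, w>]; [hu3] and [hu4] express that
    [N A^-1] is integral with even diagonal. *)
Variables (N : nat) (u : 'I_n -> 'rV[R]_n).
Hypothesis hu1 : forall i v, L v -> exists k : int, 2 * dot (u i) v = k%:~R.
Hypothesis hu2 : forall w, (forall i, exists k : int, 2 * dot (u i) w = k%:~R) -> L w.
Hypothesis hu3 : forall i, L (N%:R *: u i).
Hypothesis hu4 : forall i, exists k : int, N%:R * dot (u i) (u i) = k%:~R.

(** Translation by [c u_i], which lies in [L] because [N] divides [c], multiplies the sum by the
    character value of [2 <u_i, w>]. A nonzero sum forces this to be 1 for every [i], so [w] lies in
    the bidual [L]. *)
Lemma cuspsum_support (a : int) (c : nat) (d : int) j : (0 < c)%N -> (N %| c)%N ->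
  cuspsum a c d (vw j) != 0 -> L (vw j).
Proof.
move=> c0 /dvdnP[c1 hc] nz; apply: hu2 => i.
have cR : (c%:R : R) != 0 by rewrite pnatr_eq0 -lt0n.
have Lcu : L (c%:R *: u i).
  by have := LZ c1%:Z (hu3 i); rewrite scalerA hc natrM.
have [x hx] := LP Lcu.
apply: cexp_tpi_eq1; apply: (mulIf nz); rewrite mul1r; apply/esym.
apply: (cuspsum_shift (u := x)) => //; first by rewrite /vz -hx.
move=> v Lv; have [k1 h1] := hu1 i Lv; have [k2 h2] := hu4 i.
exists (a * k1 + a * c1%:Z * k2); rewrite /vz -hx /phase !(dotDl, dotDr, dotZl, dotZr) (dotC v (u i)).
rewrite !intrD !intrM -h1 -h2.
rewrite -[X in _ = _ + (_ + X)]mulrA (_ : c1%:~R * (N%:R * dot (u i) (u i)) = c%:R * dot (u i) (u i)).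
  by field.
by rewrite hc natrM mulrA.
Qed.

(** Translation by [- d w], together with [a d = 1 + b c], removes [w] from the phase modulo 1. *)
Lemma cuspsum_lattice (a b : int) (c : nat) (d : int) j : (0 < c)%N -> a * d - b * c%:Z = 1 ->
  L (vw j) -> cuspsum a c d (vw j) = cusp0 a c.
Proof.
move=> c0 hdet Lw; have cR : (c%:R : R) != 0 by rewrite pnatr_eq0 -lt0n.
have [x hx] := LP Lw; rewrite -(cuspsum0 a c d).
have -> : cuspsum a c d 0 = cexp (tpi * 0%:K) * cuspsum a c d 0 by rewrite mulr0 cexp0 mul1r.
apply: (cuspsum_shift (u := (- d) *: x)) => //.
  by rewrite vzZ /vz -hx; exact: LZ.
move=> v Lv; have [k1 h1] := Ld Lv Lw; have [k2 h2] := Ln Lw.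
exists (- b * k1 + d * b * k2); rewrite vzZ [vz x](_ : _ = vw j) //.
have hd : a%:~R * d%:~R = 1 + b%:~R * c%:R :> R.
  by rewrite -intrM -(subrK (b * c%:Z) (a * d)) hdet intrD intrM.
rewrite /phase !dot0r !(dotDl, dotDr, dotZl, dotZr) (dotC (vw j) v) !intrD !intrM -h1 -h2 !mulrNz.
apply/eqP; rewrite -subr_eq0; apply/eqP.
transitivity ((1 + b%:~R * c%:R - a%:~R * d%:~R) * (2 * dot v (vw j) - d%:~R * dot (vw j) (vw j)) / c%:R).
  by field.
by rewrite hd subrr !mul0r.
Qed.

Lemma theta_gamma0 (a b : int) (c : nat) (d : int) (tau : C) (m : nat) h : (0 < c)%N -> (N %| c)%N ->
  a * d - b * c%:Z = 1 -> 0 < complex.Im tau -> Harm (2 * m) h ->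
  theta h L ((a%:~R * tau + b%:~R) / (c%:R * tau + d%:~R)) ^+ 2 =
  multiplier a c * (c%:R * tau + d%:~R) ^+ (4 * m + n) * theta h L tau ^+ 2.
Proof.
move=> c0 Nc hdet ht hh; have [r hr /(_ m h hh)[S [hS1 hS2]]] := theta_cusp c0 hdet ht.
set J := c%:R * tau + d%:~R in hr hS1 *.
have ind j : cuspsum a c d (vw j) = cusp0 a c * indL (vw j).
  rewrite /indL; case: asboolP => [Lw|nL]; first by rewrite mulr1 (cuspsum_lattice c0 hdet).
  by rewrite mulr0; apply/eqP; apply: contra_notT nL; exact: cuspsum_support.
have -> : theta h L ((a%:~R * tau + b%:~R) / J) = r * J ^+ (2 * m) * (cusp0 a c * theta h L tau).
  (* The theta series is recovered from [S] by dividing by [cusp0 a c], so the case where this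
     constant vanishes is separate. *)
  rewrite hS1; congr (_ * _); have [z|nz] := eqVneq (cusp0 a c) 0.
    rewrite z mul0r; apply: hassum_unique hS2 _; apply: eq_hassum (hassum0 _) => j.
    by rewrite ind z !mul0r.
  have := hassumZ (cusp0 a c)^-1 hS2 => hS3.
  rewrite (theta_dual (S := (cusp0 a c)^-1 * S)); first by rewrite mulVKf.
  by apply: eq_hassum hS3 => j; rewrite ind !mulrA mulVf// mul1r.
rewrite !exprMn hr -/cusp_const -exprM /multiplier.
have -> : J ^+ (4 * m + n) = J ^+ (2 * m * 2) * J ^+ n by rewrite -exprD; congr (_ ^+ (_ + _)); lia.
by ring.
Qed.

(** The gain is a change of modulus: the sum modulo [c], which shares factors with the level, is
    traded for a sum modulo [d], which is prime to [c]. The bottom row of [g S] is [(d, - c)], and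
    the constant [cusp_const] is the same on both sides and cancels. *)
Lemma multiplier_dual (a b : int) (c d : nat) : (0 < c)%N -> (0 < d)%N -> (N %| c)%N ->
  a * d%:Z - b * c%:Z = 1 -> multiplier a c * cusp0 0 1 ^+ 2 = cusp0 b d ^+ 2 / d%:R ^+ n.
Proof.
move=> c0 d0 Nc hdet; pose t l : C := 'i%C * (l.+1%:R : R)%:K.
have t0 l : 0 < complex.Im (t l) by rewrite !ReIm /= !(mul0r, mul1r, addr0, add0r) ltr0n.
have tn l : t l != 0 by apply: contraTneq (t0 l) => ->; rewrite ltxx.
have det1 : b * (- c%:Z) - (- a) * d%:Z = 1 by rewrite -hdet; ring.
have det2 : 0 * 0 - (-1) * 1%N%:Z = 1 :> int by [].
have /choice[S1 hS1] : forall l, exists S : C,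
    theta 1 L ((b%:~R * t l + (- a)%:~R) / (d%:R * t l + (- c%:Z)%:~R)) ^+ 2 =
      cusp_const / d%:R ^+ n * (d%:R * t l + (- c%:Z)%:~R) ^+ n * S ^+ 2 /\
    hassum (fun j => cuspsum b d (- c%:Z) (vw j) * (ev (vw j) 1)%:K * cexp (tpi * t l * (dot (vw j) (vw j))%:K)) S.
  move=> l; have [r hr /(_ 0%N _ Harm1)[S [h1 h2]]] := theta_cusp d0 det1 (t0 l).
  by exists S; split => //; rewrite h1 expr0 mulr1 exprMn hr.
have /choice[S2 hS2] : forall l, exists S : C,
    theta 1 L ((0%:~R * t l + (-1)%:~R) / (1%:R * t l + 0%:~R)) ^+ 2 =
      cusp_const / 1%:R ^+ n * (1%:R * t l + 0%:~R) ^+ n * S ^+ 2 /\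
    hassum (fun j => cuspsum 0 1 0 (vw j) * (ev (vw j) 1)%:K * cexp (tpi * t l * (dot (vw j) (vw j))%:K)) S.
  move=> l; have [r hr /(_ 0%N _ Harm1)[S [h1 h2]]] := theta_cusp (ltn0Sn 0) det2 (t0 l).
  by exists S; split => //; rewrite h1 expr0 mulr1 exprMn hr.
rewrite [RHS]mulrC; apply/esym; apply: (@tends_sqr_eq _ _ _ _ S1 S2).
- by rewrite -(cuspsum0 b d (- c%:Z)); apply: cusp_limit => l; exact: (hS1 l).2.
- by rewrite -(cuspsum0 0 1 0); apply: cusp_limit => l; exact: (hS2 l).2.
move=> l; have [h1 _] := hS1 l; have [h2 _] := hS2 l.
set J1 := d%:R * t l + (- c%:Z)%:~R in h1.
have J10 : J1 != 0.
  have : 0 < complex.Im J1.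
    rewrite /J1 -(rmorph_nat (real_complex R)) -(rmorph_int (real_complex R)) !ReIm /=.
    by rewrite !(mul0r, mul1r, addr0, add0r) mulr_gt0 ?ltr0n.
  by apply: contraTneq => ->; rewrite ltxx.
pose t2 : C := - (t l)^-1.
have et2 : (0%:~R * t l + (-1)%:~R) / (1%:R * t l + 0%:~R) = t2.
  by rewrite mul0r add0r mul1r addr0 mulrNz mulN1r.
have ht2 : 0 < complex.Im t2 by exact: Im_negV.
have dJ : c%:R * t2 + d%:~R = J1 / t l.
  by rewrite /t2 /J1 mulrNz; move: (tn l); move: (t l) => z z0; field.
have eg : (a%:~R * t2 + b%:~R) / (c%:R * t2 + d%:~R) = (b%:~R * t l + (- a)%:~R) / J1.
  have gen (z J A B : C) : z != 0 -> J != 0 -> (A * - z^-1 + B) / (J / z) = (B * z - A) / J.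
    by move=> z0 J0; field; rewrite z0 J0.
  by rewrite dJ mulrNz; exact: gen.
have := theta_gamma0 (b := b) c0 Nc hdet ht2 Harm1.
rewrite eg h1 -et2 h2 et2 dJ muln0 add0n mul1r addr0 expr1n divr1 => h.
have cd : (d%:R : C) ^+ n != 0 by rewrite expf_neq0// pnatr_eq0 -lt0n.
have Jn : J1 ^+ n != 0 by rewrite expf_neq0.
have tln : t l ^+ n != 0 by rewrite expf_neq0.
have cc := cusp_const_neq0.
move: h; rewrite expr_div_n; move: (J1 ^+ n) (t l ^+ n) (d%:R ^+ n) cusp_const (multiplier a c) Jn tln cd cc => J T D c1 mm J0 T0 D0 c10.
move: (S1 l ^+ 2) (S2 l ^+ 2) => s1 s2 h; apply: (mulfI (mulf_neq0 c10 J0)).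
transitivity (c1 / D * J * s1); first by field.
by rewrite h; field.
Qed.

Lemma multiplier_gauss (a b : int) (c d : nat) (k : 'I_n -> int) : (0 < c)%N -> (0 < d)%N -> (N %| c)%N ->
  a * d%:Z - b * c%:Z = 1 -> coprime d K -> (forall i, K%:R ^+ 2 * mu i = (k i)%:~R) ->
  multiplier a c = \prod_i (gauss_sum (b * k i) d ^+ 2 / d%:R).
Proof.
move=> c0 d0 Nc hdet co hk; have := multiplier_dual c0 d0 Nc hdet.
rewrite (cusp0_gauss b d0 co hk) exprMn.
have c1 : cusp0 0 1 ^+ 2 != 0 by rewrite expf_neq0 ?cusp01_neq0.
move=> h; transitivity ((\prod_i gauss_sum (b * k i) d) ^+ 2 / d%:R ^+ n).
  by apply: (mulIf c1); rewrite h; ring.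
rewrite -prodrXl -[n in _ / _ ^+ n]card_ord -prodr_const -prodf_div.
by [].
Qed.

End Level.

End ThetaTransformation.

(** * Quadratic Gauss sums *)

(** The nontrivial Dirichlet character modulo 4. *)
Definition chi4 (d : int) : int :=
  if (d %% 4 == 1)%Z then 1 else if (d %% 4 == 3)%Z then -1 else 0.

Lemma chi4_mod (a b k : int) : a = b + 4 * k -> chi4 a = chi4 b.
Proof. by move=> ->; rewrite /chi4 [b + _]addrC [4 * k]mulrC modzMDl. Qed.

Lemma chi4M (a b : int) : chi4 (a * b) = chi4 a * chi4 b.
Proof.
have key (x : int) : exists k r : int, x = r + 4 * k /\ (r = 0 \/ r = 1 \/ r = 2 \/ r = 3).
  by exists (x %/ 4)%Z, (x %% 4)%Z; split; lia.
have [k [r [-> hr]]] := key a; have [k' [r' [-> hr']]] := key b.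
rewrite (@chi4_mod _ (r * r') (k * r' + r * k' + 4 * k * k')); last by ring.
rewrite (@chi4_mod (r + _) r k)// (@chi4_mod (r' + _) r' k')//.
by case: hr => [|[|[|]]] ->; case: hr' => [|[|[|]]] ->.
Qed.

Lemma chi4_odd (d : int) : (d %% 2 = 1)%Z -> chi4 d ^+ 2 = 1.
Proof.
move=> h; rewrite /chi4; case: eqP => [_|h1]; first by rewrite expr1n.
by case: eqP => [_|h3]; [rewrite sqrrN expr1n | exfalso; lia].
Qed.

Section JacobiTheta.
Context {R : realType}.
Local Notation C := (R[i]).
Local Notation "x %:K" := (x%:C%C : C) (at level 2, format "x %:K").

Let P : 'M[R]_1 := 1%:M.
Let mu : 'I_1 -> R := fun=> 1.
Let L : set 'rV[R]_1 := [set v | exists x : 'rV[int]_1, v = comb P (zc x)].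

Let mu0 i : 0 < mu i. Proof. exact: ltr01. Qed.
Let hP i j : dot (row i P) (row j P) = if i == j then mu i else 0.
Proof. by rewrite !ord1 eqxx /dot big_ord1 !mxE eqxx mulr1. Qed.
Let vE x : vz P x = comb P (zc x). Proof. by []. Qed.
Let L0 : L 0. Proof. by exists 0; rewrite -vE; have := vzZ P 0 0; rewrite !scale0r. Qed.
Let LD v w : L v -> L w -> L (v + w).
Proof. by case=> x -> [y ->]; exists (x + y); rewrite -!vE vzD. Qed.
Let LZ (k : int) v : L v -> L (k%:~R *: v).
Proof. by case=> x ->; exists (k *: x); rewrite -!vE vzZ. Qed.
Let dotE x y : dot (comb P (zc x)) (comb P (zc y)) = (x 0 0 * y 0 0)%:~R.
Proof. by rewrite (comb_comb hP) big_ord1 /mu mul1r /zc intrM. Qed.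
Let Ln v : L v -> exists k : int, dot v v = k%:~R.
Proof. by case=> x ->; rewrite dotE; eexists. Qed.
Let Ld v w : L v -> L w -> exists k : int, 2 * dot v w = k%:~R.
Proof. by case=> x -> [y ->]; rewrite dotE; exists (2 * (x 0 0 * y 0 0)); rewrite [RHS]intrM. Qed.
Let LP v : L v -> exists x, v = comb P (zc x). Proof. by []. Qed.
Let PL (k : 'rV[int]_1) : L (comb P (zc (1%N%:Z *: k))). Proof. by eexists. Qed.

Let one : 'rV[int]_1 := \row_i 1.
(** The integers have dual basis [1/2] for the pairing [2 x y], whence level 4. *)
Let u (i : 'I_1) : 'rV[R]_1 := 2^-1 *: comb P (zc one).
Let dot_one (w : 'rV[R]_1) : dot (comb P (zc one)) w = w 0 0.
Proof.
by rewrite /comb /P mulmx1 /dot big_ord1 mxE /zc mxE mul1r.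
Qed.
Let combE (w : 'rV[R]_1) (k : int) : w 0 0 = k%:~R -> w = comb P (zc (\row_i k)).
Proof. by move=> h; apply/rowP => i; rewrite /comb /P mulmx1 !ord1 h mxE /zc mxE. Qed.
Let half (x : R) : 2 * (2^-1 * x) = x. Proof. by rewrite mulrA divff ?mul1r// pnatr_eq0. Qed.
Let hu1 i v : L v -> exists k : int, 2 * dot (u i) v = k%:~R.
Proof.
by case=> x ->; exists (x 0 0); rewrite /u dotZl half dotE mxE mul1r.
Qed.
Let hu2 w : (forall i, exists k : int, 2 * dot (u i) w = k%:~R) -> L w.
Proof. by move=> /(_ 0)[k]; rewrite /u dotZl half dot_one => /combE ->; eexists. Qed.
Let hu3 i : L (4%:R *: u i).
Proof.
exists (2 *: one); rewrite -vE vzZ /u scalerA; congr (_ *: _).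
by rewrite (natrM R 2 2) mulfK// pnatr_eq0.
Qed.
Let hu4 i : exists k : int, 4%:R * dot (u i) (u i) = k%:~R.
Proof. by exists 1; rewrite /u dotZl dotZr dotE !mxE mulr1; field. Qed.

Local Notation th := (theta (1 : mpoly 1 R) L).
Local Notation lam := (multiplier L P mu 1).

Lemma jacobi_gamma0 (a b : int) (c : nat) (d : int) (tau : C) : (0 < c)%N -> (4 %| c)%N ->
  a * d - b * c%:Z = 1 -> 0 < complex.Im tau ->
  th ((a%:~R * tau + b%:~R) / (c%:R * tau + d%:~R)) ^+ 2 = lam a c * (c%:R * tau + d%:~R) * th tau ^+ 2.
Proof.
move=> c0 c4 hdet ht.
have := theta_gamma0 mu0 hP (ltn0Sn 0) LD LZ Ln Ld LP PL hu1 hu2 hu3 hu4 c0 c4 hdet ht (@Harm1 R 1).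
by rewrite muln0 add0n expr1.
Qed.

Lemma jacobi_multiplier (a b : int) (c d : nat) : (0 < c)%N -> (0 < d)%N -> (4 %| c)%N ->
  a * d%:Z - b * c%:Z = 1 -> lam a c = gauss_sum b d ^+ 2 / d%:R.
Proof.
move=> c0 d0 c4 hdet.
have := multiplier_gauss mu0 hP (ltn0Sn 0) L0 LD LZ Ln Ld LP PL hu1 hu2 hu3 hu4 (k := fun=> 1) c0 d0 c4 hdet (coprimen1 d).
by rewrite big_ord1 mulr1; apply=> i; rewrite expr1n mulr1.
Qed.

Let th_period (tau : C) (k : int) : 0 < complex.Im tau -> th (tau + k%:~R) = th tau.
Proof. exact: (theta_period mu0 hP (ltn0Sn 0) LD LZ Ln LP PL k (@Harm1 R 1)). Qed.

Lemma lam14 : lam 1 4 = 1.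
Proof.
rewrite (jacobi_multiplier (b := 0) (d := 1))// /gauss_sum big_ord1.
by rewrite !mul0r mulr0 cexp0 expr1n divr1.
Qed.

(** The matrices with rows [(1, 0)] and [(4 s, 1)]. The case [s = -1] follows from [s = 1] applied
    at [tau / J]. *)
Lemma jacobi_V (s : int) (tau : C) : s = 1 \/ s = -1 -> 0 < complex.Im tau ->
  let J := (4 * s)%:~R * tau + 1 in
  [/\ J != 0, 0 < complex.Im (tau / J) & th (tau / J) ^+ 2 = J * th tau ^+ 2].
Proof.
move=> hs ht J.
have hJ : complex.Im J = (4 * s)%:~R * complex.Im tau.
  by rewrite /J -(rmorph_int (real_complex R)) !ReIm /=; ring.
have J0 : J != 0.
  apply/eqP => J0; move: hJ; rewrite J0 /= => /eqP; rewrite eq_sym mulf_eq0 (gt_eqF ht) orbF intr_eq0.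
  by case: hs => ->.
have Vpos (z : C) (k : int) : 0 < complex.Im z -> k%:~R * z + 1 != 0 -> 0 < complex.Im (z / (k%:~R * z + 1)).
  move=> z0 J1; have zn : z != 0 by apply: contraTneq z0 => ->; rewrite ltxx.
  have -> : z / (k%:~R * z + 1) = - (- z^-1 - k%:~R)^-1.
    move: (k%:~R : C) J1 => y J1; apply: (mulIf J1); rewrite divfK//.
    have -> : - z^-1 - y = - ((y * z + 1) / z) by field.
    by rewrite invrN opprK invf_div divfK.
  apply: Im_negV; rewrite -(rmorph_int (real_complex R)) Im_add [complex.Im (- _%:K)]/= oppr0 addr0.
  exact: Im_negV.
have hI : 0 < complex.Im (tau / J) by exact: Vpos.
have hdet : 1 * 1 - 0 * 4%N%:Z = 1 :> int by [].
split => //; case: hs => hs.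
  have := jacobi_gamma0 (a := 1) (b := 0) (c := 4) (d := 1) isT isT hdet ht.
  by rewrite lam14 mul1r addr0 mul1r /J hs mulr1.
have t0 : tau != 0 by apply: contraTneq ht => ->; rewrite ltxx.
have := jacobi_gamma0 (a := 1) (b := 0) (c := 4) (d := 1) isT isT hdet hI.
have e1 : 4%:R * (tau / J) + 1%:~R = J^-1.
  by move: J0; rewrite /J hs => J0; field.
have e2 : (1%:~R * (tau / J) + 0%:~R) / J^-1 = tau by rewrite mul1r addr0 invrK divfK.
by rewrite e1 e2 lam14 mul1r => ->; rewrite mulrA mulfV// mul1r.
Qed.

(** The descent runs on [|c| + |d|]: for [|c| > 2 |d|] the matrices of [jacobi_V] replace [c] by
    [c + 4 s d], otherwise translations replace [d] by [d + s c]. The class of [d] modulo 4 is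
    unchanged because 4 divides [c]. *)
Lemma jacobi_chi4 (k : nat) (a b c d : int) (tau : C) : (absz c + absz d <= k)%N -> a * d - b * c = 1 ->
  (4 %| c)%Z -> 0 < complex.Im tau ->
  th ((a%:~R * tau + b%:~R) / (c%:~R * tau + d%:~R)) ^+ 2 = (chi4 d)%:~R * (c%:~R * tau + d%:~R) * th tau ^+ 2.
Proof.
elim: k a b c d tau => [|k IH] a b c d tau hk hdet /dvdzP[c' hc] ht.
  have c0 : c = 0 by lia.
  have d0 : d = 0 by lia.
  by move/eqP: hdet; rewrite c0 d0 !mulr0 subr0.
have [c0|cn0] := eqVneq c 0.
  move: hdet; rewrite c0 mulr0 subr0 => ad.
  have [[-> ->]|[-> ->]] : (a = 1 /\ d = 1) \/ (a = -1 /\ d = -1).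
    have /eqP := congr1 absz ad; rewrite abszM muln_eq1 => /andP[/eqP ha /eqP hd].
    have [ea|ea] : a = 1 \/ a = -1 by lia.
      by left; rewrite ea in ad; lia.
    by right; rewrite ea in ad; lia.
    by rewrite mul0r add0r divr1 mul1r th_period// !mul1r.
  have -> : ((-1)%:~R * tau + b%:~R) / (0%:~R * tau + (-1)%:~R) = tau + (- b)%:~R :> C.
    by rewrite mul0r add0r mulN1r !mulrNz invrN invr1 mulrN mulr1 opprD opprK.
  by rewrite th_period// mul0r add0r -intrM mul1r.
have [big|small] := ltnP (2 * absz d) (absz c).
  have [s [hs lts]] : exists s : int, (s = 1 \/ s = -1) /\ (absz (c + 4 * s * d)%R < absz c)%N.
    have dn0 : d <> 0 by move=> d0; move: hdet; rewrite d0 hc; lia.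
    have [h|h] : (0 < c /\ 0 < d \/ c < 0 /\ d < 0) \/ (0 < c /\ d < 0 \/ c < 0 /\ 0 < d) by lia.
      by exists (-1); split; [right | lia].
    by exists 1; split; [left | lia].
  have [|J0 hI hJ] := @jacobi_V (- s) tau _ ht; first by case: hs => ->; rewrite ?opprK; [right|left].
  set J := (4 * - s)%:~R * tau + 1 in J0 hI hJ.
  have := IH (a + 4 * s * b) b (c + 4 * s * d) d (tau / J) _ _ _ hI.
  have key (x y : int) : (x + 4 * s * y)%:~R * (tau / J) + y%:~R = (x%:~R * tau + y%:~R) / J :> C.
    transitivity (((x + 4 * s * y)%:~R * tau + y%:~R * J) / J); first by field.
    by congr (_ / _); rewrite /J mulrN mulrNz !intrD !intrM; ring.
  have c1 (X Y : C) : X / J / (Y / J) = X / Y by rewrite invf_div mulrA divfK.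
  have c2 (X Y t : C) : X * (Y / J) * (J * t) = X * Y * t by field.
  rewrite !key hJ c1 c2; apply.
  - by lia.
  - by rewrite -hdet; ring.
  - by apply/dvdzP; exists (c' + s * d); rewrite hc; ring.
have [s [hs lts]] : exists s : int, (s = 1 \/ s = -1) /\ (absz (d + s * c)%R < absz d)%N.
  (* Equality would make [d] even, as 4 divides [c], and contradict determinant 1; it has to be
     excluded for the next translation to be strictly decreasing. *)
  have ne : absz c <> (2 * absz d)%N.
    move=> e; have [e1|e1] : c = 2 * d \/ c = - (2 * d) by lia.
      have e2 : d = 2 * c' by lia.
      by move: hdet; rewrite e1 e2; lia.
    have e2 : d = 2 * (- c') by lia.
    by move: hdet; rewrite e1 e2; lia.
  have [h|h] : (0 < c /\ 0 < d \/ c < 0 /\ d < 0) \/ (0 < c /\ d < 0 \/ c < 0 /\ 0 < d) by lia.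
    by exists (-1); split; [right | lia].
  by exists 1; split; [left | lia].
have ht' : 0 < complex.Im (tau + (- s)%:~R).
  by rewrite -(rmorph_int (real_complex R)) Im_add /= addr0.
have := IH a (b + s * a) c (d + s * c) (tau + (- s)%:~R) _ _ _ ht'.
have e1 : c%:~R * (tau + (- s)%:~R) + (d + s * c)%:~R = c%:~R * tau + d%:~R :> C.
  by rewrite !intrD !intrM !mulrNz; ring.
have e2 : a%:~R * (tau + (- s)%:~R) + (b + s * a)%:~R = a%:~R * tau + b%:~R :> C.
  by rewrite !intrD !intrM !mulrNz; ring.
rewrite e1 e2 th_period// (@chi4_mod (d + s * c) d (s * c')); last by rewrite hc; ring.
apply.
- by lia.
- by rewrite -hdet; ring.
- by apply/dvdzP; exists c'.
Qed.

(** A matrix with right column [(v, d)] and [c] divisible by 4 has two known multipliers: the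
    normalised square of the Gauss sum by [jacobi_multiplier], and [chi4 d] by [jacobi_chi4]. *)
Lemma gauss_sum_sqr (v : int) (d : nat) : odd d -> coprimez v d%:Z ->
  gauss_sum v d ^+ 2 = (chi4 d%:Z)%:~R * d%:R :> C.
Proof.
move=> od co; have d0 : (0 < d)%N by case: d od co.
have : coprimez d%:Z (4 * v).
  rewrite coprimezMr [X in _ && X]coprimez_sym co andbT.
  rewrite (_ : (4 : int) = (2 ^ 2)%N%:Z)// /coprimez /gcdz !absz_nat eqz_nat.
  by apply: (coprimeXr 2); rewrite coprimen2.
move=> /coprimezP[[p q] /= hpq].
(* A Bezout relation gives the matrix, and [t] is taken large enough to make [c] positive. *)
pose t : int := (absz q).+1%:Z; pose c := absz (4 * (t * d%:Z - q)).
have hc : c%:Z = 4 * (t * d%:Z - q) by rewrite /c gez0_abs// /t; nia.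
have c0 : (0 < c)%N by rewrite -ltz_nat hc /t; nia.
have c4 : (4 %| c)%N by rewrite /c abszM dvdn_mulr.
have hdet : (p + 4 * v * t) * d%:Z - v * c%:Z = 1 by rewrite hc; apply: etrans hpq; ring.
have [tau ht thn] := theta1_neq0 mu0 hP (ltn0Sn 0) L0 LD LZ Ln Ld LP PL.
have h1 := jacobi_gamma0 c0 c4 hdet ht.
have h2 := jacobi_chi4 (leqnn _) hdet (_ : (4 %| c%:Z)%Z) ht.
have J0 : c%:R * tau + d%:Z%:~R != 0 :> C.
  have : 0 < complex.Im (c%:R * (c%:R * tau + d%:Z%:~R)).
    by rewrite Im_automorphy mulr_gt0// exprn_gt0// ltr0n.
  by apply: contraTneq => ->; rewrite mulr0 ltxx.
move: h1; rewrite h2; last by rewrite /dvdz.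
have -> : (c%:Z)%:~R = c%:R :> C by [].
have th2 : th tau ^+ 2 != 0 by rewrite expf_neq0.
move=> /(mulIf th2) /(mulIf J0); rewrite (jacobi_multiplier c0 d0 c4 hdet) => ->.
by rewrite divfK// pnatr_eq0 -lt0n.
Qed.

End JacobiTheta.

(** * The character of the level *)

(** An elementary substitute for primes in progressions. After a first shift to a positive [e] prime
    to [c], a prime of [M] divides exactly one of [e] and [j c], hence not [e + j c]. *)
Lemma coprime_shift (c : nat) (d : int) (M : nat) : (0 < c)%N -> coprimez d c%:Z -> (0 < M)%N ->
  exists (j : int) (d' : nat), [/\ (0 < d')%N, d'%:Z = d + j * c%:Z & coprime d' M].
Proof.
move=> c0 co M0; pose e := absz (d + (absz d).+1%:Z * c%:Z).
have he : e%:Z = d + (absz d).+1%:Z * c%:Z by rewrite /e gez0_abs//; nia.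
have e0 : (0 < e)%N by rewrite -ltz_nat he; nia.
have coe : coprime e c.
  have /coprimezP[[p q] /= hpq] := co.
  have : coprimez e%:Z c%:Z.
    apply/coprimezP; exists (p, q - p * (absz d).+1%:Z); rewrite /= he; apply: etrans hpq; ring.
  by rewrite /coprimez /gcdz !absz_nat eqz_nat.
pose j := (M`_(\pi(e)^'))%N.
exists ((absz d).+1%:Z + j%:Z), (e + j * c)%N; split; first by rewrite addn_gt0 e0.
  by rewrite PoszD PoszM he; ring.
rewrite coprime_has_primes ?addn_gt0 ?e0//; apply/hasPn => p.
rewrite !mem_primes => /and3P[pp _ pM]; rewrite pp addn_gt0 e0 /=; apply/negP => pd.
have [pe|pe] := boolP (p %| e)%N.
  have pjc : (p %| j * c)%N by rewrite -(dvdn_addr _ pe).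
  have : ~~ (p %| c)%N.
    apply/negP => pc; have : (p %| gcdn e c)%N by rewrite dvdn_gcd pe.
    by move: coe; rewrite /coprime => /eqP ->; rewrite dvdn1 => /eqP p1; rewrite p1 in pp.
  move: pjc; rewrite Euclid_dvdM// => /orP[pj|->//] _.
  have := pnat_dvd pj (part_pnat _ M); rewrite pnatE// inE /= mem_primes pp e0 pe.
  by [].
have pj : (p %| j)%N.
  have := partn_dvd (negn \pi(e)) M0 pM; rewrite part_pnat_id//.
  by rewrite pnatE// inE /= mem_primes pp e0 (negbTE pe).
by move: pd; rewrite dvdn_addl ?dvdn_mulr// (negbTE pe).
Qed.

Lemma odd_part (M : nat) : (0 < M)%N -> exists k o, odd o /\ M = (2 ^ k * o)%N.
Proof.
move=> M0; exists (logn 2 M), (M`_(negn 2%N))%N; split; last by rewrite -p_part partnC.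
by have := part_pnat (negn 2%N) M; rewrite p'natE ?part_gt0// dvdn2 negbK.
Qed.

Section LevelCharacter.
Context {R : realType}.
Local Notation C := (R[i]).
Local Notation "x %:K" := (x%:C%C : C) (at level 2, format "x %:K").

Variables (n : nat) (L : set 'rV[R]_n) (P : 'M[R]_n) (mu : 'I_n -> R) (K : nat).
Hypothesis mu0 : forall i, 0 < mu i.
Hypothesis hP : forall i j, dot (row i P) (row j P) = if i == j then mu i else 0.
Hypothesis K0 : (0 < K)%N.
Hypothesis L0 : L 0.
Hypothesis LD : forall v w, L v -> L w -> L (v + w).
Hypothesis LZ : forall (k : int) v, L v -> L (k%:~R *: v).
Hypothesis Ln : forall v, L v -> exists k : int, dot v v = k%:~R.
Hypothesis Ld : forall v w, L v -> L w -> exists k : int, 2 * dot v w = k%:~R.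
Hypothesis LP : forall v, L v -> exists x, v = comb P (zc x).
Hypothesis PL : forall k : 'rV[int]_n, L (comb P (zc (K%:Z *: k))).
Variables (N : nat) (u : 'I_n -> 'rV[R]_n).
Hypothesis N0 : (0 < N)%N.
Hypothesis hu1 : forall i v, L v -> exists k : int, 2 * dot (u i) v = k%:~R.
Hypothesis hu2 : forall w, (forall i, exists k : int, 2 * dot (u i) w = k%:~R) -> L w.
Hypothesis hu3 : forall i, L (N%:R *: u i).
Hypothesis hu4 : forall i, exists k : int, N%:R * dot (u i) (u i) = k%:~R.

Local Notation lam := (multiplier L P mu K).

Lemma multiplier_chi4 : exists2 M : nat, (0 < M)%N & forall (a b : int) (c d : nat),
  (0 < c)%N -> (0 < d)%N -> (N %| c)%N -> a * d%:Z - b * c%:Z = 1 -> coprime d (2 * M) ->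
  lam a c = (chi4 d%:Z)%:~R ^+ n.
Proof.
have /choice[k hk] : forall i, exists k : int, K%:R ^+ 2 * mu i = k%:~R.
  move=> i; have [k hk] := Ln (PL (delta_mx 0 i)); exists k; rewrite -hk (comb_comb hP).
  rewrite (bigD1 i)//= big1 => [|j ji]; last by rewrite /zc !mxE (negbTE ji) /= !(mulr0, mul0r).
  rewrite /zc !mxE !eqxx mulr1 addr0.
  have -> : (K%:Z)%:~R = K%:R :> R by [].
  by ring.
have k0 i : k i != 0.
  rewrite -(intr_eq0 R) -hk mulf_neq0 ?expf_neq0 ?pnatr_eq0 -?lt0n//.
  by rewrite gt_eqF.
(* Coprimality with [K] is used by the Chinese remainder theorem, and coprimality with each [k i]
   keeps the coefficient [b * k i] of the Gauss sum invertible modulo [d]. *)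
exists (K * \prod_i absz (k i))%N.
  by rewrite muln_gt0 K0 prodn_gt0// => i; rewrite absz_gt0.
move=> a b c d c0 d0 Nc hdet; rewrite !coprimeMr => /and3P[d2 dK dk].
have od : odd d by rewrite -coprimen2.
rewrite (multiplier_gauss mu0 hP K0 L0 LD LZ Ln Ld LP PL hu1 hu2 hu3 hu4 c0 d0 Nc hdet dK hk).
rewrite -[n in RHS]card_ord -prodr_const; apply: eq_bigr => i _; rewrite gauss_sum_sqr//.
  by rewrite mulfK// pnatr_eq0 -lt0n.
rewrite coprimezMl; apply/andP; split.
  by apply/coprimezP; exists (- c%:Z, a); rewrite /= -hdet; ring.
rewrite coprimez_sym /coprimez /gcdz absz_nat eqz_nat.
by apply: coprime_dvdr dk; rewrite (bigD1 i)//= dvdn_mulr.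
Qed.

(** If 4 did not divide [N], some [d = 1 + j N] would be congruent to 3 modulo 4 and prime to [2 M].
    The matrices with rows [(1, 0), (N, 1)] and [(1, j), (N, d)] share [(a, c) = (1, N)], yet would
    have multipliers 1 and [(-1)^n = -1]. *)
Lemma level_dvd4 : odd n -> (4 %| N)%N.
Proof.
move=> on; apply/negPn/negP => n4; have [M M0 hM] := multiplier_chi4.
have [k [w [odo hMo]]] := odd_part M0.
(* With [w] the odd part of [M], this choice makes [j N] congruent to 2 modulo 4 and divisible by
   [w]. *)
pose j := if odd N then (2 * w)%N else w.
have l1 : lam 1 N = 1.
  have := hM 1 0 N 1%N N0 isT (dvdnn N) (erefl _) (coprime1n _).
  by rewrite expr1n.
have coj : coprime (1 + j * N) (2 * M).
  rewrite hMo mulnA -expnS coprimeMr; apply/andP; split.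
    apply: coprimeXr; rewrite coprimen2 oddD oddM /j.
    by case: ifP => [oN|oN]; rewrite ?oddM ?odo ?oN.
  have [x ->] : exists x, (j * N = x * w)%N.
    rewrite /j; case: ifP => _; first by exists (2 * N)%N; lia.
    by exists N; rewrite mulnC.
  by rewrite coprime_sym addnC /coprime gcdnMDl gcdn1.
have := hM 1 j%:Z N (1 + j * N)%N N0 isT (dvdnn N) _ coj.
rewrite l1; have -> : chi4 (1 + j * N)%N%:Z = -1.
  rewrite /chi4; have h3 : ((1 + j * N)%N%:Z %% 4 = 3)%Z.
    have : exists x, w = (x * 2 + 1)%N by exists w./2; lia.
    case=> x hx; rewrite /j; case: ifP => oN.
      have [y hy] : exists y, N = (y * 2 + 1)%N by exists N./2; lia.
      have -> : (1 + 2 * w * N)%N%:Z = 3 + 4 * ((x * 2 + 1) * y + x)%N%:Z by rewrite hx hy; lia.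
      by rewrite addrC mulrC modzMDl.
    have [y hy] : exists y, N = (y * 4 + 2)%N by exists (N %/ 4)%N; lia.
    have -> : (1 + w * N)%N%:Z = 3 + 4 * ((x * 2 + 1) * y + x)%N%:Z by rewrite hx hy; lia.
    by rewrite addrC mulrC modzMDl.
  by rewrite h3.
rewrite mulrNz -signr_odd on expr1 => h.
have /eqP : (1 : C) = - 1 by apply: h; rewrite mul1r PoszD PoszM; ring.
by rewrite -subr_eq0 opprK -(natrD _ 1 1) pnatr_eq0.
Qed.

Definition level_chi (d : int) : int := if odd n then chi4 d else 1.

(** Replacing [d] by [d + j c] and [b] by [b + j a] keeps [(a, c)], and [coprime_shift] reaches a
    [d'] to which [multiplier_chi4] applies. For odd [n], [chi4] does not notice the change because
    4 divides [N], hence [c]; for even [n] the power is 1. *)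
Lemma multiplier_level (a b : int) (c : nat) (d : int) : (0 < c)%N -> (N %| c)%N ->
  a * d - b * c%:Z = 1 -> lam a c = (level_chi d)%:~R.
Proof.
move=> c0 Nc hdet; have [M M0 hM] := multiplier_chi4.
have co : coprimez d c%:Z by apply/coprimezP; exists (a, - b); rewrite /= -hdet; ring.
have M2 : (0 < 2 * M)%N by rewrite muln_gt0.
have [j [d' [d'0 hd' cod]]] := coprime_shift c0 co M2.
have hdet' : a * d'%:Z - (b + j * a) * c%:Z = 1 by rewrite hd'; apply: etrans hdet; ring.
rewrite (hM a (b + j * a) c d' c0 d'0 Nc hdet' cod).
have od : (d' %% 2 = 1)%N by move: cod; rewrite coprimeMr coprimen2 => /andP[]; lia.
have sq : (chi4 d'%:Z)%:~R ^+ 2 = 1 :> C.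
  by rewrite -rmorphXn /= chi4_odd//; lia.
rewrite /level_chi; case: ifPn => on; last first.
  by rewrite -(even_halfK on) -mul2n exprM sq expr1n.
rewrite -(odd_double_half n) on exprD expr1 -mul2n exprM sq expr1n mulr1; congr (_%:~R).
have /dvdnP[N' hN'] := level_dvd4 on; have /dvdnP[c' hc'] := Nc.
by apply: (@chi4_mod _ _ (j * (c' * N')%N%:Z)); rewrite hd' hc' hN' !PoszM; ring.
Qed.

(** The parity condition [chi (-1) = (-1)^k]: it makes the transformation law insensitive to
    replacing [g] by [- g], which reduces [c < 0] to [c > 0]. *)
Lemma level_chiN (m : nat) (d : int) (J : C) :
  (level_chi (- d))%:~R * (- J) ^+ (4 * m + n) = (level_chi d)%:~R * J ^+ (4 * m + n).
Proof.
have od : odd (4 * m + n) = odd n by rewrite oddD oddM.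
case: (boolP (odd n)) => on.
  have e : (- J) ^+ (4 * m + n) = - J ^+ (4 * m + n) by rewrite exprNn -signr_odd od on expr1 mulN1r.
  rewrite e /level_chi on -mulN1r chi4M (_ : chi4 (-1) = -1)// intrM mulrNz mulN1r.
  by rewrite mulrNN.
have e : (- J) ^+ (4 * m + n) = J ^+ (4 * m + n).
  by rewrite exprNn -signr_odd od (negbTE on) expr0 mul1r.
by rewrite e /level_chi (negbTE on).
Qed.

Theorem theta_level (a b c d : int) (tau : C) (m : nat) h : (N%:Z %| c)%Z ->
  a * d - b * c = 1 -> 0 < complex.Im tau -> Harm (2 * m) h ->
  theta h L ((a%:~R * tau + b%:~R) / (c%:~R * tau + d%:~R)) ^+ 2 =
  (level_chi d)%:~R * (c%:~R * tau + d%:~R) ^+ (4 * m + n) * theta h L tau ^+ 2.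
Proof.
move=> Nc hdet ht hh.
have pos (a' b' : int) (c' : nat) (d' : int) : (0 < c')%N -> (N %| c')%N -> a' * d' - b' * c'%:Z = 1 ->
    theta h L ((a'%:~R * tau + b'%:~R) / (c'%:R * tau + d'%:~R)) ^+ 2 =
    (level_chi d')%:~R * (c'%:R * tau + d'%:~R) ^+ (4 * m + n) * theta h L tau ^+ 2.
  move=> c'0 Nc' hd; rewrite -(multiplier_level c'0 Nc' hd).
  exact: (theta_gamma0 mu0 hP K0 LD LZ Ln Ld LP PL hu1 hu2 hu3 hu4 c'0 Nc' hd ht hh).
have per k : theta h L (tau + k%:~R) = theta h L tau.
  exact: (theta_period mu0 hP K0 LD LZ Ln LP PL k hh ht).
have [cneg|cpos|c0] := ltgtP c 0; last 1 first.
- have ad : a * d = 1 by rewrite -hdet c0 mulr0 subr0.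
  have hd : d = 1 \/ d = -1.
    by have /eqP := congr1 absz ad; rewrite abszM muln_eq1 => /andP[_ /eqP]; lia.
  have one : (level_chi 1)%:~R * (1 : C) ^+ (4 * m + n) = 1.
    by rewrite expr1n mulr1 /level_chi; case: ifP.
  rewrite c0 !mul0r !add0r; case: hd => hd; rewrite hd in ad *.
    have -> : a = 1 by lia.
    by rewrite mul1r divr1 per one mul1r.
  have -> : a = -1 by lia.
  rewrite !mulrNz level_chiN one mul1r -(per (- b)); congr (theta h L _ ^+ 2).
  by rewrite mulN1r !mulrNz invrN invr1 mulrN mulr1 opprD opprK.
- have -> : (a%:~R * tau + b%:~R) / (c%:~R * tau + d%:~R) =
      ((- a)%:~R * tau + (- b)%:~R) / ((absz c)%:R * tau + (- d)%:~R) :> C.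
    rewrite (_ : (absz c)%:R = - c%:~R); last by rewrite -mulrNz -ltz0_abs.
    by rewrite !mulrNz !mulNr -!opprD invrN mulrNN.
  rewrite pos.
  + rewrite (_ : (absz c)%:R = - c%:~R); last by rewrite -mulrNz -ltz0_abs.
    by rewrite !mulrNz mulNr -opprD level_chiN.
  + by lia.
  + by rewrite -[N]absz_nat; exact: Nc.
  + by rewrite ltz0_abs// -hdet; ring.
- have := pos a b (absz c) d; have -> : (absz c)%:R = c%:~R :> C by rewrite -[in RHS](gtz0_abs cpos).
  apply.
  + by lia.
  + by rewrite -[N]absz_nat; exact: Nc.
  + by rewrite gtz0_abs.
Qed.

End LevelCharacter.

(** * Holomorphy and q-expansion *)

Section MoreSummation.
Context {R : realType}.
Local Notation C := (R[i]).
Local Notation "x %:K" := (x%:C%C : C) (at level 2, format "x %:K").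

Lemma hassum_comp (S T : choiceType) (phi : S -> T) (f : T -> C) (s : C) : injective phi ->
  (forall y, f y != 0 -> exists x, y = phi x) -> hassum f s -> hassum (f \o phi) s.
Proof.
move=> inj supp hf; have [[M hM] _] := hf.
have h : hassum (f \o phi) (tsum (f \o phi)).
  apply: summable_hassum; exists M => A; apply: le_trans (hM [fset phi x | x in A]%fset).
  by rewrite big_imfset//= => x y _ _; exact: inj.
by rewrite (hassum_unique hf (hassum_reindex inj supp h)).
Qed.

Lemma hassum_point (T : choiceType) (a : T) (c : C) : hassum (fun x => if x == a then c else 0) c.
Proof.
apply: (@hassum_reindex _ unit _ (fun=> a)); first by case; case.
  by move=> y; case: (y =P a) => [-> _|_]; [exists tt | rewrite eqxx].
have := hassum_fin (fun _ : unit => c).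
by rewrite big_const /= card_unit /= addr0; apply: eq_hassum => x /=; rewrite eqxx.
Qed.

Lemma hassum_fset (T : choiceType) (A : {fset T}) (f : T -> C) :
  (forall x, x \notin A -> f x = 0) -> hassum f (\sum_(x <- A) f x).
Proof.
move=> f0; have := hassum_bigsum A (P := xpredT) (fun a _ => hassum_point a (f a)).
apply: eq_hassum => x; have [xA|xA] := boolP (x \in A).
  rewrite (bigD1_seq x)//= eqxx big1 ?addr0// => y.
  by rewrite eq_sym => /negbTE ->.
rewrite f0// big_seq big1// => y yA; case: (x =P y) => // xy.
by rewrite xy yA in xA.
Qed.

Lemma finite_bsums (T : choiceType) (g : T -> R) (D : set T) (c : R) : 0 < c -> (forall x, 0 <= g x) ->
  bsums g -> (forall x, D x -> c <= g x) -> finite_set D.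
Proof.
move=> c0 g0 [M hM] hD; apply: contrapT => inf.
have M0 : 0 <= M by have := hM fset0; rewrite big_seq_fset0.
have [A AD hA] := infinite_set_fset (Num.bound (M / c)).+1 inf.
have h1 : c * #|` A|%:R <= M.
  apply: le_trans (hM A); rewrite mulrC -sum_const_fset big_seq [leRHS]big_seq.
  by apply: ler_sum => x xA; apply: hD; exact: AD.
have h2 : M / c < (Num.bound (M / c))%:R by apply: archi_boundP; rewrite divr_ge0// ltW.
have h3 : (Num.bound (M / c))%:R <= #|` A|%:R :> R by rewrite ler_nat ltnW.
by move: h2; rewrite ltr_pdivrMr// => h2; nra.
Qed.

Lemma normc_le (z e : C) : 0 < e -> cabs z <= complex.Re e -> `|z| <= e.
Proof. by case: e => e1 e2; rewrite ltcE lecE cabsE /= => /andP[/eqP -> _] ->; rewrite eqxx. Qed.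

Lemma Re_gt0 (e : C) : 0 < e -> 0 < complex.Re e.
Proof. by case: e => a b; rewrite ltcE /= => /andP[]. Qed.

Lemma tends_cvg (u : nat -> C) (s : C) : tends u s -> (u : nat -> C^o) @ \oo --> (s : C^o).
Proof.
move=> h; apply/(@cvgrPdist_le _ (C^o : normedModType C)) => e e0; have [N0 hN] := h _ (Re_gt0 e0).
exists N0 => // l /= Nl; apply: normc_le => //.
by rewrite cabsBC; exact: hN.
Qed.

Lemma derivable_cabs (f : C^o -> C^o) (x D : C) :
  (forall e : R, 0 < e -> exists2 d : R, 0 < d & forall z : C, z != 0 -> cabs z < d ->
    cabs (z^-1 * (f (x + z) - f x) - D) <= e) -> derivable f x 1.
Proof.
move=> h; apply/cvg_ex; exists (D : C^o); apply/(@cvgrPdist_le _ (C^o : normedModType C)) => e e0.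
have [d d0 hd] := h _ (Re_gt0 e0).
have dK : 0 < d%:K by rewrite ltcR.
near=> z; apply: normc_le => //; rewrite cabsBC /=.
have -> : (z *: (1 : C^o) + x : C) = x + z by rewrite addrC; congr (_ + _); exact: mulr1.
apply: hd; first by near: z; exact: nbhs_dnbhs_neq.
have : `|z| < d%:K by near: z; exact: dnbhs0_lt.
by rewrite cabsE ltcR.
Unshelve. all: by end_near.
Qed.

End MoreSummation.

(** * Holomorphy, q-expansion and integrality *)

Section ThetaAnalytic.
Context {R : realType}.
Local Notation C := (R[i]).
Local Notation "x %:K" := (x%:C%C : C) (at level 2, format "x %:K").
Variables (n : nat) (L : set 'rV[R]_n).
Hypothesis Ln : forall v, L v -> exists k : int, dot v v = k%:~R.

Definition theta_term (h : mpoly n R) (tau : C) (v : 'rV[R]_n) : C :=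
  indL L v * (ev v h)%:K * cexp (tpi * tau * (dot v v)%:K).

Hypothesis hsum : forall (m : nat) h tau, Harm (2 * m) h -> 0 < complex.Im tau ->
  hassum (theta_term h tau) (theta h L tau).

Let pos_Im (y : R) : 0 < y -> 0 < complex.Im ('i%C * y%:K).
Proof. by move=> y0; rewrite !ReIm /= !(mul0r, mul1r, addr0, add0r). Qed.

Lemma theta_bounded (m : nat) h : Harm (2 * m) h ->
  exists M : R, forall tau, 1 <= complex.Im tau -> cabs (theta h L tau) <= M.
Proof.
move=> hh; have [[M hM] _] := hsum hh (pos_Im ltr01).
exists M => tau ht; apply: (hassum_cabs_le (hsum hh (lt_le_trans ltr01 ht))) => A.
apply: le_trans (hM A); apply: ler_sum => v _.
rewrite /theta_term ![cabs (_ * cexp _)]cabsM; apply: ler_wpM2l; first exact: cabs_ge0.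
by apply: cabs_cexp_le => //; exact: dot_ge0.
Qed.

Lemma sqr_le_expR (x : R) : 0 <= x -> x ^+ 2 <= 4 * expR x.
Proof.
move=> x0; have -> : expR x = expR (x / 2) ^+ 2 by rewrite -expRM_natl; congr expR; rewrite -mulr_natl; field.
have h := expR_ge1Dx (x / 2); have h2 : x / 2 <= expR (x / 2) by lra.
have : (x / 2) ^+ 2 <= expR (x / 2) ^+ 2 by rewrite ler_pXn2r ?nnegrE ?expR_ge0//; lra.
by rewrite expr_div_n; lra.
Qed.

(** Termwise differentiation with a remainder of order [z^2]. The majorant [g] is the series at
    height [y / 2]; the other half of the exponent absorbs the powers of [|v|^2]. *)
Lemma theta_derivable (m : nat) h tau : Harm (2 * m) h -> 0 < complex.Im tau ->
  derivable (theta h L : C^o -> C^o) tau 1.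
Proof.
move=> hh ht; set y := complex.Im tau in ht.
pose a v : C := indL L v * (ev v h)%:K.
pose g v := cabs (a v) * expR (- (pi * y * dot v v)).
have y2 : 0 < y / 2 by rewrite divr_gt0.
have [M hM] : bsums g.
  have [[M hM] _] := hsum hh (pos_Im y2); exists M => A; apply: le_trans (hM A).
  apply: ler_sum => v _; rewrite /g /theta_term [cabs (_ * cexp _)]cabsM cabs_cexp Re_tpi_mul.
  rewrite !ReIm /= !(mul0r, mul1r, addr0, add0r); apply: ler_wpM2l; first exact: cabs_ge0.
  by rewrite ler_expR le_eqVlt; apply/orP; left; apply/eqP; field.
have piy : 0 < pi * y by rewrite mulr_gt0 ?pi_gt0.
have ctpi : cabs (tpi : C) = 2 * pi.
  rewrite tpiE; have -> : Complex 0 (2 * pi) = 'i%C * (2 * pi)%:K :> C.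
    by apply: complex_ext; rewrite !ReIm /=; ring.
  by rewrite cabsM cabs_i mul1r cabs_real ger0_norm// mulr_ge0 ?pi_ge0.
have sumD : hassum (fun v => a v * (tpi * (dot v v)%:K * cexp (tpi * tau * (dot v v)%:K)))
    (tsum (fun v => a v * (tpi * (dot v v)%:K * cexp (tpi * tau * (dot v v)%:K)))).
  apply: summable_hassum; apply: (@bsums_le _ _ _ (fun v => 2 / y * g v)); last first.
    by apply: bsumsZ; [rewrite divr_ge0// ltW | exists M].
  move=> v; set X := dot v v; have X0 : 0 <= X by exact: dot_ge0.
  rewrite [cabs (_ * _)]cabsM /g mulrCA; apply: ler_wpM2l; first exact: cabs_ge0.
  rewrite [cabs (_ * cexp _)]cabsM [cabs (tpi * _)]cabsM ctpi cabs_real (ger0_norm X0) cabs_cexp Re_tpi_mul -/y.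
  have -> : - (2 * pi * y * X) = - (pi * y * X) + - (pi * y * X) by ring.
  rewrite expRD mulrA; apply: ler_wpM2r; first exact: expR_ge0.
  rewrite expRN ler_pdivrMr ?expR_gt0//.
  have h1 := expR_ge1Dx (pi * y * X).
  apply: (@le_trans _ _ (2 / y * (pi * y * X))); last by apply: ler_wpM2l; [rewrite divr_ge0// ltW | lra].
  by rewrite le_eqVlt; apply/orP; left; apply/eqP; field; rewrite gt_eqF.
set D := tsum _ in sumD.
(* The factors come from [cexp_taylor2] with [|tpi| = 2 pi], from [1 + q <= 2 E], and from
   [sqr_le_expR] at [s X] with [s = pi y / 2]. *)
pose K0 : R := 4 * (2 * pi) ^+ 2 * 2 * (4 / (pi * y / 2) ^+ 2).
have K00 : 0 <= K0.
  rewrite /K0; apply: mulr_ge0; last by apply: divr_ge0 => //; exact: sqr_ge0.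
  by apply: mulr_ge0 => //; apply: mulr_ge0 => //; exact: sqr_ge0.
have M0 : 0 <= M by have := hM fset0; rewrite big_seq_fset0.
have main (z : C) : cabs z <= y / 4 -> cabs (theta h L (tau + z) - theta h L tau - z * D) <= cabs z ^+ 2 * (K0 * M).
  move=> hz; have htz : 0 < complex.Im (tau + z).
    rewrite ReIm -/y; have := le_trans (Im_le_cabs z) hz; rewrite ler_norml => /andP[]; lra.
  have hs := hassumB (hassumB (hsum hh htz) (hsum hh ht)) (hassumZ z sumD).
  apply: (hassum_cabs_le hs) => A.
  apply: (@le_trans _ _ (\sum_(v <- A) cabs z ^+ 2 * K0 * g v)); last first.
    by rewrite -mulr_sumr mulrA; apply: ler_wpM2l; [rewrite mulr_ge0 ?sqr_ge0 | exact: hM].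
  apply: ler_sum => v _; set X := dot v v; have X0 : 0 <= X by exact: dot_ge0.
  rewrite /theta_term -/X -/(a v).
  have -> : a v * cexp (tpi * (tau + z) * X%:K) - a v * cexp (tpi * tau * X%:K) -
      z * (a v * (tpi * X%:K * cexp (tpi * tau * X%:K))) =
      a v * (cexp (tpi * tau * X%:K) * (cexp (tpi * z * X%:K) - 1 - tpi * z * X%:K)).
    by rewrite mulrDr mulrDl cexpD; ring.
  rewrite [cabs (a v * _)]cabsM /g mulrCA; apply: ler_wpM2l; first exact: cabs_ge0.
  rewrite [cabs (cexp _ * _)]cabsM; apply: le_trans (ler_wpM2l (cabs_ge0 _) (cexp_taylor2 _)) _.
  rewrite cabs_cexp !Re_tpi_mul -/y [cabs (tpi * z * _)]cabsM [cabs (tpi * z)]cabsM ctpi cabs_real (ger0_norm X0).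
  set s := pi * y / 2; have s0 : 0 < s by rewrite /s divr_gt0.
  have e1 : expR (- (2 * pi * complex.Im z * X)) <= expR (s * X).
    rewrite ler_expR -!mulNr; apply: ler_wpM2r => //.
    have := le_trans (Im_le_cabs z) hz; rewrite ler_norml => /andP[h1 _].
    have := @ler_wpM2l R (2 * pi) _ _ _ h1; rewrite mulr_ge0 ?pi_ge0// => /(_ isT).
    by rewrite /s; lra.
  have e2 : 1 <= expR (s * X) by rewrite -expR0 ler_expR mulr_ge0// ltW.
  have e3 : X ^+ 2 <= 4 / s ^+ 2 * expR (s * X).
    have := @sqr_le_expR (s * X); rewrite mulr_ge0 ?(ltW s0)// => /(_ isT).
    by rewrite exprMn [4 / _ * _]mulrAC ler_pdivlMr ?exprn_gt0// mulrC.
  set q := expR (- (2 * pi * complex.Im z * X)) in e1 *.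
  (* Of the two factors [expR (- s X)], one absorbs [X^2] and the other the growth of [1 + q]; the
     rest is the exponential in [g]. *)
  have -> : - (2 * pi * y * X) = - (s * X) + (- (s * X) + - (pi * y * X)) by rewrite /s; field.
  rewrite !expRD !expRN.
  set E := expR (s * X) in e1 e2 e3 *; set G := (expR (pi * y * X))^-1.
  have G0 : 0 <= G by rewrite invr_ge0 expR_ge0.
  have E0 : 0 < E by exact: expR_gt0.
  have hq : 1 + q <= 2 * E by lra.
  have q0 : 0 <= q by exact: expR_ge0.
  have hp : 0 <= 4 * (2 * pi) ^+ 2 * cabs z ^+ 2.
    by apply: mulr_ge0; [apply: mulr_ge0 => // | ]; exact: sqr_ge0.
  apply: (@le_trans _ _ (E^-1 * (E^-1 * G) * (4 * (2 * pi) ^+ 2 * cabs z ^+ 2 * ((4 / s ^+ 2 * E) * (2 * E))))).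
    apply: ler_wpM2l; first by rewrite !mulr_ge0 ?invr_ge0 ?(ltW E0).
    have -> : 4 * (2 * pi * cabs z * X) ^+ 2 * (1 + q) = 4 * (2 * pi) ^+ 2 * cabs z ^+ 2 * (X ^+ 2 * (1 + q)) by ring.
    apply: ler_wpM2l => //; apply: ler_pM => //; first exact: sqr_ge0.
    by lra.
  rewrite le_eqVlt; apply/orP; left; apply/eqP; rewrite /K0 -/s; field.
  by rewrite !gt_eqF.
apply: (@derivable_cabs _ _ tau D) => e e0.
exists (Num.min (y / 4) (e / (K0 * M + 1))).
  by rewrite lt_min !divr_gt0// ltr_wpDl// mulr_ge0.
move=> z z0; rewrite lt_min => /andP[z1 z2].
have cz : 0 < cabs z by rewrite lt_neqAle cabs_ge0 andbT eq_sym cabs_eq0.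
have -> : z^-1 * (theta h L (tau + z) - theta h L tau) - D = z^-1 * (theta h L (tau + z) - theta h L tau - z * D).
  by rewrite [RHS]mulrBr mulKf.
rewrite cabsM cabsV mulrC ler_pdivrMr//; apply: le_trans (main z (ltW z1)) _.
rewrite expr2 -mulrA mulrC; apply: ler_wpM2r; first exact: ltW.
apply: (@le_trans _ _ (cabs z * (K0 * M + 1))); first by rewrite ler_wpM2l ?cabs_ge0// lerDl.
by rewrite -ler_pdivlMr ?ltW// ltr_wpDl// mulr_ge0.
Qed.

Definition pair_term (m : nat) (tau : C) (p : 'rV[R]_n * 'rV[R]_n) : C :=
  indL L p.1 * indL L p.2 * (zonal_term m p.1 p.2)%:K *
  cexp (tpi * tau * (dot p.1 p.1 + dot p.2 p.2)%:K).

Lemma Theta_hassum (m d : nat) (h : 'I_d -> mpoly n R) tau :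
  Harm_orthonormal_basis (2 * m) h -> 0 < complex.Im tau ->
  hassum (pair_term m tau) (Theta h L tau).
Proof.
move=> hh ht; have [hharm _ _] := hh.
have := hassum_bigsum (index_enum 'I_d) (P := xpredT)
  (fun j _ => hassum_mul (hsum (hharm j) ht) (hsum (hharm j) ht)).
apply: eq_hassum => p; rewrite /pair_term -(zonal_kernel p.1 p.2 hh) (rmorph_sum (real_complex R)).
rewrite mulr_sumr mulr_suml; apply: eq_bigr => j _; rewrite /theta_term.
rewrite [(_ + _)%:K](rmorphD (real_complex R)) mulrDr cexpD (rmorphM (real_complex R) (ev p.1 (h j))) /=.
by move: (cexp _) (cexp _) => A B; ring.
Qed.

Lemma nomeX (tau : C) (k : nat) : nome tau ^+ k = cexp (tpi * tau * (k%:R : R)%:K).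
Proof.
rewrite /nome /expi2pi -cexpMn; congr cexp.
rewrite mulr1 (rmorphM (real_complex R)) !(rmorph_nat (real_complex R)) /= /tpi -mulr_natr; ring.
Qed.

Let normset (k : nat) : set ('rV[R]_n * 'rV[R]_n) :=
  [set p | [/\ L p.1, L p.2 & enorm p.1 ^+ 2 + enorm p.2 ^+ 2 = k%:R]].

(** Finiteness is read off from convergence of the squared theta series of the constant polynomial
    at [i], where each such pair contributes the fixed modulus [expR (- 2 pi k)]. *)
Lemma finite_normset (k : nat) : finite_set (normset k).
Proof.
have h1 := hsum (@Harm1 R n) (pos_Im ltr01).
have [hb _] := hassum_mul h1 h1.
apply: (finite_bsums (c := expR (- (2 * pi * k%:R))) _ _ hb).
- exact: expR_gt0.
- by move=> x; exact: cabs_ge0.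
move=> p [L1 L2 hk]; rewrite /theta_term /indL (asboolT L1) (asboolT L2) !ev1 !mul1r -cexpD -mulrDr.
rewrite -(rmorphD (real_complex R)) cabs_cexp Re_tpi_mul -!enorm_sqr hk ler_expR.
by rewrite !ReIm /= !(mul0r, mul1r, addr0, add0r) mulr1.
Qed.

Lemma Theta_series (m d : nat) (h : 'I_d -> mpoly n R) tau :
  Harm_orthonormal_basis (2 * m) h -> 0 < complex.Im tau ->
  hassum (fun k => (Theta_coef m L k)%:K * nome tau ^+ k) (Theta h L tau).
Proof.
(* On lattice pairs the norm sum is a natural number and [truncn] returns it exactly; other pairs
   have zero terms, so their fibre is immaterial. *)
move=> hh ht; pose kp (p : 'rV[R]_n * 'rV[R]_n) : nat := Num.truncn (dot p.1 p.1 + dot p.2 p.2).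
apply: (hassum_fiber (p := kp) (Theta_hassum hh ht)) => k.
have kpE p : L p.1 -> L p.2 -> dot p.1 p.1 + dot p.2 p.2 = (kp p)%:R.
  move=> /Ln[k1 h1] /Ln[k2 h2]; have : 0 <= dot p.1 p.1 + dot p.2 p.2 by rewrite addr_ge0 ?dot_ge0.
  rewrite /kp h1 h2 -intrD; case: (k1 + k2) => [j _|j]; first by rewrite natrK.
  by rewrite ler0z.
have fin := finite_normset k.
have -> : (Theta_coef m L k)%:K * nome tau ^+ k =
    \sum_(p <- fset_set (normset k)) (if kp p == k then pair_term m tau p else 0).
  rewrite /Theta_coef fsbig_finite// (rmorph_sum (real_complex R)) mulr_suml big_seq [RHS]big_seq.
  apply: eq_bigr => p; rewrite in_fset_set// inE => -[L1 L2]; rewrite !enorm_sqr => hk.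
  have -> : kp p = k by apply/eqP; rewrite -(eqr_nat R) -kpE// hk.
  by rewrite eqxx /pair_term /indL (asboolT L1) (asboolT L2) !mul1r nomeX hk.
apply: hassum_fset => p; rewrite in_fset_set//; case: eqP => // kk np.
rewrite /pair_term /indL; case: asboolP => [L1|_]; last by rewrite !mul0r.
case: asboolP => [L2|_]; last by rewrite mulr0 !mul0r.
by exfalso; move/negP: np; apply; rewrite inE; split => //; rewrite !enorm_sqr kpE// kk.
Qed.

Hypothesis Ld : forall v w, L v -> L w -> exists k : int, 2 * dot v w = k%:~R.

(** In the [i]-th summand [(2m)!] cancels [(2m-2i)! i!] up to a binomial and a falling factorial. Of
    [2^(2m)], one factor [2^i] cancels the denominator and [2^(2m-2i)] turns [<v, w>] into the
    integer [2 <v, w>]. The product leaves its tail [Q]. *)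
Lemma zonal_int (m : nat) v w : (0 < n)%N -> L v -> L w ->
  exists k : int, (2 * m)`!%:R * 2 ^+ (2 * m) * pfactor_prod n m m * zonal_term m v w = k%:~R.
Proof.
move=> n0 Lv Lw; have [a ha] := Ln Lv; have [b hb] := Ln Lw; have [c hc] := Ld Lv Lw.
have /choice[k hk] : forall i : 'I_m.+1, exists k : int,
    (2 * m)`!%:R * 2 ^+ (2 * m) * pfactor_prod n m m *
    (@zcoef R n m i * dot v w ^+ (2 * m - 2 * i) * (dot v v * dot w w) ^+ i) = k%:~R.
  move=> i; have im : (i <= m)%N by rewrite -ltnS.
  have i2m : (2 * i <= 2 * m)%N by rewrite leq_mul2l.
  pose Q : int := \prod_(i <= l < m) (n%:Z + 4 * m%:Z - 4 - 2 * l%:Z).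
  have pfE : pfactor_prod n m m = pfactor_prod n m i * Q%:~R :> R.
    rewrite /pfactor_prod -(big_mkord xpredT (fun l => n%:R + 4 * m%:R - 4 - 2 * l%:R : R)).
    rewrite (big_cat_nat (n := i))//= big_mkord /Q rmorph_prod; congr (_ * _).
    apply: eq_bigr => l _; rewrite !rmorphB !rmorphD /= !rmorphM /=; ring.
  have f1 : (2 * m)`!%:R = 'C(2 * m, 2 * i)%:R * ((2 * i) ^_ i)%:R * i`!%:R * (2 * m - 2 * i)`!%:R :> R.
    rewrite -!natrM -(bin_fact i2m) -(@ffact_fact (2 * i) i); last by rewrite leq_pmull.
    have -> : (2 * i - i = i)%N by rewrite mul2n -addnn addnK.
    by congr (_%:R); ring.
  have f2 : 2 ^+ (2 * m) = 2 ^+ i * 2 ^+ i * 2 ^+ (2 * m - 2 * i) :> R.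
    by rewrite -!exprD; congr (_ ^+ _); lia.
  exists ((-1) ^+ i * ('C(2 * m, 2 * i) * (2 * i) ^_ i * 2 ^ i)%N%:Z * Q * c ^+ (2 * m - 2 * i) * (a * b) ^+ i).
  have eXn (x : int) j : (x ^+ j)%:~R = x%:~R ^+ j :> R by exact: rmorphXn.
  rewrite !intrM !eXn intrM -hc -ha -hb [in RHS]exprMn pfE f1 f2 /zcoef (_ : (-1)%:~R = -1 :> R)//.
  have -> : (('C(2 * m, 2 * i) * (2 * i) ^_ i * 2 ^ i)%N%:Z)%:~R = 'C(2 * m, 2 * i)%:R * ((2 * i) ^_ i)%:R * 2 ^+ i :> R.
    by rewrite -natrX -!natrM.
  have z1 : (2 * m - 2 * i)`!%:R != 0 :> R by rewrite pnatr_eq0 -lt0n fact_gt0.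
  have z2 : i`!%:R != 0 :> R by rewrite pnatr_eq0 -lt0n fact_gt0.
  have z3 : 2 ^+ i != 0 :> R by rewrite expf_neq0// pnatr_eq0.
  have z4 : pfactor_prod n m i != 0 :> R by rewrite gt_eqF// pfactor_gt0.
  move: z1 z2 z3 z4; move: ((2 * m - 2 * i)`!%:R) (i`!%:R) (2 ^+ i) (pfactor_prod n m i) => F G T2 pf z1 z2 z3 z4.
  move: (2 ^+ (2 * m - 2 * i)) (dot v w ^+ _) ((dot v v * dot w w) ^+ _) ((-1) ^+ _) => X Y Z S.
  by field; rewrite z1 z2 z3 z4.
exists (\sum_i k i); rewrite zonal_termE mulr_sumr rmorph_sum /=.
by apply: eq_bigr => i _; rewrite hk.
Qed.

Lemma Theta_coef_int (m k : nat) : (0 < n)%N ->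
  exists c : int, (2 * m)`!%:R * 2 ^+ (2 * m) * pfactor_prod n m m * Theta_coef m L k = c%:~R.
Proof.
move=> n0; rewrite /Theta_coef fsbig_finite; last exact: finite_normset.
rewrite mulr_sumr big_seq.
elim/big_rec : _ => [|p x]; first by exists 0.
rewrite in_fset_set; last exact: finite_normset.
rewrite inE => -[L1 L2 _] [c ->]; have [c' ->] := zonal_int m n0 L1 L2.
by exists (c' + c); rewrite intrD.
Qed.

(** For [m > 0] a pair with a zero component contributes nothing, and the other pairs have norm sum
    at least [2 mu]. *)
Lemma Theta_coef_small (m k mu : nat) : (0 < m)%N -> minimal_norm L mu -> (k < 2 * mu)%N ->
  Theta_coef m L k = 0.
Proof.
move=> m0 [_ hmu] hk; apply: fsbig1 => p [L1 L2 hp].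
have z0 : 0 ^+ (2 * m) = 0 :> R by rewrite expr0n muln_eq0 /= gtn_eqF.
have e0 : enorm (0 : 'rV[R]_n) = 0 by rewrite /enorm dot0r sqrtr0.
rewrite /zonal_term; have [->|v0] := eqVneq p.1 0; first by rewrite e0 z0 mulr0 mul0r.
have [->|w0] := eqVneq p.2 0; first by rewrite e0 z0 mulr0.
have := lerD (hmu _ L1 v0) (hmu _ L2 w0); rewrite hp -natrD ler_nat addnn -mul2n.
by rewrite leqNgt hk.
Qed.

Lemma hassum_qexpansion (f : C -> C) (a : nat -> C) :
  (forall tau, 0 < complex.Im tau -> hassum (fun k => a k * nome tau ^+ k) (f tau)) -> qexpansion f a.
Proof.
move=> h tau ht; apply: tends_cvg => e e0; have [N0 hN] := hassum_nat_cvg (h tau ht) e0.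
by exists N0 => l /hN; rewrite /series /= big_mkord.
Qed.

Lemma Theta_integral (m d mu : nat) (h : 'I_d -> mpoly n R) : (0 < n)%N -> (0 < m)%N ->
  Harm_orthonormal_basis (2 * m) h -> minimal_norm L mu -> exists b : nat -> int,
  qexpansion (fun tau => ((2 * m)`!%:R * 2 ^+ (2 * m) * pfactor_prod n m m)%:K
    / nome tau ^+ (2 * mu) * Theta h L tau) (fun k => (b k)%:~R).
Proof.
move=> n0 m0 hh hmu.
have /choice[b hb] := fun k => Theta_coef_int m k n0.
exists (fun k => b (k + 2 * mu)%N); apply: hassum_qexpansion => tau ht.
set cst : R := (_ * _ * _) in hb *.
have := hassumZ (cst%:K / nome tau ^+ (2 * mu)) (Theta_series hh ht).
have inj : injective (fun k => (k + 2 * mu)%N) by move=> x y /addIn.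
move=> /(hassum_comp inj) hs; apply: eq_hassum (hs _) => [k|k nz]; last first.
  have [small|big] := ltnP k (2 * mu); last by exists (k - 2 * mu)%N; rewrite subnK.
  by move: nz; rewrite (Theta_coef_small m0 hmu small) mul0r mulr0 eqxx.
have nz : nome tau ^+ (2 * mu) != 0 by rewrite expf_neq0// /nome /expi2pi cexp_neq0.
rewrite /= exprD -(rmorph_int (real_complex R)) -hb (rmorphM (real_complex R) cst) /=.
by move: (nome tau ^+ (2 * mu)) nz (nome tau ^+ k) => X X0 Y; field.
Qed.

End ThetaAnalytic.

(** * Application to an integral lattice with a chosen basis *)

Section Lattice.
Context {R : realType}.
Local Notation C := (R[i]).
Local Notation "x %:K" := (x%:C%C : C) (at level 2, format "x %:K").
Variables (n : nat) (L : set 'rV[R]_n) (B : 'M[R]_n).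
Hypothesis hB : lattice_basis L B.
Hypothesis hint : integral_lattice L.

Lemma theta_term_hassum (m : nat) h tau : Harm (2 * m) h -> 0 < complex.Im tau ->
  hassum (theta_term L h tau) (theta h L tau).
Proof.
move=> hh ht; have [P [mu [K [K0 mu0 hP LP PL]]]] := orthogonal_superlattice hB hint.
have hs := theta_summable mu0 hP K0 (latticeD hB) (latticeZ hB) LP PL hh ht.
apply: (hassum_reindex (vz_inj mu0 hP)) hs => v.
by rewrite /theta_term /indL; case: asboolP => [/LP//|_]; rewrite !mul0r eqxx.
Qed.

(** The square of the prefactor carries exactly [J^(4m+n)], so the slash leaves a constant times
    [S ^+ 2], controlled by [cusp_bounded]. The argument uses no divisibility of [c] and therefore
    reaches every cusp. *)
Lemma theta_slash_bounded (a b c d : int) (m : nat) h : a * d - b * c = 1 -> Harm (2 * m) h ->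
  exists M : R, forall tau, 1 <= complex.Im tau ->
    cabs ((c%:~R * tau + d%:~R) ^- (4 * m + n) *
      theta h L ((a%:~R * tau + b%:~R) / (c%:~R * tau + d%:~R)) ^+ 2) <= M.
Proof.
move=> hdet hh; have [P [mu [K [K0 mu0 hP LP PL]]]] := orthogonal_superlattice hB hint.
have pos (a' b' : int) (c' : nat) (d' : int) : (0 < c')%N -> a' * d' - b' * c'%:Z = 1 ->
    exists M : R, forall tau, 1 <= complex.Im tau ->
    cabs ((c'%:R * tau + d'%:~R) ^- (4 * m + n) *
      theta h L ((a'%:~R * tau + b'%:~R) / (c'%:R * tau + d'%:~R)) ^+ 2) <= M.
  move=> c0 hd; have [M hM] := cusp_bounded mu0 hP K0 (latticeD hB) (latticeZ hB)
    (lattice_norm_int hint) (lattice_dot_int hB hint) LP PL c0 hd hh.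
  set A : C := cusp_const mu K / c'%:R ^+ n.
  exists (cabs A * M ^+ 2) => tau h1; have ht : 0 < complex.Im tau by exact: lt_le_trans h1.
  have [r hr /(_ m h hh)[S [-> hS]]] := theta_cusp mu0 hP K0 (latticeD hB) (latticeZ hB)
    (lattice_norm_int hint) (lattice_dot_int hB hint) LP PL c0 hd ht.
  set J := c'%:R * tau + d'%:~R in hr *.
  have J0 : J != 0.
    have : 0 < complex.Im (c'%:R * J) by rewrite Im_automorphy mulr_gt0// exprn_gt0// ltr0n.
    by apply: contraTneq => ->; rewrite mulr0 ltxx.
  have -> : J ^- (4 * m + n) * (r * J ^+ (2 * m) * S) ^+ 2 = A * S ^+ 2.
    rewrite !exprMn hr -/(cusp_const mu K) -exprM.
    have -> : J ^+ (4 * m + n) = J ^+ (2 * m * 2) * J ^+ n by rewrite -exprD; congr (_ ^+ (_ + _)); lia.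
    have z1 : J ^+ (2 * m * 2) != 0 by rewrite expf_neq0.
    have z2 : J ^+ n != 0 by rewrite expf_neq0.
    rewrite /A; move: (J ^+ _) (J ^+ _) z1 z2 (c'%:R ^+ n)^-1 => X Y X0 Y0 c1.
    by field; rewrite X0 Y0.
  rewrite [cabs (A * _)]cabsM cabsX; apply: ler_wpM2l; first exact: cabs_ge0.
  have hSM := hM _ _ h1 hS; have S0 := cabs_ge0 S.
  by rewrite ler_pXn2r ?nnegrE//; lra.
have [cneg|cpos|c0] := ltgtP c 0; last 1 first.
- have ad : a * d = 1 by rewrite -hdet c0 mulr0 subr0.
  have hd : a = 1 /\ d = 1 \/ a = -1 /\ d = -1.
    have /eqP := congr1 absz ad; rewrite abszM muln_eq1 => /andP[/eqP ha /eqP hd].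
    have [ea|ea] : a = 1 \/ a = -1 by lia.
      by left; rewrite ea in ad; lia.
    by right; rewrite ea in ad; lia.
  have [M hM] := theta_bounded theta_term_hassum hh; exists (M ^+ 2) => tau h1.
  rewrite c0 mul0r add0r.
  have [k ->] : exists k : int, (a%:~R * tau + b%:~R) / d%:~R = tau + k%:~R :> C.
    case: hd => -[-> ->]; first by exists b; rewrite mul1r divr1.
    by exists (- b); rewrite !mulrNz mulN1r invrN invr1 mulrN mulr1 opprD opprK.
  have cd : cabs (d%:~R : C) = 1 by case: hd => -[_ ->]; rewrite ?mulrNz ?cabsN cabs1.
  rewrite [leLHS]cabsM [X in X * _]cabsV [X in X^-1 * _]cabsX cd expr1n invr1 mul1r [leLHS]cabsX.
  have h2 : 1 <= complex.Im (tau + k%:~R) by rewrite -(rmorph_int (real_complex R)) Im_add /= addr0.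
  have h3 := hM _ h2; have h4 := cabs_ge0 (theta h L (tau + k%:~R)).
  by rewrite ler_pXn2r ?nnegrE//; lra.
- have [||M hM] := pos (- a) (- b) (absz c) (- d).
  + by lia.
  + by rewrite ltz0_abs// -hdet; ring.
  exists M => tau h1; have := hM tau h1.
  have -> : (absz c)%:R = - c%:~R :> C by rewrite -mulrNz -ltz0_abs.
  rewrite !mulrNz !mulNr -!opprD invrN mulrNN.
  have absN (J T : C) k : cabs ((- J) ^- k * T) = cabs (J ^- k * T).
    rewrite [LHS]cabsM [RHS]cabsM; congr (_ * _).
    by rewrite [LHS]cabsV [RHS]cabsV [cabs ((- J) ^+ k)]cabsX [cabs (J ^+ k)]cabsX cabsN.
  by rewrite absN.
- have [||M hM] := pos a b (absz c) d.
  + by lia.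
  + by rewrite gtz0_abs.
  exists M => tau h1; have := hM tau h1.
  by have -> : (absz c)%:R = c%:~R :> C by rewrite -[in RHS](gtz0_abs cpos).
Qed.

(** Parametrised by coordinates in a basis, every term depends only on inner products, hence on the
    Gram matrix; two embeddings are compared in this form. *)
Lemma Theta_gram (m d : nat) (h : 'I_d -> mpoly n R) tau :
  Harm_orthonormal_basis (2 * m) h -> 0 < complex.Im tau ->
  hassum (fun z : 'rV[int]_n * 'rV[int]_n =>
    (zonal_term m (map_mx intr z.1 *m B) (map_mx intr z.2 *m B))%:K *
    cexp (tpi * tau * (dot (map_mx intr z.1 *m B) (map_mx intr z.1 *m B) +
                       dot (map_mx intr z.2 *m B) (map_mx intr z.2 *m B))%:K)) (Theta h L tau).
Proof.
move=> hh ht; have hs := Theta_hassum theta_term_hassum hh ht.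
pose f (z : 'rV[int]_n) : 'rV[R]_n := map_mx intr z *m B.
have finj : injective f.
  move=> x y /(congr1 (mulmx^~ (invmx B))); rewrite /f /= !mulmxK ?hB.1// => e.
  by apply/rowP => i; apply: (@intr_inj R); move/rowP : e => /(_ i); rewrite !mxE.
have Lf z : L (f z) by rewrite hB.2; exists z.
have inj : injective (fun z : 'rV[int]_n * 'rV[int]_n => (f z.1, f z.2)).
  by move=> [x y] [x' y'] /= [/finj -> /finj ->].
apply: eq_hassum (hassum_comp inj _ hs) => [z|p].
  by rewrite /= /pair_term /indL /= (asboolT (Lf z.1)) (asboolT (Lf z.2)) !mul1r.
rewrite /pair_term /indL; case: asboolP => [|_]; last by rewrite !mul0r eqxx.
case: asboolP => [|_]; last by rewrite mulr0 !mul0r eqxx.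
by case: p => v w /=; rewrite hB.2 => -[y ->] [x ->] _; exists (x, y).
Qed.

(** * The dual basis and the level *)

Section LevelData.
Variable N : nat.
Hypothesis hN : basis_level B N.

Let A := 2 *: (B *m B^T).
(** The rows of [A^-1 B], that is, the basis dual to [B] for the pairing [2 <v, w>]. *)
Let u (i : 'I_n) : 'rV[R]_n := row i (invmx A) *m B.

Let uA : A \in unitmx.
Proof.
by rewrite /A unitmxZ ?unitfE ?pnatr_eq0// unitmx_mul unitmx_tr hB.1.
Qed.

Lemma level_dual (z : 'rV[R]_n) i : 2 * dot (u i) (z *m B) = z 0 i.
Proof.
rewrite dot_mx /u trmx_mul !mulmxA -[_ *m B *m B^T]mulmxA.
have gen (r : 'rV[R]_n) (G : 'M[R]_n) (t : 'cV[R]_n) : 2 * (r *m G *m t) 0 0 = (r *m (2 *: G) *m t) 0 0.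
  by rewrite -scalemxAr -scalemxAl [RHS]mxE.
rewrite gen -/A -row_mul.
by rewrite mulVmx// row1 -rowE !mxE.
Qed.

Lemma level_family : (0 < N)%N /\
  [/\ forall i v, L v -> exists k : int, 2 * dot (u i) v = k%:~R,
      forall w, (forall i, exists k : int, 2 * dot (u i) w = k%:~R) -> L w,
      forall i, L (N%:R *: u i) &
      forall i, exists k : int, N%:R * dot (u i) (u i) = k%:~R].
Proof.
have [N0 [entries diag] _] := hN; split => //; split.
- by move=> i v; rewrite hB.2 => -[z ->]; exists (z 0 i); rewrite level_dual mxE.
- move=> w /choice[k hk]; rewrite hB.2; exists (\row_i k i).
  rewrite -[LHS](mulmxKV hB.1); congr (_ *m _); apply/rowP => i; rewrite !mxE -hk.
  by rewrite -[in RHS](mulmxKV hB.1 w) level_dual mxE.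
- move=> i; have /choice[k hk] : forall j, exists k : int, (N%:R *: invmx A) i j = k%:~R.
    by move=> j; have /intrP[k ->] := entries i j; exists k.
  rewrite hB.2; exists (\row_j k j); rewrite /u scalemxAl; congr (_ *m _).
  by apply/rowP => j; rewrite !mxE -hk mxE.
- move=> i; have [k hk] := diag i; exists k.
  have -> : dot (u i) (u i) = invmx A i i / 2.
    have := level_dual (row i (invmx A)) i; rewrite -/(u i) [RHS]mxE => <-.
    by rewrite mulrAC divff ?mul1r// pnatr_eq0.
  by move: hk; rewrite mxE mulrA -/A => ->; rewrite intrM mulrAC divff ?mul1r// pnatr_eq0.
Qed.

Theorem theta_modular (a b c d : int) (tau : C) (m : nat) h : (N%:Z %| c)%Z ->
  a * d - b * c = 1 -> 0 < complex.Im tau -> Harm (2 * m) h ->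
  theta h L ((a%:~R * tau + b%:~R) / (c%:~R * tau + d%:~R)) ^+ 2 =
  (level_chi n d)%:~R * (c%:~R * tau + d%:~R) ^+ (4 * m + n) * theta h L tau ^+ 2.
Proof.
have [P [mu [K [K0 mu0 hP LP PL]]]] := orthogonal_superlattice hB hint.
have [N0 [hu1 hu2 hu3 hu4]] := level_family.
exact: (theta_level mu0 hP K0 (lattice0 hB) (latticeD hB) (latticeZ hB)
    (lattice_norm_int hint) (lattice_dot_int hB hint) LP PL N0 hu1 hu2 hu3 hu4).
Qed.

Lemma level_odd : odd n -> (4 %| N)%N.
Proof.
have [P [mu [K [K0 mu0 hP LP PL]]]] := orthogonal_superlattice hB hint.
have [N0 [hu1 hu2 hu3 hu4]] := level_family.
exact: (level_dvd4 mu0 hP K0 (lattice0 hB) (latticeD hB) (latticeZ hB)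
    (lattice_norm_int hint) (lattice_dot_int hB hint) LP PL N0 hu1 hu2 hu3 hu4).
Qed.

End LevelData.

End Lattice.

(** For odd [n], divisibility of [N] by 4 gives [chi4] the period [N] and makes every integer prime
    to [N] odd, where [chi4] does not vanish. *)
Lemma dirichlet_level_chi {R : realType} (n N : nat) : (odd n -> (4 %| N)%N) ->
  dirichlet_character N (fun a => (if coprimez a N%:Z then (level_chi n a)%:~R else 0) : R[i]).
Proof.
move=> hN; split.
- have -> : coprimez 1 N%:Z by apply/coprimezP; exists (1, 0); rewrite /= mul0r addr0 mulr1.
  by rewrite /level_chi; case: ifP.
- move=> a b; rewrite coprimezMl; case: (coprimez a _); case: (coprimez b _); rewrite ?mulr0 ?mul0r//=.
  by rewrite -intrM /level_chi; case: ifP => _; rewrite ?chi4M ?mulr1.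
- move=> a; have -> : coprimez (a + N%:Z) N%:Z = coprimez a N%:Z.
    apply/coprimezP/coprimezP => -[[p q] /= hpq].
      by exists (p, p + q); rewrite /=; apply: etrans hpq; ring.
    by exists (p, q - p); rewrite /=; apply: etrans hpq; ring.
  rewrite /level_chi; case: (boolP (odd n)) => on //; have /dvdnP[k hk] := hN on.
  by rewrite (@chi4_mod (a + N%:Z) a k%:Z)// hk PoszM; ring.
- move=> a; case: ifPn => [co|_]; last by rewrite eqxx.
  rewrite intr_eq0 /level_chi; case: ifP => // on; have /dvdnP[k hk] := hN on.
  have : chi4 a ^+ 2 = 1.
    apply: chi4_odd; have /coprimezP[[p q] /= hpq] := co.
    have [y [ha|ha]] : exists y, a = 2 * y \/ a = 2 * y + 1 by exists (a %/ 2)%Z; lia.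
      have : 2 * (p * y + 2 * (q * k%:Z)) = 1 by apply: etrans hpq; rewrite ha hk PoszM; ring.
      by lia.
    by rewrite ha; lia.
  by apply: contra_eq_neq => ->; rewrite expr0n.
Qed.

(** * Independence of the isometric embedding *)

Section Isometry.
Context {R : realType}.
Variables (n : nat) (L : set 'rV[R]_n) (B : 'M[R]_n) (phi : 'rV[R]_n -> 'rV[R]_n).
Hypothesis hB : lattice_basis L B.
Hypothesis hphi : isometric_embedding L phi.

Lemma isometry_dot v w : L v -> L w -> dot (phi v) (phi w) = dot v w.
Proof.
move=> Lv Lw; have [hadd hn] := hphi.
have nrm x : L x -> dot (phi x) (phi x) = dot x x by move=> /hn e; rewrite -!enorm_sqr e.
have := nrm _ (latticeD hB Lv Lw); rewrite hadd// !dotDl !dotDr !nrm//.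
rewrite (dotC w v) (dotC (phi w)); lra.
Qed.

(** [phi] is known to be additive on [L] only, so [B'] is built from the images of the basis
    vectors. The defect [F] is additive and vanishes on unit vectors, hence everywhere; [B'] is
    invertible because its Gram matrix is. *)
Lemma isometry_basis : exists B' : 'M[R]_n, lattice_basis (phi @` L) B' /\ B' *m B'^T = B *m B^T.
Proof.
have [hadd hn] := hphi; pose B' : 'M[R]_n := \matrix_i phi (row i B).
have gram : B' *m B'^T = B *m B^T.
  apply/matrixP => i j; transitivity (dot (phi (row i B)) (phi (row j B))).
    by rewrite mxE; apply: eq_bigr => k _; rewrite !mxE.
  rewrite isometry_dot; [|exact: (lattice_row hB) ..].
  by rewrite [RHS]mxE; apply: eq_bigr => k _; rewrite !mxE.
pose f (z : 'rV[int]_n) : 'rV[R]_n := map_mx intr z *m B.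
have Lf z : L (f z) by rewrite hB.2; exists z.
pose F z := phi (f z) - map_mx intr z *m B'.
have FD x y : F (x + y) = F x + F y.
  by rewrite /F /f map_mxD !mulmxDl hadd; [rewrite opprD addrACA | exact: Lf ..].
have F0 : F 0 = 0 by apply: (addrI (F 0)); rewrite -FD !addr0.
have FN x : F x = 0 -> F (- x) = 0.
  by move=> h; have := FD x (- x); rewrite subrr F0 h add0r => <-.
have Fe i : F (delta_mx 0 i) = 0.
  rewrite /F /f map_delta_mx -!rowE /B' rowK subrr.
  by [].
have Fk (k : int) x : F x = 0 -> F (k *: x) = 0.
  move=> h; have nat_case (j : nat) : F (j%:Z *: x) = 0.
    elim: j => [|j IH]; first by rewrite scale0r.
    have -> : j.+1%:Z = j%:Z + 1 by rewrite -addn1.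
    by rewrite scalerDl FD IH scale1r h addr0.
  by case: k => j; [exact: nat_case | rewrite NegzE scaleNr; exact/FN/nat_case].
have Fz z : F z = 0.
  rewrite [z]row_sum_delta; elim/big_rec : _ => // i x _ hx.
  by rewrite FD hx addr0; exact/Fk/Fe.
exists B'; split => //; split.
  have : B' *m B'^T \in unitmx by rewrite gram unitmx_mul unitmx_tr hB.1.
  by rewrite unitmx_mul => /andP[].
have phiE z : phi (f z) = map_mx intr z *m B' by apply/eqP; rewrite -subr_eq0; exact/eqP/Fz.
apply/seteqP; split => [w [v + <-]|w [z ->]].
  by rewrite hB.2 => -[z ->]; exists z; exact: phiE.
by exists (f z); [exact: Lf | exact: phiE].
Qed.

Lemma isometry_Theta (m d d' : nat) (h : 'I_d -> mpoly n R) (h' : 'I_d' -> mpoly n R) tau :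
  integral_lattice L -> Harm_orthonormal_basis (2 * m) h -> Harm_orthonormal_basis (2 * m) h' ->
  0 < complex.Im tau -> Theta h' (phi @` L) tau = Theta h L tau.
Proof.
move=> hint hh hh' ht; have [B' [hB' gram]] := isometry_basis.
have hint' : integral_lattice (phi @` L).
  by move=> _ [v Lv <-]; rewrite (hphi.2 _ Lv); exact: hint.
apply: hassum_unique (Theta_gram hB' hint' hh' ht) _.
have dotE (x y : 'rV[R]_n) : dot (x *m B') (y *m B') = dot (x *m B) (y *m B).
  rewrite !dot_mx !trmx_mul !mulmxA -[x *m B' *m _]mulmxA gram.
  by rewrite -[x *m B *m B^T]mulmxA.
apply: eq_hassum (Theta_gram hB hint hh ht) => z.
by rewrite !dotE !zonal_termE; under [in RHS]eq_bigr do rewrite !dotE.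
Qed.

End Isometry.

Lemma det_2x2 (F : comNzRingType) (g : 'M[F]_2) : \det g = g 0 0 * g 1 1 - g 0 1 * g 1 0.
Proof.
rewrite (expand_det_row _ 0) big_ord_recl big_ord1 /cofactor !det_mx11 !mxE /=.
rewrite expr0 mul1r expr1 mulN1r mulrN.
have e1 : lift 0 0 = 1 :> 'I_2 by apply/val_inj.
have e2 : lift 1 0 = 0 :> 'I_2 by apply/val_inj.
by rewrite !e1 e2.
Qed.

Theorem theorem3p3 (R : realType) (n m N d : nat) (L : set 'rV[R]_n)
    (h : 'I_d -> mpoly n R)
    (hL : full_rank_lattice L) (hint : integral_lattice L)
    (hN : lattice_level L N) (hh : Harm_orthonormal_basis (2 * m) h) :
  [/\ exists chi : int -> R[i],
        [/\ dirichlet_character N chi,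
            ~~ odd n -> principal_character N chi &
            modular_form (4 * m + n) N chi (Theta h L)],
      forall phi, isometric_embedding L phi ->
        forall (d' : nat) (h' : 'I_d' -> mpoly n R),
          Harm_orthonormal_basis (2 * m) h' ->
          forall tau, upper_half_plane tau ->
            Theta h' (phi @` L) tau = Theta h L tau,
      qexpansion (Theta h L) (fun k => (Theta_coef m L k)%:C%C) &
      (0 < m)%N -> forall mu : nat, minimal_norm L mu ->
        exists b : nat -> int,
          qexpansion
            (fun tau => ((2 * m)`!%:R * 2 ^+ (2 * m) * pfactor_prod n m m)%:C%C
                        / nome tau ^+ (2 * mu) * Theta h L tau)
            (fun k => (b k)%:~R)].
Proof.
have [B [hB hlev]] := hN; have [hharm _ _] := hh.
have hsum := theta_term_hassum hB hint.
have Ln := lattice_norm_int hint; have Ld := lattice_dot_int hB hint.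
split.
- have chiP := @dirichlet_level_chi R n N (level_odd hB hint hlev).
  exists (fun a => if coprimez a N%:Z then (level_chi n a)%:~R else 0); split => //.
    by move=> on a co; rewrite co /level_chi (negbTE on).
  split.
  + move=> tau ht; have -> : (Theta h L : R[i]^o -> R[i]^o) =
        \sum_(j < d) ((theta (h j) L : R[i]^o -> R[i]^o) ^+ 2).
      by apply/funext => z; rewrite /Theta fct_sumE; apply: eq_bigr => j _; rewrite exprfctE.
    by apply: derivable_sum => j; apply: derivableX; exact: (theta_derivable hsum (hharm j) ht).
  + move=> g hg Ng tau ht; have hdet : g 0 0 * g 1 1 - g 0 1 * g 1 0 = 1 by rewrite -det_2x2.
    have co : coprimez (g 1 1) N%:Z.
      by have /dvdzP[c hc] := Ng; apply/coprimezP; exists (g 0 0, - (g 0 1 * c)); rewrite /= -hdet hc; ring.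
    rewrite co /Theta mulr_sumr; apply: eq_bigr => j _.
    exact: (theta_modular hB hint hlev Ng hdet ht (hharm j)).
  + move=> g hg; have hdet : g 0 0 * g 1 1 - g 0 1 * g 1 0 = 1 by rewrite -det_2x2.
    have /choice[M hM] := fun j => theta_slash_bounded hB hint hdet (hharm j).
    exists 1, (\sum_(j < d) M j) => tau ht h1; rewrite cabsE lecR /slash /Theta mulr_sumr.
    by apply: le_trans (cabs_sum _ _ _) _; apply: ler_sum => j _; exact: hM.
- by move=> phi hphi d' h' hh' tau ht; exact: (isometry_Theta hB hphi hint hh hh' ht).
- by apply: hassum_qexpansion => tau ht; exact: (Theta_series Ln hsum hh ht).
(* A nonzero lattice vector forces [0 < n], which makes the factors of [pfactor_prod] positive. *)
- move=> m0 mu hmu; have n0 : (0 < n)%N.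
    have [[v [_ v0 _]] _] := hmu; rewrite lt0n; apply: contra_neq v0 => n0.
    by apply/rowP => -[i lti]; exfalso; move: lti; rewrite n0.
  exact: (Theta_integral Ln hsum Ld n0 m0 hh hmu).
Qed.
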